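(* The optimal values of the reduced planner's problem (CP$^{\rm r}$) and of the reduced bidding model (C$^{\rm r}$) are equal, and they are smaller than or equal to the optimal value of the bidding model (C). All three problems are defined in the context.
   Context: **Time.** Days $\mathcal D=\{1,\dots,D\}$, hours $\mathcal T=\{1,\dots,T\}$, $H=T/D\in\mathbb N$ hours per day; $t=0$ is the present. $\mathcal T(d)=\{(d-1)H+1,\dots,dH\}$ is the set of hours of day $d$; $\uparrow(d)=dH$ (last hour of day $d$), $\downarrow(d)=(d-1)H+1$ (first hour of day $d$), $\Downarrow(d)=(d-1)H$ (last hour of day $d-1$). For an hour $t$ in day $d(t)$ put $\uparrow(t)=\uparrow(d(t))$, $\downarrow(t)=\downarrow(d(t))$, $\Downarrow(t)=\Downarrow(d(t))$. **Reservoir system.** A directed acyclic graph with node (reservoir) set $\mathcal R$, $|\mathcal R|=R$, and arc set $\mathcal A$, $|\mathcal A|=A$; arcs point from upstream to downstream reservoirs. $\mathbf M\in\{-1,0,1\}^{R\times A}$ is its incidence matrix: $m_{r,a}=-1$ if arc $a$ leaves $r$, $+1$ if $a$ enters $r$, $0$ otherwise. Node $R$ is the unique sink (a dummy reservoir/river); every other node has at least one outgoing arc. Deterministic data for $t\in\mathcal T$: reservoir bounds $\underline{\bm w}_t\in\mathbb R_+^R$, $\overline{\bm w}_t\in(\mathbb R_+\cup\{+\infty\})^R$ with $\underline w_{t,R}=0$, $\overline w_{t,R}=+\infty$; generator and pump capacities $\overline{\bm g}_t,\overline{\bm p}_t\in\mathbb R_+^A$ (arcs entering node $R$ have no pumps,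 i.e. pump capacity $0$); generator efficiencies $\bm\eta_t\in\mathbb R_+^A$ and inverse pump efficiencies $\bm\zeta_t\in\mathbb R_+^A$ with $\bm\eta_t<\bm\zeta_t$ componentwise. The initial filling levels $\bm w_0\in\mathbb R^R$ are deterministic. For days, $\underline{\bm w}_d:=\underline{\bm w}_{\uparrow(d)}$ and $\overline{\bm w}_d:=\overline{\bm w}_{\uparrow(d)}$; the symbol $\bm w_d$ (index $d\in\mathcal D$) denotes end-of-day filling levels. **Uncertainty.** All random objects live on a probability space $(\Omega,\mathcal F,\mathbb P)$ and have finite expectations. For each $t\in\mathcal T$: spot price $\pi^{\rm s}_t$, capacity prices $\pi^{\rm u}_t,\pi^{\rm v}_t$ and activation prices $\psi^{\rm u}_t,\psi^{\rm v}_t$ (real-valued); inflows $\bm\phi_t\in\mathbb R_+^R$; reserve allocations $\kappa^{\rm u}_t,\kappa^{\rm v}_t$ (Bernoulli); reserve activations $(\rho^{\rm u}_t,\rho^{\rm v}_t)$ with support $\{(\rho^{\rm u},\rho^{\rm v})\in[0,\overline\rho^{\rm u}_t]\times[0,\overline\rho^{\rm v}_t]:\rho^{\rm u}+\rho^{\rm v}\le1\}$, where $\overline\rho^{\rm u}_t,\overline\rho^{\rm v}_t\in(0,1]$. The pairs $(\rho^{\rm u}_t,\rho^{\rm v}_t)$ are independent across $t$ and independent of all other random variables. The pairs $(\kappa^{\rm u}_t,\kappa^{\rm v}_t)$ are likewise independent across $t$ and independent of all other random variables, with success probabilities in $(0,1)$. Information: $\bm\xi_t$ collects the variables revealed in hour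 $t\in\{0\}\cup\mathcal T$, namely: $(\psi^{\rm u}_t,\psi^{\rm v}_t,\rho^{\rm u}_t,\rho^{\rm v}_t)$ if $t\ge1$; in addition $\{(\kappa^{\rm u}_\tau,\kappa^{\rm v}_\tau)\}_{\tau=t}^{t+H-1}$ if $t$ is the first hour of a day; in addition $\{(\pi^{\rm s}_\tau,\pi^{\rm u}_\tau,\pi^{\rm v}_\tau,\bm\phi_\tau)\}_{\tau=t+1}^{t+H}$ if $t=\Downarrow(\tau')$ for some $\tau'\in\mathcal T$ (including $t=0$). $\bm\xi_{[t,t']}=(\bm\xi_t,\dots,\bm\xi_{t'})$, $\mathcal F_{[t,t']}=\sigma(\bm\xi_{[t,t']})$, $\bm\xi_{[t']}=\bm\xi_{[0,t']}$, $\mathcal F_{[t']}=\mathcal F_{[0,t']}$. $\mathcal L^k(\mathcal G)$ is the set of integrable $\mathcal G$-measurable functions $\Omega\to\mathbb R^k$, $\mathcal L=\mathcal L^1$. $\mathbb P_{|\bm\xi_{[\Downarrow(d)]}}$ is $\mathbb P$ conditioned on $\bm\xi_{[\Downarrow(d)]}$. The supremum over an empty set is $-\infty$. **Bidding model (C):** $$\sup\ \sum_{t\in\mathcal T}\mathbb E\big[\pi^{\rm s}_ts_t+\kappa^{\rm u}_t(\pi^{\rm u}_t+\rho^{\rm u}_t\psi^{\rm u}_t)u_t+\kappa^{\rm v}_t(\pi^{\rm v}_t+\rho^{\rm v}_t\psi^{\rm v}_t)v_t\big]$$ over $s_t,u_t,v_t\in\mathcal L(\mathcal F_{[\Downarrow(t)]})$,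 $\bm g_t,\bm p_t,\bm z_t\in\mathcal L^A(\mathcal F_{[t]})$ and hourly levels $\bm w_t\in\mathcal L^R(\mathcal F_{[t]})$, $t\in\mathcal T$, subject to, for all $t\in\mathcal T$, $\mathbb P$-a.s.: $0\le u_t$, $0\le v_t$, $\bm0\le\bm g_t\le\overline{\bm g}_t$, $\bm0\le\bm p_t\le\overline{\bm p}_t$, $\bm0\le\bm z_t$; $s_t+\kappa^{\rm u}_t\rho^{\rm u}_tu_t-\kappa^{\rm v}_t\rho^{\rm v}_tv_t=\bm\eta_t^\top\bm g_t-\bm\zeta_t^\top\bm p_t$; $\bm w_t=\bm w_{t-1}+\bm\phi_t+\mathbf M(\bm g_t-\bm p_t+\bm z_t)$; $\underline{\bm w}_t\le\bm w_t\le\overline{\bm w}_t$. **Trader's problem.** $\Pi_d(\bm w_{d-1},\bm w_d,\bm\xi_{[\Downarrow(d)]})$ is the optimal value ($-\infty$ if infeasible) of $$\sup\ \sum_{t\in\mathcal T(d)}\mathbb E\big[\pi^{\rm s}_ts_t+\kappa^{\rm u}_t(\pi^{\rm u}_t+\rho^{\rm u}_t\psi^{\rm u}_t)u_t+\kappa^{\rm v}_t(\pi^{\rm v}_t+\rho^{\rm v}_t\psi^{\rm v}_t)v_t\,\big|\,\bm\xi_{[\Downarrow(d)]}\big]$$ over $s_t,u_t,v_t\in\mathbb R$, $\bm g_t,\bm p_t,\bm z_t\in\mathcal L^A(\mathcal F_{[\downarrow(d),t]})$, $t\in\mathcal T(d)$, subject to, $\mathbb P_{|\bm\xi_{[\Downarrow(d)]}}$-a.s.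 for all $t\in\mathcal T(d)$: $0\le u_t$, $0\le v_t$, $\bm0\le\bm g_t\le\overline{\bm g}_t$, $\bm0\le\bm p_t\le\overline{\bm p}_t$, $\bm0\le\bm z_t$; $s_t+\kappa^{\rm u}_t\rho^{\rm u}_tu_t-\kappa^{\rm v}_t\rho^{\rm v}_tv_t=\bm\eta_t^\top\bm g_t-\bm\zeta_t^\top\bm p_t$; $\underline{\bm w}_t\le\bm w_{d-1}+\sum_{\tau=\downarrow(d)}^t[\bm\phi_\tau+\mathbf M(\bm g_\tau-\bm p_\tau+\bm z_\tau)]\le\overline{\bm w}_t$; and $\bm w_d\le\bm w_{d-1}+\sum_{\tau\in\mathcal T(d)}[\bm\phi_\tau+\mathbf M(\bm g_\tau-\bm p_\tau+\bm z_\tau)]$. **Reduced planner's problem (CP$^{\rm r}$):** $\sup\sum_{d\in\mathcal D}\mathbb E[\Pi_d(\bm w_{d-1},\bm w_d,\bm\xi_{[\Downarrow(d)]})]$ over $\bm w_d\in\mathcal L^R(\mathcal F_{[\Downarrow(d)]})$ with $\underline{\bm w}_d\le\bm w_d\le\overline{\bm w}_d$ $\mathbb P$-a.s., $d\in\mathcal D$. **Reduced bidding model (C$^{\rm r}$):** with, for $t\in\mathcal T(d)$, $\tilde\pi^{\rm s}_t=\mathbb E[\pi^{\rm s}_t|\bm\xi_{[\Downarrow(d)]}]$, $\tilde\pi^{\rm u}_t=\mathbb E[\kappa^{\rm u}_t(\pi^{\rm u}_t+\rho^{\rm u}_t\psi^{\rm u}_t)|\bm\xi_{[\Downarrow(d)]}]$,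 $\tilde\pi^{\rm v}_t=\mathbb E[\kappa^{\rm v}_t(\pi^{\rm v}_t+\rho^{\rm v}_t\psi^{\rm v}_t)|\bm\xi_{[\Downarrow(d)]}]$, $$\sup\ \sum_{t\in\mathcal T}\mathbb E\big[\tilde\pi^{\rm s}_ts_t+\tilde\pi^{\rm u}_tu_t+\tilde\pi^{\rm v}_tv_t\big]$$ over $s_t,u_t,v_t\in\mathcal L(\mathcal F_{[T]})$, $\bm g_t,\bm p_t,\bm z_t\in\mathcal L^A(\mathcal F_{[T]})$, $\bm w_d\in\mathcal L^R(\mathcal F_{[\Downarrow(d)]})$, subject to, $\mathbb P$-a.s. for all $d\in\mathcal D$, $t\in\mathcal T(d)$: $0\le u_t$, $0\le v_t$, $\bm0\le\bm g_t\le\overline{\bm g}_t$, $\bm0\le\bm p_t\le\overline{\bm p}_t$, $\bm0\le\bm z_t$; $s_t+\overline\rho^{\rm u}_tu_t=\bm\eta_t^\top\bm g_t-\bm\zeta_t^\top\bm p_t$; $s_t-\overline\rho^{\rm v}_tv_t\ge-\bm\zeta_t^\top\overline{\bm p}_t$; $\underline{\bm w}_t\le\bm w_{d-1}+\sum_{\tau=\downarrow(d)}^t[\bm\phi_\tau+\mathbf M(\bm g_\tau-\bm p_\tau+\bm z_\tau)]\le\overline{\bm w}_t$; $\bm w_d\le\bm w_{d-1}+\sum_{\tau\in\mathcal T(d)}[\bm\phi_\tau+\mathbf M(\bm g_\tau-\bm p_\tau+\bm z_\tau)]$; $\underline{\bm w}_d\le\bm w_d\le\overline{\bm w}_d$.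 *)

(* Defs.v *)
From HB Require Import structures.
From mathcomp Require Import all_boot all_order all_algebra.
From mathcomp Require Import all_classical all_reals all_analysis.
From mathcomp Require Import measurable_realfun.

Set Implicit Arguments.
Unset Strict Implicit.
Unset Printing Implicit Defensive.

Import Order.TTheory GRing.Theory Num.Theory.
Import numFieldNormedType.Exports.

Local Open Scope classical_set_scope.
Local Open Scope ring_scope.

Section vectors.
Context {R : realType}.

Definition lev n (x y : 'cV[R]_n) : Prop := forall i, x i ord0 <= y i ord0.

Definition leve n (x : 'cV[R]_n) (y : 'cV[\bar R]_n) : Prop :=
  forall i, ((x i ord0)%:E <= y i ord0)%E.

Definition dotv n (x y : 'cV[R]_n) : R := (x^T *m y) ord0 ord0.

End vectors.

Section random_variables.
Context {R : realType} {disp : measure_display} {Omega : measurableType disp}.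
Implicit Types (S : set (Omega -> R)) (X Y f : Omega -> R).

Definition rv_gen S : set (set Omega) :=
  \bigcup_(X in S) preimage_set_system setT X measurable.

(* The sigma-algebra generated by a set of real random variables, which is also
   the one generated by the random vector listing them. *)
Definition sigma_rv S : set (set Omega) := <<s rv_gen S >>.

Definition measurable_wrt S f : Prop :=
  measurable_fun [set: g_sigma_algebraType (rv_gen S)]
    (f : g_sigma_algebraType (rv_gen S) -> R).

Definition inL (mu : probability Omega R) S f : Prop :=
  measurable_wrt S f /\ mu.-integrable setT (EFin \o f).

Definition inLv (mu : probability Omega R) S n (f : Omega -> 'cV[R]_n) : Prop :=
  forall i, inL mu S (fun om => f om i ord0).

Definition is_cond_exp (P : probability Omega R) S X Y : Prop :=
  inL P S Y /\
  forall B, sigma_rv S B ->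
    (\int[P]_(om in B) (Y om)%:E = \int[P]_(om in B) (X om)%:E)%E.

(* K is a regular version of the conditional probability P( . | S). *)
Definition is_regular_cond_prob (P : probability Omega R) S
    (K : Omega -> probability Omega R) : Prop :=
  forall A : set Omega, measurable A ->
    measurable_fun [set: g_sigma_algebraType (rv_gen S)]
      (fun om : g_sigma_algebraType (rv_gen S) => K om A) /\
    forall B, sigma_rv S B -> (P (A `&` B) = \int[P]_(om in B) K om A)%E.

Definition mutually_independent (P : probability Omega R) (I : eqType)
    (D : set I) (F : I -> set (set Omega)) : Prop :=
  forall (J : seq I) (A : I -> set Omega), uniq J ->
    (forall i, i \in J -> D i /\ F i (A i)) ->
    (P (\bigcap_(i in [set` J]) A i) = \prod_(i <- J) P (A i))%E.

Definition rv_support (T : topologicalType) (P : probability Omega R)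
    (X : Omega -> T) : set T :=
  [set x | forall U : set T, open U -> U x -> (0 < P (X @^-1` U))%E].

End random_variables.

Record hydro_system (R : realType) := HydroSystem {
  ndays : nat;
  hpd : nat; (* hours per day *)
  ndays_gt0 : (0 < ndays)%N;
  hpd_gt0 : (0 < hpd)%N;
  nupper : nat; (* number of reservoirs other than the sink *)
  narcs : nat;
  arc_src : 'I_narcs -> 'I_nupper.+1;
  arc_tgt : 'I_narcs -> 'I_nupper.+1;
  acyclic : forall c : seq 'I_nupper.+1,
    cycle (fun r r' => [exists a, (arc_src a == r) && (arc_tgt a == r')]) c ->
    c = [::];
  sink_no_out : forall a, arc_src a != ord_max;
  nonsink_out : forall r, r != ord_max -> exists a, arc_src a = r;
  wlo : nat -> 'cV[R]_nupper.+1;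
  whi : nat -> 'cV[\bar R]_nupper.+1;
  gmax : nat -> 'cV[R]_narcs;
  pmax : nat -> 'cV[R]_narcs;
  eta : nat -> 'cV[R]_narcs;
  zeta : nat -> 'cV[R]_narcs;
  w0 : 'cV[R]_nupper.+1;
  wlo_ge0 : forall t, (1 <= t <= ndays * hpd)%N -> lev 0 (wlo t);
  whi_ge0 : forall t, (1 <= t <= ndays * hpd)%N -> leve 0 (whi t);
  wlo_sink : forall t, (1 <= t <= ndays * hpd)%N -> wlo t ord_max ord0 = 0;
  whi_sink : forall t, (1 <= t <= ndays * hpd)%N -> whi t ord_max ord0 = +oo%E;
  gmax_ge0 : forall t, (1 <= t <= ndays * hpd)%N -> lev 0 (gmax t);
  pmax_ge0 : forall t, (1 <= t <= ndays * hpd)%N -> lev 0 (pmax t);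
  pmax_sink : forall t, (1 <= t <= ndays * hpd)%N ->
    forall a, arc_tgt a = ord_max -> pmax t a ord0 = 0;
  eta_ge0 : forall t, (1 <= t <= ndays * hpd)%N -> lev 0 (eta t);
  zeta_ge0 : forall t, (1 <= t <= ndays * hpd)%N -> lev 0 (zeta t);
  eta_lt_zeta : forall t, (1 <= t <= ndays * hpd)%N ->
    forall a, eta t a ord0 < zeta t a ord0 }.

Section time_and_graph.
Context {R : realType} (S : hydro_system R).

Definition nhours : nat := (ndays S * hpd S)%N.
Definition is_day (d : nat) : bool := (1 <= d <= ndays S)%N.
Definition is_hour (t : nat) : bool := (1 <= t <= nhours)%N.
Definition first_hour (d : nat) : nat := (d.-1 * hpd S).+1.
Definition last_hour (d : nat) : nat := (d * hpd S)%N.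
Definition prev_last_hour (d : nat) : nat := (d.-1 * hpd S)%N.
Definition day_of (t : nat) : nat := (t.-1 %/ hpd S).+1.
Definition in_day (d t : nat) : bool := (first_hour d <= t <= last_hour d)%N.

Definition level := 'cV[R]_(nupper S).+1.
Definition flow := 'cV[R]_(narcs S).

Definition incidence : 'M[R]_((nupper S).+1, narcs S) :=
  \matrix_(r, a) if arc_src a == r then -1
                 else if arc_tgt a == r then 1 else 0.

Definition energy (t : nat) (g p : flow) : R :=
  dotv (eta S t) g - dotv (zeta S t) p.

Definition bounds (t : nat) (u v : R) (g p z : flow) : Prop :=
  [/\ 0 <= u, 0 <= v,
      lev 0 g /\ lev g (gmax S t), lev 0 p /\ lev p (pmax S t) & lev 0 z].

Definition level_bounds (t : nat) (w : level) : Prop :=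
  lev (wlo S t) w /\ leve w (whi S t).

End time_and_graph.

(* Values at indices other than hours play no role. *)
Record market (R : realType) (S : hydro_system R) (disp : measure_display)
    (Omega : measurableType disp) (P : probability Omega R) := Market {
  pi_s : nat -> {RV P >-> R};
  pi_u : nat -> {RV P >-> R};
  pi_v : nat -> {RV P >-> R};
  psi_u : nat -> {RV P >-> R};
  psi_v : nat -> {RV P >-> R};
  phi : nat -> 'I_(nupper S).+1 -> {RV P >-> R};
  kappa_u : nat -> {RV P >-> bool};
  kappa_v : nat -> {RV P >-> bool};
  rho_u : nat -> {RV P >-> R};
  rho_v : nat -> {RV P >-> R};
  rhobar_u : nat -> R;
  rhobar_v : nat -> R }.

Section model.
Context {R : realType} {S : hydro_system R} {disp : measure_display}
  {Omega : measurableType disp} {P : probability Omega R} (X : market S P).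

Definition kapu (t : nat) (om : Omega) : R := (kappa_u X t om)%:R.
Definition kapv (t : nat) (om : Omega) : R := (kappa_v X t om)%:R.
Definition inflow (t : nat) (om : Omega) : level S := \col_r phi X t r om.

Definition spot_rvs (t : nat) : set (Omega -> R) :=
  [set (pi_s X t : Omega -> R); (pi_u X t : Omega -> R);
       (pi_v X t : Omega -> R)]
  `|` range (fun r => phi X t r : Omega -> R).
Definition psi_rvs (t : nat) : set (Omega -> R) :=
  [set (psi_u X t : Omega -> R); (psi_v X t : Omega -> R)].
Definition rho_rvs (t : nat) : set (Omega -> R) :=
  [set (rho_u X t : Omega -> R); (rho_v X t : Omega -> R)].
Definition kappa_rvs (t : nat) : set (Omega -> R) := [set kapu t; kapv t].

Definition all_hours (V : nat -> set (Omega -> R)) : set (Omega -> R) :=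
  \bigcup_(t in [set t | is_hour S t]) V t.

(* The family indexed by Some t (the pair in hour t) and None (all the other
   random variables, jointly). *)
Definition pair_vs_rest (V : nat -> set (Omega -> R))
    (rest : set (Omega -> R)) (i : option nat) : set (set Omega) :=
  sigma_rv (if i is Some t then V t else rest).

Definition independent_pairs (V : nat -> set (Omega -> R))
    (rest : set (Omega -> R)) : Prop :=
  mutually_independent P
    [set i | if i is Some t then is_hour S t else true] (pair_vs_rest V rest).

Definition bernoulli_rv (Y : {RV P >-> bool}) : Prop :=
  exists p : R, 0 < p < 1 /\ distribution P Y =1 bernoulli_prob p.

Record market_assumptions : Prop := MarketAssumptions {
  finite_expectations : forall Y : Omega -> R,
    (all_hours spot_rvs `|` all_hours psi_rvs `|` all_hours rho_rvs
       `|` all_hours kappa_rvs) Y ->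
    P.-integrable setT (EFin \o Y);
  inflow_ge0 : forall t, is_hour S t -> forall om, lev 0 (inflow t om);
  kappa_bernoulli : forall t, is_hour S t ->
    bernoulli_rv (kappa_u X t) /\ bernoulli_rv (kappa_v X t);
  rhobar_bounds : forall t, is_hour S t ->
    0 < rhobar_u X t <= 1 /\ 0 < rhobar_v X t <= 1;
  rho_support : forall t, is_hour S t ->
    rv_support P (fun om => (rho_u X t om, rho_v X t om) : R * R) =
    [set x | [/\ 0 <= x.1 <= rhobar_u X t, 0 <= x.2 <= rhobar_v X t
               & x.1 + x.2 <= 1]];
  rho_indep : independent_pairs rho_rvs
    (all_hours spot_rvs `|` all_hours psi_rvs `|` all_hours kappa_rvs);
  kappa_indep : independent_pairs kappa_rvs
    (all_hours spot_rvs `|` all_hours psi_rvs `|` all_hours rho_rvs) }.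

(* The components of the random vector revealed in hour t. *)
Definition xi (t : nat) : set (Omega -> R) :=
  [set Y | is_hour S t /\ (psi_rvs t `|` rho_rvs t) Y] `|`
  [set Y | (exists2 d, is_day S d & t = first_hour S d) /\
           exists2 tau, (t <= tau <= t + hpd S - 1)%N & kappa_rvs tau Y] `|`
  [set Y | (exists2 tau', is_hour S tau' &
                          t = prev_last_hour S (day_of S tau')) /\
           exists2 tau, (t + 1 <= tau <= t + hpd S)%N & spot_rvs tau Y].

Definition info (t t' : nat) : set (Omega -> R) :=
  \bigcup_(tau in [set tau | (t <= tau <= t')%N]) xi tau.

Definition info_bid (d : nat) : set (Omega -> R) :=
  info 0%N (prev_last_hour S d).

Definition rev_u (t : nat) (om : Omega) : R :=
  kapu t om * (pi_u X t om + rho_u X t om * psi_u X t om).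
Definition rev_v (t : nat) (om : Omega) : R :=
  kapv t om * (pi_v X t om + rho_v X t om * psi_v X t om).

Definition revenue (t : nat) (om : Omega) (s u v : R) : R :=
  pi_s X t om * s + rev_u t om * u + rev_v t om * v.

Definition delivery (t : nat) (om : Omega) (s u v : R) : R :=
  s + kapu t om * rho_u X t om * u - kapv t om * rho_v X t om * v.

Definition level_after (d t : nat) (w : level S)
    (g p z : nat -> Omega -> flow S) (om : Omega) : level S :=
  w + \sum_(first_hour S d <= tau < t.+1)
        (inflow tau om
         + incidence S *m (g tau om - p tau om + z tau om)).

Record bidding_feasible (s u v : nat -> Omega -> R)
    (g p z : nat -> Omega -> flow S)
    (w : nat -> Omega -> level S) : Prop := CFeasible {
  C_init : forall om, w 0%N om = w0 S;
  C_bids : forall t, is_hour S t ->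
    [/\ inL P (info_bid (day_of S t)) (s t),
        inL P (info_bid (day_of S t)) (u t) &
        inL P (info_bid (day_of S t)) (v t)];
  C_flows : forall t, is_hour S t ->
    [/\ inLv P (info 0%N t) (g t), inLv P (info 0%N t) (p t),
        inLv P (info 0%N t) (z t) & inLv P (info 0%N t) (w t)];
  C_constraints : forall t, is_hour S t -> {ae P, forall om,
    [/\ bounds t (u t om) (v t om) (g t om) (p t om) (z t om),
        delivery t om (s t om) (u t om) (v t om)
          = energy t (g t om) (p t om),
        w t om = w t.-1 om + inflow t om
                 + incidence S *m (g t om - p t om + z t om)
      & level_bounds t (w t om)]} }.

Definition bidding_value : \bar R :=
  ereal_sup [set x | exists s u v g p z w,
    bidding_feasible s u v g p z w /\
    x = (\sum_(1 <= t < (nhours S).+1)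
           'E_P[fun om => revenue t om (s t om) (u t om) (v t om)])%E].

(* Here om stands for the observed value of the variables in info_bid d, and
   K om for P conditioned on them; the bids are thus real numbers, and almost
   sure statements, integrability and expectations refer to K om. *)
Record trader_feasible (K : Omega -> probability Omega R) (d : nat)
    (wprev wend : level S) (om : Omega) (s u v : nat -> R)
    (g p z : nat -> Omega -> flow S) : Prop := TraderFeasible {
  trader_flows : forall t, in_day S d t ->
    [/\ inLv (K om) (info (first_hour S d) t) (g t),
        inLv (K om) (info (first_hour S d) t) (p t) &
        inLv (K om) (info (first_hour S d) t) (z t)];
  trader_constraints : forall t, in_day S d t -> {ae K om, forall om',
    [/\ bounds t (u t) (v t) (g t om') (p t om') (z t om'),
        delivery t om' (s t) (u t) (v t) = energy t (g t om') (p t om')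
      & level_bounds t (level_after d t wprev g p z om')]};
  trader_target : {ae K om, forall om',
    lev wend (level_after d (last_hour S d) wprev g p z om')} }.

Definition trader_value (K : Omega -> probability Omega R) (d : nat)
    (wprev wend : level S) (om : Omega) : \bar R :=
  ereal_sup [set x | exists s u v g p z,
    trader_feasible K d wprev wend om s u v g p z /\
    x = (\sum_(first_hour S d <= t < (last_hour S d).+1)
           'E_(K om)[fun om' => revenue t om' (s t) (u t) (v t)])%E].

Record reduced_planner_feasible (w : nat -> Omega -> level S) : Prop :=
  CPrFeasible {
  CPr_init : forall om, w 0%N om = w0 S;
  CPr_levels : forall d, is_day S d -> inLv P (info_bid d) (w d);
  CPr_bounds : forall d, is_day S d ->
    {ae P, forall om, level_bounds (last_hour S d) (w d om)} }.

Definition reduced_planner_value (K : nat -> Omega -> probability Omega R) : \bar R :=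
  ereal_sup [set x | exists2 w, reduced_planner_feasible w &
    x = (\sum_(1 <= d < (ndays S).+1)
           \int[P]_om trader_value (K d) d (w d.-1 om) (w d om) om)%E].

Record reduced_bidding_feasible (s u v : nat -> Omega -> R)
    (g p z : nat -> Omega -> flow S) (w : nat -> Omega -> level S) : Prop :=
  CrFeasible {
  Cr_init : forall om, w 0%N om = w0 S;
  Cr_bids : forall t, is_hour S t ->
    [/\ inL P (info 0%N (nhours S)) (s t), inL P (info 0%N (nhours S)) (u t) &
        inL P (info 0%N (nhours S)) (v t)];
  Cr_flows : forall t, is_hour S t ->
    [/\ inLv P (info 0%N (nhours S)) (g t), inLv P (info 0%N (nhours S)) (p t) &
        inLv P (info 0%N (nhours S)) (z t)];
  Cr_levels : forall d, is_day S d -> inLv P (info_bid d) (w d);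
  Cr_constraints : forall d t, is_day S d -> in_day S d t ->
    {ae P, forall om,
      [/\ bounds t (u t om) (v t om) (g t om) (p t om) (z t om),
          s t om + rhobar_u X t * u t om = energy t (g t om) (p t om),
          s t om - rhobar_v X t * v t om >= - dotv (zeta S t) (pmax S t)
        & level_bounds t (level_after d t (w d.-1 om) g p z om)]};
  Cr_target : forall d, is_day S d -> {ae P, forall om,
    lev (w d om) (level_after d (last_hour S d) (w d.-1 om) g p z om)};
  Cr_bounds : forall d, is_day S d ->
    {ae P, forall om, level_bounds (last_hour S d) (w d om)} }.

Definition reduced_bidding_value (tpi_s tpi_u tpi_v : nat -> Omega -> R) : \bar R :=
  ereal_sup [set x | exists s u v g p z w,
    reduced_bidding_feasible s u v g p z w /\
    x = (\sum_(1 <= t < (nhours S).+1)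
           'E_P[fun om => (tpi_s t om * s t om + tpi_u t om * u t om
                           + tpi_v t om * v t om)%R])%E].

End model.

(* Main.v *)
(* Given the closing-time information of day d, the trader's problem has the value
   of the finite linear program formed by the constraints of the reduced bidding
   model for day d. Indeed, a solution of that program serves every activation
   scenario by moving from (g, p) towards (0, pmax) and spilling the water withheld,
   which leaves all filling levels unchanged; conversely, since allocations and
   activations are independent of the closing-time information, every feasible
   trader strategy meets, with positive conditional probability, scenarios
   arbitrarily close to full activation in either direction, and a small change of
   the bids turns its decisions there into a solution of the program.

   Linear systems with measurable coefficients have measurable solutions, so the
   program has epsilon-optimal solutions depending measurably on the closing-time
   information. They are feasible for the reduced bidding model, which makes the
   two reduced values equal. Mixed as above and completed by releasing the water in
   excess of the planned end-of-day levels through the network to the sink, they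
   become feasible for the bidding model with the same expected revenue. *)

Require Import Defs.
From mathcomp Require Import all_boot all_order all_algebra.
From mathcomp Require Import all_classical all_reals all_analysis.
From mathcomp Require Import measurable_realfun giry.
From mathcomp Require Import lra ring zify.

Set Implicit Arguments.
Unset Strict Implicit.
Unset Printing Implicit Defensive.

Import Order.TTheory GRing.Theory Num.Theory.
Import numFieldNormedType.Exports.

Local Open Scope classical_set_scope.
Local Open Scope ring_scope.

(** * Measurable selection for linear systems *)

(** Measurability and null sets shape the proof. The trader optimizes over functions, and his value
    is not evidently measurable in the outcome; for almost every outcome the linear program replaces
    it by a quantity that is. One null set has to serve all bids, strategies and levels at once, so
    [generic_outcome] lists conditions on the conditional law that can be secured outside a single
    null set and that imply all that is used.

    In the reduced bidding model the bids may depend on later information, but nothing is gained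
    from it: the program of a day has coefficients known at closing time, and its value bounds the
    objective outcome by outcome.

    Bids, generation and pumping are bounded, whereas spills have no capacity. Acyclicity supplies a
    potential that decreases along arcs; nonnegative levels then bound the spills by integrable
    quantities. The same potential yields routes to the sink. The excess water is released in the
    last hour of each day, the only hour in which the planned level is imposed, and the sink can
    receive it because its upper bound is infinite. *)

Section measurable_linear_systems.
Context {d : measure_display} {T : measurableType d} {R : realType}.

(** Inversion is discontinuous at [0], where its value is [0] by convention; on either side of [0]
    it is a composite of [expR] and [ln]. *)
Lemma measurable_fun_inv (f : T -> R) :
  measurable_fun setT f -> measurable_fun setT (fun t => (f t)^-1).
Proof.
move=> mf; have E x : x^-1 = if 0 < x then expR (- ln x) else
    if x < 0 then - expR (- ln (- x)) else 0 :> R.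
  case: (ltrgt0P x) => [x0|x0|->]; last by rewrite invr0.
    by rewrite expRN lnK.
  by rewrite expRN lnK ?posrE ?oppr_gt0// invrN opprK.
under eq_fun do rewrite E.
have mN (g : T -> R) : measurable_fun setT g -> measurable_fun setT (fun t => - g t).
  exact: measurable_funN.
have ml (g : T -> R) : measurable_fun setT g ->
    measurable_fun setT (fun t => expR (- ln (g t))).
  move=> mg; apply: (measurableT_comp (@measurable_expR R)); apply: mN.
  exact: (measurableT_comp (@measurable_ln R)).
apply: measurable_fun_ifT; [exact: measurable_fun_ltr|exact: ml|].
apply: measurable_fun_ifT; [exact: measurable_fun_ltr| |exact: measurable_cst].
by apply/mN/ml/mN.
Qed.

Lemma measurable_forall_fin (I : finType) (F : I -> set T) :
  (forall i, measurable (F i)) -> measurable [set t | forall i, F i t].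
Proof.
move=> mF; rewrite (_ : mkset _ = \bigcap_(i in [set: I]) F i); last first.
  by apply/seteqP; split => t /= Ft i; [move=> _; exact: Ft|exact: Ft].
by apply: fin_bigcap_measurable.
Qed.

Lemma measurable_exists_fin (I : finType) (F : I -> set T) :
  (forall i, measurable (F i)) -> measurable [set t | exists i, F i t].
Proof.
move=> mF; have := measurable_forall_fin (fun i => measurableC (mF i)).
move=> /measurableC; congr measurable; apply/seteqP; split => t /=.
  by move=> /existsNP[i /contrapT Fi]; exists i.
by move=> [i Fi] /(_ i).
Qed.

(* A solvable system [alpha i * y <= beta i] is solved by its largest lower
   bound, by its smallest upper bound, or by [0]. *)
Lemma test_point (I : finType) (alpha beta : I -> R) (y : R) :
  (forall i, alpha i * y <= beta i) ->
  exists c : option I,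
    forall i, alpha i * oapp (fun j => beta j / alpha j) 0 c <= beta i.
Proof.
move=> Hy; have [[i0 i0lt]|/forallNP nlow] := pselect (exists i, alpha i < 0).
  case: (@Order.TotalTheory.arg_maxP _ _ _ i0 (fun i => alpha i < 0)
      (fun i => beta i / alpha i) i0lt) => i ilt imax.
  have Ly : beta i / alpha i <= y by rewrite ler_ndivrMr// mulrC; exact: Hy.
  exists (Some i) => j /=; case: (ltP (alpha j) 0) => aj.
    by move: (imax _ aj) => /= H; rewrite mulrC -ler_ndivrMr.
  exact: le_trans (ler_wpM2l aj Ly) (Hy j).
have age0 j : 0 <= alpha j by rewrite leNgt; apply/negP/nlow.
have [[i0 i0lt]|/forallNP nup] := pselect (exists i, 0 < alpha i).
  case: (@Order.TotalTheory.arg_minP _ _ _ i0 (fun i => 0 < alpha i)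
      (fun i => beta i / alpha i) i0lt) => i ilt imin.
  exists (Some i) => j /=; case: (ltP 0 (alpha j)) => aj.
    by move: (imin _ aj) => /= H; rewrite mulrC -ler_pdivlMr.
  have aj0 : alpha j = 0 by apply/eqP; rewrite eq_le aj age0.
  by have := Hy j; rewrite aj0 !mul0r.
exists None => j /=; rewrite mulr0.
have aj0 : alpha j = 0.
  by apply/eqP; rewrite eq_le age0 andbT leNgt; apply/negP/nup.
by have := Hy j; rewrite aj0 mul0r.
Qed.

(** Only the first [n] entries of [x] count, so eliminating the last variable lowers [n] without
    changing the type of the unknown. *)
Definition solves (I : finType) n (a : I -> nat -> R) (b : I -> R) (x : nat -> R) :=
  forall i, \sum_(k < n) a i k * x k <= b i.

Fixpoint first_choice (C : Type) (F : C -> set T) (f : C -> nat -> T -> R)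
    (s : seq C) (k : nat) (t : T) : R :=
  if s is c :: s' then
    if `[< F c t >] then f c k t else first_choice F f s' k t
  else 0.

Lemma measurable_first_choice (C : Type) (F : C -> set T) f s k :
  (forall c, measurable (F c)) -> (forall c, measurable_fun setT (f c k)) ->
  measurable_fun setT (first_choice F f s k).
Proof.
move=> mF mf; elim: s => [|c s IH] /=; first exact: measurable_cst.
apply: measurable_fun_ifT => //; apply: (measurable_fun_bool true).
rewrite setTI (_ : _ @^-1` _ = F c)//; apply/seteqP; split => t /=.
  by move/asboolP.
by move=> Fc; apply/asboolP.
Qed.

Lemma first_choiceP (C : eqType) (F : C -> set T) f s t c :
  c \in s -> F c t ->
  exists2 c', F c' t & forall k, first_choice F f s k t = f c' k t.
Proof.
elim: s => // c0 s IH; rewrite inE => cs Fc.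
have [F0|nF0] := pselect (F c0 t).
  by exists c0 => // k /=; rewrite asboolT.
case: IH => //; first by case/orP: cs => // /eqP ccs; rewrite ccs in Fc.
by move=> c' Fc' E; exists c' => // k /=; rewrite asboolF.
Qed.

(** Elimination of the last variable: by [test_point] it can be taken among finitely many
    expressions in the other variables, one for each constraint, or [0]. Each candidate leaves a
    system in one variable less with measurable coefficients, and the solvable parameters form a
    finite union. *)
Lemma measurable_solution n : forall (I : finType) (a : I -> nat -> T -> R) (b : I -> T -> R),
  (forall i k, measurable_fun setT (a i k)) -> (forall i, measurable_fun setT (b i)) ->
  measurable [set t | exists x, solves n (fun i k => a i k t) (b ^~ t) x] /\
  exists2 f : nat -> T -> R, (forall k, measurable_fun setT (f k)) &
    forall t, (exists x, solves n (fun i k => a i k t) (b ^~ t) x) ->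
      solves n (fun i k => a i k t) (b ^~ t) (f ^~ t).
Proof.
elim: n => [I a b ma mb|n IH I a b ma mb].
  have E t : (exists x, solves 0 (fun i k => a i k t) (b ^~ t) x) ->
      solves 0 (fun i k => a i k t) (b ^~ t) (fun=> 0).
    by move=> [x Hx] i; have := Hx i; rewrite !big_ord0.
  split; last first.
    by exists (fun _ => cst 0) => [k|t /E//]; exact: measurable_cst.
  rewrite (_ : mkset _ = [set t | forall i, 0 <= b i t]); last first.
    apply/seteqP; split => t /=.
      by move/E => H i; have := H i; rewrite big_ord0.
    by move=> H; exists (fun=> 0) => i; rewrite big_ord0.
  apply: measurable_forall_fin => i.
  by rewrite -[X in measurable X]setTI; apply: measurable_fun_ler.
(* Row [i] with [last c x t] substituted for variable [n] is row [i] minus [q c i t] times row [c].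
   If the pivot [a j n t] vanishes, then so do [q] and [last] by the convention on division by [0],
   which is again the candidate [0]. *)
pose q (c : option I) i t := oapp (fun j => a i n t / a j n t) 0 c.
pose a' c i k t := a i k t - q c i t * oapp (fun j => a j k t) 0 c.
pose b' c i t := b i t - q c i t * oapp (b ^~ t) 0 c.
pose last c (x : nat -> R) t :=
  oapp (fun j => (b j t - \sum_(k < n) a j k t * x k) / a j n t) 0 c.
pose ext x y : nat -> R := fun k => if k == n then y else x k.
have extE x y i t : \sum_(k < n.+1) a i k t * ext x y k =
    \sum_(k < n) a i k t * x k + a i n t * y.
  rewrite big_ord_recr /= {2}/ext eqxx; congr (_ + _); apply: eq_bigr => k _.
  by rewrite /ext ifF// ltn_eqF.
have sumE (u v x : nat -> R) r : \sum_(k < n) (u k - r * v k) * x k =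
    \sum_(k < n) u k * x k - r * \sum_(k < n) v k * x k.
  by rewrite mulr_sumr -sumrB; apply: eq_bigr => k _; ring.
have subst c x t : solves n (fun i k => a' c i k t) ((b' c) ^~ t) x <->
    solves n.+1 (fun i k => a i k t) (b ^~ t) (ext x (last c x t)).
  have a'E i : \sum_(k < n) a' c i k t * x k = \sum_(k < n) a i k t * x k -
      q c i t * \sum_(k < n) oapp (fun j => a j k t) 0 c * x k.
    exact: (sumE (fun k => a i k t) (fun k => oapp (fun j => a j k t) 0 c)).
  split => H i; move: (H i);
    rewrite a'E extE {H} /b' /q /last {a'E}; case: c => [j|] /=.
  - set S := \sum_(k < n) _; set S' := \sum_(k < n) _ => H.
    have -> : a i n t * ((b j t - S') / a j n t) = a i n t / a j n t * (b j t - S').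
      by ring.
    by rewrite mulrBr; lra.
  - by rewrite !mul0r mulr0; lra.
  - set S := \sum_(k < n) _; set S' := \sum_(k < n) _.
    have -> : a i n t * ((b j t - S') / a j n t) = a i n t / a j n t * (b j t - S').
      by ring.
    by rewrite mulrBr; lra.
  - by rewrite !mul0r mulr0; lra.
have feasE t : (exists x, solves n.+1 (fun i k => a i k t) (b ^~ t) x) <->
    exists c, exists x, solves n (fun i k => a' c i k t) ((b' c) ^~ t) x.
  split => [[x Hx]|[c [x /subst Hx]]]; last by exists (ext x (last c x t)).
  have [i|c Hc] := @test_point I (fun i => a i n t)
    (fun i => b i t - \sum_(k < n) a i k t * x k) (x n).
    by have := Hx i; rewrite big_ord_recr /=; lra.
  exists c, x; apply/subst => i; rewrite extE /last.
  by have := Hc i; case: (c) => [j|] /=; lra.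
have mq c i : measurable_fun setT (q c i).
  rewrite /q; case: c => [j|] /=; last exact: measurable_cst.
  by apply: measurable_funM => //; exact: measurable_fun_inv.
have ma' c i k : measurable_fun setT (a' c i k).
  apply: measurable_funB => //; apply: measurable_funM => //.
  by case: c => [j|] /=; [exact: ma|exact: measurable_cst].
have mb' c i : measurable_fun setT (b' c i).
  apply: measurable_funB => //; apply: measurable_funM => //.
  by case: c => [j|] /=; [exact: mb|exact: measurable_cst].
have IHc c := IH I (a' c) (b' c) (ma' c) (mb' c).
split.
  rewrite (_ : mkset _ = [set t | exists c, exists x,
      solves n (fun i k => a' c i k t) ((b' c) ^~ t) x]); last first.
    by apply/seteqP; split => t /feasE.
  by apply: measurable_exists_fin => c; have [] := IHc c.
have /choice[f mfP] c : exists f : nat -> T -> R,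
    (forall k, measurable_fun setT (f k)) /\
    forall t, (exists x, solves n (fun i k => a' c i k t) ((b' c) ^~ t) x) ->
      solves n (fun i k => a' c i k t) ((b' c) ^~ t) (f ^~ t).
  by have [_ [f mf fP]] := IHc c; exists f.
pose F c := [set t | exists x, solves n (fun i k => a' c i k t) ((b' c) ^~ t) x].
pose g c k t := ext (f c ^~ t) (last c (f c ^~ t) t) k.
(* The candidate that works depends on [t]; choosing the first one in a fixed enumeration keeps the
   selection measurable. *)
exists (first_choice F g (enum {: option I})) => [k|t /feasE[c Fc]].
  apply: measurable_first_choice => c; first by have [] := IHc c.
  rewrite /g /ext; case: (k == n); last by have [mf _] := mfP c; exact: mf.
  rewrite /last; case: c => [j|] /=; last exact: measurable_cst.
  apply: measurable_funM; last exact: measurable_fun_inv.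
  apply: measurable_funB => //; apply: measurable_sum => l.
  by apply: measurable_funM => //; have [mf _] := mfP (Some j); exact: mf.
have [|c' Fc' E] := @first_choiceP _ F g (enum {: option I}) t c _ Fc.
  by rewrite mem_enum.
rewrite (_ : (_ ^~ t) = g c' ^~ t); last by apply/funext.
by apply/subst/(mfP c').2.
Qed.

(** * Affine forms and polyhedra with measurable coefficients *)

Variable J : finType.
Implicit Types (F G : (J -> R) -> T -> R) (C : (J -> R) -> T -> Prop).

(** The closure rules for these two notions recognize the program of a day as a linear system from
    the shape of its constraints, without writing its matrix. *)
Definition affine F := exists (a : J -> T -> R) (b : T -> R),
  [/\ forall j, measurable_fun setT (a j), measurable_fun setT b &
      forall x t, F x t = \sum_j a j t * x j + b t].

Definition polyhedral C := exists (I : finType) (F : I -> (J -> R) -> T -> R),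
  (forall i, affine (F i)) /\ forall x t, C x t <-> forall i, F i x t <= 0.

Lemma affine_ext F G : (forall x t, F x t = G x t) -> affine F -> affine G.
Proof. by move=> E [a [b [ma mb H]]]; exists a, b; split => // x t; rewrite -E. Qed.

Lemma affine_cst (b : T -> R) : measurable_fun setT b -> affine (fun _ t => b t).
Proof.
move=> mb; exists (fun _ => cst 0), b; split => //= x t.
by rewrite big1 ?add0r// => j _; rewrite mul0r.
Qed.

Lemma affine_var j : affine (fun x _ => x j).
Proof.
exists (fun i => cst (i == j)%:R), (cst 0); split => //= x t.
rewrite (bigD1 j)//= eqxx mul1r big1 ?addr0// => i /negbTE ->.
by rewrite mul0r.
Qed.

Lemma affineD F G : affine F -> affine G -> affine (fun x t => F x t + G x t).
Proof.
move=> [a [b [ma mb H]]] [a' [b' [ma' mb' H']]].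
exists (fun j t => a j t + a' j t), (fun t => b t + b' t); split => [j||x t].
- exact: measurable_funD.
- exact: measurable_funD.
- rewrite H H' addrACA -big_split /=; congr (_ + _).
  by apply: eq_bigr => j _; rewrite mulrDl.
Qed.

Lemma affineZ (c : T -> R) F : measurable_fun setT c -> affine F ->
  affine (fun x t => c t * F x t).
Proof.
move=> mc [a [b [ma mb H]]].
exists (fun j t => c t * a j t), (fun t => c t * b t); split => [j||x t].
- exact: measurable_funM.
- exact: measurable_funM.
- by rewrite H mulrDr mulr_sumr; congr (_ + _); apply: eq_bigr => j _; rewrite mulrA.
Qed.

Lemma affineN F : affine F -> affine (fun x t => - F x t).
Proof.
move=> /(affineZ (measurable_cst (-1 : R))); apply: affine_ext => x t /=.
by rewrite mulN1r.
Qed.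

Lemma affineB F G : affine F -> affine G -> affine (fun x t => F x t - G x t).
Proof. by move=> HF /affineN; apply: affineD. Qed.

Lemma affine_sum (K : Type) (s : seq K) (F : K -> (J -> R) -> T -> R) :
  (forall k, affine (F k)) -> affine (fun x t => \sum_(k <- s) F k x t).
Proof.
move=> HF; elim: s => [|k s IH].
  by apply: affine_ext (affine_cst (measurable_cst (0 : R))) => x t; rewrite big_nil.
by apply: affine_ext (affineD (HF k) IH) => x t; rewrite big_cons.
Qed.

Lemma polyhedral_ext C C' : (forall x t, C x t <-> C' x t) ->
  polyhedral C -> polyhedral C'.
Proof.
by move=> E [I [F [aF H]]]; exists I, F; split => // x t; rewrite -E H.
Qed.

Lemma polyhedral_le F G : affine F -> affine G -> polyhedral (fun x t => F x t <= G x t).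
Proof.
move=> aF aG; exists unit, (fun _ x t => F x t - G x t); split => [_|x t].
  exact: affineB.
by rewrite subr_le0; split => // /(_ tt).
Qed.

Lemma polyhedral_true : polyhedral (fun _ _ => True).
Proof. by exists void, (fun _ _ _ => 0); split => [[]|x t]; split => // _ []. Qed.

Lemma polyhedral_and C C' : polyhedral C -> polyhedral C' ->
  polyhedral (fun x t => C x t /\ C' x t).
Proof.
move=> [I [F [aF H]]] [I' [F' [aF' H']]].
exists (I + I')%type, (fun i => match i with inl i => F i | inr i => F' i end).
split => [[]//|x t]; split => [[/H HF /H' HF'] []//|HF].
by split; [apply/H => i; exact: HF (inl i)|apply/H' => i; exact: HF (inr i)].
Qed.

Lemma polyhedral_eq F G : affine F -> affine G -> polyhedral (fun x t => F x t = G x t).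
Proof.
move=> aF aG; have := polyhedral_and (polyhedral_le aF aG) (polyhedral_le aG aF).
apply: polyhedral_ext => x t; split => [[FG GF]|->]; last by split.
by apply/eqP; rewrite eq_le FG GF.
Qed.

Lemma polyhedral_imply (b : bool) C : (b -> polyhedral C) ->
  polyhedral (fun x t => b -> C x t).
Proof.
case: b => [/(_ isT)|_]; first by apply: polyhedral_ext => x t; split => // /(_ isT).
by apply: polyhedral_ext polyhedral_true.
Qed.

Lemma polyhedral_forall (K : finType) (C : K -> (J -> R) -> T -> Prop) :
  (forall k, polyhedral (C k)) -> polyhedral (fun x t => forall k, C k x t).
Proof.
move=> HC; pose S := {I : finType & I -> (J -> R) -> T -> R}.
have /choice[IF IFP] k : exists IF : S, (forall i, affine (projT2 IF i)) /\
    forall x t, C k x t <-> forall i, projT2 IF i x t <= 0.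
  by have [I [F HF]] := HC k; exists (existT _ I F).
exists {k : K & projT1 (IF k)}, (fun i => projT2 (IF (tag i)) (tagged i)).
split => [i|x t]; first exact: (IFP (tag i)).1.
split => [H i|H k]; first exact: ((IFP (tag i)).2 x t).1.
by apply/(IFP k).2 => i; exact: (H (existT _ k i)).
Qed.

Lemma polyhedral_selection C : polyhedral C ->
  measurable [set t | exists x, C x t] /\
  exists2 f : J -> T -> R, (forall j, measurable_fun setT (f j)) &
    forall t, (exists x, C x t) -> C (f ^~ t) t.
Proof.
move=> [I [F [aF HC]]].
have /choice[ab abP] i : exists ab : (J -> T -> R) * (T -> R),
    [/\ forall j, measurable_fun setT (ab.1 j), measurable_fun setT ab.2 &
    forall x t, F i x t = \sum_j ab.1 j t * x j + ab.2 t].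
  by have [a [b H]] := aF i; exists (a, b).
pose a i k t := if insub k is Some k' then (ab i).1 (@enum_val J J k') t else 0.
pose b i t := - (ab i).2 t.
have solvesE t (x : nat -> R) : solves #|J| (fun i k => a i k t) (b ^~ t) x <->
    C (fun j => x (enum_rank j)) t.
  have E i : F i (fun j => x (enum_rank j)) t =
      \sum_(k < #|J|) a i k t * x k - b i t.
    have [_ _ ->] := abP i; rewrite opprK; congr (_ + _).
    rewrite (reindex (@enum_val J J)) /=; last first.
      by exists enum_rank => k _; [exact: enum_valK|exact: enum_rankK].
    apply: eq_bigr => k _; rewrite /a insubT//= => lk; rewrite enum_valK.
    by congr ((ab i).1 (enum_val _) t * _); exact: val_inj.
  rewrite HC; split => H i; have := H i; rewrite E; lra.
have CE t : (exists x, C x t) <->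
    exists x, solves #|J| (fun i k => a i k t) (b ^~ t) x.
  split => [[x Cx]|[x /solvesE Cx]]; last by eexists; exact: Cx.
  exists (fun k => if insub k is Some k' then x (@enum_val J J k') else 0).
  apply/solvesE; move: Cx; congr C; apply/funext => j.
  rewrite insubT//= => lj; rewrite -[LHS](congr1 x (enum_rankK j)).
  by congr (x (enum_val _)); exact: val_inj.
have [||mS [f mf fP]] := @measurable_solution #|J| I a b.
- move=> i k; rewrite /a; case: insubP => [k' _ _|_]; last exact: measurable_cst.
  by have [] := abP i.
- by move=> i; apply: measurable_funN; have [] := abP i.
split.
  by move: mS; congr measurable; apply/seteqP; split => t /CE.
by exists (fun j => f (enum_rank j)) => // t /CE /fP /solvesE.
Qed.

End measurable_linear_systems.

(** * Regular conditional probabilities *)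

Section sub_sigma_algebra.
Context {d d' : measure_display} {T : measurableType d} {U : measurableType d'} {R : realType}.
Implicit Types S : set (T -> R).

Definition all_measurable S := forall Y, S Y -> measurable_fun setT Y.

Lemma sigma_rv_sub S : all_measurable S -> sigma_rv S `<=` measurable.
Proof.
move=> mS; apply: smallest_sub; first exact: sigma_algebra_measurable.
by move=> _ [Y SY [B mB <-]]; exact: mS.
Qed.

Lemma sigma_rv_mono S S' : S `<=` S' -> sigma_rv S `<=` sigma_rv S'.
Proof.
move=> SS'; apply: smallest_sub; first exact: smallest_sigma_algebra.
move=> A [Y SY YA]; apply: sub_gen_smallest; exists Y => //; exact: SS'.
Qed.

Lemma measurable_sub S (f : T -> U) : all_measurable S ->
  measurable_fun [set: g_sigma_algebraType (rv_gen S)]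
    (f : g_sigma_algebraType (rv_gen S) -> U) ->
  measurable_fun setT f.
Proof. by move=> mS mf _ B mB; apply: (sigma_rv_sub mS); exact: mf. Qed.

Lemma measurable_mono S S' (f : T -> U) : S `<=` S' ->
  measurable_fun [set: g_sigma_algebraType (rv_gen S)]
    (f : g_sigma_algebraType (rv_gen S) -> U) ->
  measurable_fun [set: g_sigma_algebraType (rv_gen S')]
    (f : g_sigma_algebraType (rv_gen S') -> U).
Proof. by move=> SS' mf _ B mB; apply: (sigma_rv_mono SS'); exact: mf. Qed.

Lemma measurable_wrt_mem S Y : S Y -> measurable_wrt S Y.
Proof.
move=> SY _ B mB; apply: sub_gen_smallest; exists Y => //.
by exists B.
Qed.

Lemma sigma_rv_preimage S (Y : T -> R) B : S Y -> measurable B -> sigma_rv S (Y @^-1` B).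
Proof. by move=> /measurable_wrt_mem mY mB; rewrite -[_ @^-1` _]setTI; exact: mY. Qed.

End sub_sigma_algebra.

Section almost_everywhere.
Context {d : measure_display} {T : measurableType d} {R : realType}.
Variable mu : {measure set T -> \bar R}.

Lemma ae_imply (b : Prop) (F : T -> Prop) : (b -> {ae mu, forall t, F t}) ->
  {ae mu, forall t, b -> F t}.
Proof.
have [hb /(_ hb)|nb _] := pselect b; first by apply: filterS.
exact/aeW.
Qed.

Lemma ae_forall_fin (I : finType) (F : I -> T -> Prop) :
  (forall i, {ae mu, forall t, F i t}) -> {ae mu, forall t, forall i, F i t}.
Proof.
move=> HF; pose G k t := if insub k is Some k' then F (@enum_val I I k') t else True.
have : {ae mu, forall t, forall k, G k t}.
  by apply: ae_foralln => k; rewrite /G; case: insubP => [*|_]; [exact: HF|exact/aeW].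
apply: filterS => t H i; have := H (enum_rank i); rewrite /G.
rewrite insubT//= => lt; suff -> : enum_val (Ordinal lt) = i by [].
by rewrite -[RHS]enum_rankK; congr enum_val; exact: val_inj.
Qed.

Lemma ae_forall_imply (b : nat -> Prop) (F : nat -> T -> Prop) :
  (forall n, b n -> {ae mu, forall t, F n t}) ->
  {ae mu, forall t, forall n, b n -> F n t}.
Proof. by move=> H; apply: ae_foralln => n; exact/ae_imply/H. Qed.

Local Open Scope ereal_scope.

Import HBNNSimple.

(* The integral of a function that is not known to be measurable, such as
   [trader_value], is a difference of lower integrals; it still depends only on
   the almost-everywhere class of the function. *)
Lemma integral_ae_ext (f g : T -> \bar R) : {ae mu, forall t, f t = g t} ->
  \int[mu]_t f t = \int[mu]_t g t.
Proof.
have le_nn (u v : T -> \bar R) : (forall t, 0 <= u t) -> (forall t, 0 <= v t) ->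
    {ae mu, forall t, u t = v t} -> \int[mu]_t u t <= \int[mu]_t v t.
  move=> u0 v0 [N [mN muN uvN]]; rewrite [leLHS]ge0_integralTE//.
  apply: ge_ereal_sup => _ [h hu <-].
  (* Setting the simple function to [0] on the null set [N] keeps its integral and puts it below [v]
     everywhere, so it competes in the supremum defining the integral of [v]. *)
  pose h' := mul_nnsfun h (indic_nnsfun R (measurableC mN)).
  apply: (@le_trans _ (\bar R) (sintegral mu h')); last first.
    rewrite [leRHS]ge0_integralTE//; apply: ereal_sup_ubound; exists h' => // t.
    rewrite /h' /= /indic_nnsfun /=.
    have [tN|tN] := pselect (N t).
      by rewrite /mindic indicE memNset ?mulr0//=; apply.
    rewrite /mindic indicE mem_set//= mulr1; apply: (le_trans (hu t)).
    suff -> : u t = v t by [].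
    by apply: contrapT => /uvN.
  rewrite -!integralT_nnsfun le_eqVlt; apply/orP; left; apply/eqP.
  apply: ge0_ae_eq_integral => //.
  - exact/measurable_EFinP.
  - exact/measurable_EFinP.
  - by move=> t _; rewrite lee_fin.
  - by move=> t _; rewrite lee_fin.
  exists N; split => // t /= /not_implyP[_ H]; apply: contrapT => tN; apply: H.
  by rewrite /indic_nnsfun /= /mindic indicE mem_set//= mulr1.
have eq_nn (u v : T -> \bar R) : (forall t, 0 <= u t) -> (forall t, 0 <= v t) ->
    {ae mu, forall t, u t = v t} -> \int[mu]_t u t = \int[mu]_t v t.
  move=> u0 v0 uv; apply/eqP; rewrite eq_le !le_nn//.
  by apply: filterS uv => t ->.
move=> fg; rewrite integralE [RHS]integralE; congr (_ - _); apply: eq_nn => //.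
- by apply: filterS fg => t ft; rewrite !funeposE ft.
- by apply: filterS fg => t ft; rewrite !funenegE ft.
Qed.

End almost_everywhere.

Section regular_conditional_probability.
Context {R : realType} {disp : measure_display} {Omega : measurableType disp}.
Variables (P : probability Omega R) (S : set (Omega -> R)).
Hypothesis mS : all_measurable S.
Variable K : Omega -> probability Omega R.
Hypothesis hK : is_regular_cond_prob P S K.

Local Open Scope ereal_scope.

Lemma kernel_measurable A : measurable A -> measurable_fun setT (fun om => K om A).
Proof. by move=> mA; apply: (measurable_sub mS); have [] := hK mA. Qed.

(** Conditioning on the whole space shows that [P] is the bind of [P] with [K] in the Giry monad;
    the integral against a bind is the iterated integral. *)
Lemma kernel_integral_ge0 (f : Omega -> \bar R) :
  measurable_fun setT f -> (forall om, 0 <= f om) ->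
  \int[P]_om f om = \int[P]_om \int[K om]_om' f om'.
Proof.
move=> mf f0; pose k om : giry Omega R := K om.
have mk : measurable_fun setT k.
  by apply: measurable_giry_codensity => // B; exact: kernel_measurable.
have := giry_int_bind (P : giry Omega R) mk mf f0; rewrite /giry_int => <-.
apply: eq_measure_integral => A mA _.
have m1 : measurable_fun setT (EFin \o \1_A : Omega -> \bar R).
  exact/measurable_EFinP/measurable_indic.
have h1 om : 0 <= (EFin \o \1_A : Omega -> \bar R) om by rewrite lee_fin.
have := giry_int_bind (P : giry Omega R) mk m1 h1; rewrite /giry_int.
rewrite integral_indic// setIT => ->; transitivity (P A) => //.
have [_ /(_ setT)] := hK mA; rewrite setIT => -> //.
  by apply: eq_integral => om _; rewrite integral_indic// setIT.
by have [_ ] := hK mA => _; rewrite -setC0; apply: sigma_algebraC; exact: sigma_algebra0.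
Qed.

Lemma kernel_integral_measurable (f : Omega -> \bar R) :
  measurable_fun setT f -> (forall om, 0 <= f om) ->
  measurable_fun [set: g_sigma_algebraType (rv_gen S)]
    (fun om : g_sigma_algebraType (rv_gen S) => \int[K om]_om' f om').
Proof.
move=> mf f0; apply: measurable_fun_integral_kernel => // U mU.
by have [] := hK mU.
Qed.

Lemma kernel_null N : measurable N -> P N = 0 -> {ae P, forall om, K om N = 0}.
Proof.
move=> mN PN; have : \int[P]_om `|K om N| = 0.
  transitivity (\int[P]_om \int[K om]_om' (\1_N om')%:E).
    by apply: eq_integral => om _; rewrite integral_indic// setIT gee0_abs.
  rewrite -kernel_integral_ge0 => [||om]; first by rewrite integral_indic// setIT.
    exact/measurable_EFinP/measurable_indic.
  by rewrite lee_fin.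
move/(ae_eq_integral_abs _ measurableT (kernel_measurable mN)).
by apply: filterS => om /(_ I).
Qed.

Lemma kernel_ae (Q : Omega -> Prop) : {ae P, forall om, Q om} ->
  {ae P, forall om, {ae K om, forall om', Q om'}}.
Proof.
move=> [N [mN PN QN]]; apply: filterS (kernel_null mN PN) => om KN.
by exists N.
Qed.

Lemma kernel_positive E : measurable E -> 0 < P E ->
  (forall B, sigma_rv S B -> P (E `&` B) = P E * P B) ->
  {ae P, forall om, 0 < K om E}.
Proof.
move=> mE PE0 indep; pose B := [set om | K om E = 0].
have mB : sigma_rv S B.
  have [+ _] := hK mE => /(_ measurableT [set 0] (emeasurable_set1 _)).
  by rewrite setTI.
have PB : P B = 0.
  have [_ /(_ B mB)] := hK mE; rewrite indep// [in RHS]integral0_eq => [/eqP|om //].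
  by rewrite mule_eq0 gt_eqF//= => /eqP.
exists B; split => //; first exact: sigma_rv_sub mB.
move=> om /=; rewrite lt_neqAle measure_ge0 andbT => /negP/negPn/eqP.
by rewrite /B /= => <-.
Qed.

Lemma kernel_mem B : sigma_rv S B ->
  {ae P, forall om, B om -> {ae K om, forall om', B om'}}.
Proof.
move=> SB; have mB := sigma_rv_sub mS SB; have mCB := measurableC mB.
have [_ /(_ B SB)] := hK mCB; rewrite setICl measure0 => /esym H.
have : \int[P]_(om in B) `|K om (~` B)| = 0.
  by under eq_integral do rewrite gee0_abs//.
move/(ae_eq_integral_abs _ mB (measurable_funTS (kernel_measurable mCB))).
apply: filterS => om /= KB /KB K0; exists (~` B); split => //.
Qed.

(** Membership of [Y] in a rational half-line is preserved under [K om] by [kernel_mem], and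
    countably many half-lines determine a real number. *)
Lemma kernel_const (Y : Omega -> R) : measurable_wrt S Y ->
  {ae P, forall om, {ae K om, forall om', Y om' = Y om}}.
Proof.
move=> mY; pose q n : R := ratr (odflt 0%R (unpickle n)).
have mle n : sigma_rv S [set om | (Y om <= q n)%R].
  have := mY measurableT `]-oo, q n]%classic (measurable_itv _).
  by rewrite setTI; congr (sigma_rv S _); apply/seteqP; split => om /=; rewrite in_itv.
have mge n : sigma_rv S [set om | (q n <= Y om)%R].
  have := mY measurableT `[q n, +oo[%classic (measurable_itv _).
  by rewrite setTI; congr (sigma_rv S _); apply/seteqP; split => om /=; rewrite in_itv/= andbT.
have /ae_foralln Hle n := kernel_mem (mle n).
have /ae_foralln Hge n := kernel_mem (mge n).
have qP x y : (x < y)%R -> exists n, (x < q n < y)%R.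
  move=> /rat_in_itvoo[r]; rewrite in_itv/= => rxy.
  by exists (pickle r); rewrite /q pickleK.
apply: filterS2 Hle Hge => om Hle Hge.
have Hle' : {ae K om, forall om', forall n, (Y om <= q n)%R -> (Y om' <= q n)%R}.
  exact: ae_forall_imply.
have Hge' : {ae K om, forall om', forall n, (q n <= Y om)%R -> (q n <= Y om')%R}.
  exact: ae_forall_imply.
apply: filterS2 Hle' Hge' => om' le' ge'.
have [lt|gt|//] := ltgtP (Y om') (Y om).
  have [n /andP[n1 n2]] := qP _ _ lt; have := ge' n (ltW n2).
  by rewrite leNgt n1.
have [n /andP[n1 n2]] := qP _ _ gt; have := le' n (ltW n1).
by rewrite leNgt n2.
Qed.

Lemma kernel_integrable (f : Omega -> R) : P.-integrable setT (EFin \o f) ->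
  {ae P, forall om, (K om).-integrable setT (EFin \o f)}.
Proof.
move=> /integrableP[mf fi].
have mg : measurable_fun setT (fun om => `|(EFin \o f) om|).
  exact: measurableT_comp.
have : P.-integrable setT (fun om => \int[K om]_om' `|(EFin \o f) om'|).
  apply/integrableP; split.
    by apply: (measurable_sub mS); apply: kernel_integral_measurable.
  under eq_integral do rewrite gee0_abs ?integral_ge0//.
  by rewrite -kernel_integral_ge0.
move=> /(integrable_ae measurableT); apply: filterS => om /(_ I).
by rewrite ge0_fin_numE ?integral_ge0// => fo; apply/integrableP; split.
Qed.

Lemma kernel_integral (f : Omega -> R) : P.-integrable setT (EFin \o f) ->
  [/\ measurable_fun [set: g_sigma_algebraType (rv_gen S)]
      (fun om : g_sigma_algebraType (rv_gen S) => \int[K om]_om' (f om')%:E),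
    P.-integrable setT (fun om => \int[K om]_om' (f om')%:E) &
    \int[P]_om (f om)%:E = \int[P]_om \int[K om]_om' (f om')%:E].
Proof.
move=> fi; have mf := measurable_int _ fi.
have [mp mn] := (measurable_funepos mf, measurable_funeneg mf).
have Kp := kernel_integral_ge0 mp (funepos_ge0 _).
have Kn := kernel_integral_ge0 mn (funeneg_ge0 _).
have mKp := kernel_integral_measurable mp (funepos_ge0 _).
have mKn := kernel_integral_measurable mn (funeneg_ge0 _).
have E om : \int[K om]_om' (f om')%:E =
    \int[K om]_om' (EFin \o f)^\+ om' - \int[K om]_om' (EFin \o f)^\- om'.
  exact: integralE.
have ip : P.-integrable setT (fun om => \int[K om]_om' (EFin \o f)^\+ om').
  apply/integrableP; split; first exact: measurable_sub mKp.
  under eq_integral do rewrite gee0_abs ?integral_ge0//.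
  rewrite -Kp; exact: integral_funepos_lt_pinfty.
have ineg : P.-integrable setT (fun om => \int[K om]_om' (EFin \o f)^\- om').
  apply/integrableP; split; first exact: measurable_sub mKn.
  under eq_integral do rewrite gee0_abs ?integral_ge0//.
  rewrite -Kn; exact: integral_funeneg_lt_pinfty.
split.
- by under eq_fun do rewrite E; exact: emeasurable_funB.
- by under eq_fun do rewrite E; exact: integrableB.
- under [RHS]eq_integral do rewrite E.
  by rewrite integralB// -Kp -Kn; exact: integralE.
Qed.

(** For almost every [om], the law [K om] is concentrated on [B] or on its complement according to
    the side on which [om] lies, so the restriction to [B] can be moved out of the inner
    integral. *)
Lemma kernel_integral_setI (X : Omega -> R) B : P.-integrable setT (EFin \o X) ->
  sigma_rv S B ->
  \int[P]_(om in B) (X om)%:E = \int[P]_(om in B) \int[K om]_om' (X om')%:E.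
Proof.
move=> iX SB; have mB := sigma_rv_sub mS SB.
have SCB : sigma_rv S (~` B) by rewrite -setTD; exact: sigma_algebraCD.
have iXB : P.-integrable setT (EFin \o (X \_ B)%R).
  rewrite (_ : EFin \o _ = (EFin \o X) \_ B); last first.
    by apply/funext => om; rewrite /= !patchE; case: ifP.
  rewrite -integrable_mkcond//; exact: integrableS iX.
transitivity (\int[P]_om ((X \_ B)%R om)%:E).
  rewrite integral_mkcond; apply: eq_integral => om _.
  by rewrite !patchE; case: ifP.
have [_ _ ->] := kernel_integral iXB; rewrite [RHS]integral_mkcond.
apply: integral_ae_ext.
have KB := kernel_mem SB; have KCB := kernel_mem SCB; apply: filterS2 KB KCB => om KB KCB.
rewrite patchE; case: ifPn => [|/negP]; rewrite inE => omB.
  apply: integral_ae_ext; apply: filterS (KB omB) => om' om'B.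
  by rewrite patchE mem_set.
rewrite -[RHS](integral0 (K om) setT); apply: integral_ae_ext.
by apply: filterS (KCB omB) => om' om'B; rewrite patchE memNset.
Qed.

(** Tested on the set where [Z2 < Z1], which lies in the sigma-algebra of [S]: the difference is
    positive there and has integral [0]. *)
Lemma ae_le_of_integral_le (Z1 Z2 : Omega -> \bar R) :
  measurable_fun [set: g_sigma_algebraType (rv_gen S)]
    (Z1 : g_sigma_algebraType (rv_gen S) -> \bar R) ->
  measurable_fun [set: g_sigma_algebraType (rv_gen S)]
    (Z2 : g_sigma_algebraType (rv_gen S) -> \bar R) ->
  P.-integrable setT Z1 -> P.-integrable setT Z2 ->
  (forall B, sigma_rv S B ->
    \int[P]_(om in B) Z1 om = \int[P]_(om in B) Z2 om) ->
  {ae P, forall om, Z1 om <= Z2 om}.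
Proof.
move=> m1 m2 i1 i2 H; pose B := [set om | Z2 om < Z1 om].
have SB : sigma_rv S B.
  by have := measurable_lte measurableT m2 m1; rewrite setTI.
have mB := sigma_rv_sub mS SB.
have iB Z : P.-integrable setT Z -> P.-integrable B Z by exact: integrableS.
have fin1 := integrable_ae measurableT i1.
have fin2 := integrable_ae measurableT i2.
have : \int[P]_(om in B) `|Z1 om - Z2 om| = 0.
  transitivity (\int[P]_(om in B) (Z1 \- Z2) om).
    apply: eq_integral => om; rewrite inE /B/= => lt.
    by rewrite gee0_abs// ltW// sube_gt0.
  rewrite integralB//; [|exact: iB|exact: iB].
  by rewrite H// subee//; exact: integrable_fin_num (iB _ i2).
have mD : measurable_fun B (fun om => Z1 om - Z2 om).
  apply: measurable_funTS; apply: emeasurable_funB.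
    exact: measurable_int i1.
  exact: measurable_int i2.
move/(ae_eq_integral_abs _ mB mD).
apply: filterS3 fin1 fin2 => om /(_ I) f1 /(_ I) f2 HB.
rewrite leNgt; apply/negP => lt; have := HB lt => /=.
move: f1 f2 lt {HB}; case: (Z1 om) => // x; case: (Z2 om) => // y _ _.
rewrite lte_fin -EFinB => lt [] /eqP; rewrite subr_eq0 => /eqP E.
by rewrite E ltxx in lt.
Qed.

Lemma kernel_cond_exp (X Y : Omega -> R) : P.-integrable setT (EFin \o X) ->
  is_cond_exp P S X Y ->
  {ae P, forall om, \int[K om]_om' (X om')%:E = (Y om)%:E}.
Proof.
move=> iX [[mY iY] HY]; have [mZ iZ _] := kernel_integral iX.
have mY' : measurable_fun [set: g_sigma_algebraType (rv_gen S)]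
    (EFin \o (Y : g_sigma_algebraType (rv_gen S) -> R)).
  exact/measurable_EFinP.
have H B : sigma_rv S B -> \int[P]_(om in B) \int[K om]_om' (X om')%:E =
    \int[P]_(om in B) (EFin \o Y) om.
  by move=> SB; rewrite -kernel_integral_setI// -HY.
have le1 := ae_le_of_integral_le mZ mY' iZ iY H.
have le2 := ae_le_of_integral_le mY' mZ iY iZ (fun B SB => esym (H B SB)).
by apply: filterS2 le1 le2 => om le1 le2; apply/eqP; rewrite eq_le le1.
Qed.

(** Under [K om] the factor [s] is almost surely the constant [s om] and leaves the inner integral;
    this takes the place of the usual approximation of [s] by simple functions. *)
Lemma cond_exp_mul (X Y s : Omega -> R) : P.-integrable setT (EFin \o X) ->
  is_cond_exp P S X Y -> measurable_wrt S s ->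
  P.-integrable setT (EFin \o (fun om => X om * s om)%R) ->
  \int[P]_om (X om * s om)%:E = \int[P]_om (Y om * s om)%:E.
Proof.
move=> iX XY ms iXs; have [_ _ ->] := kernel_integral iXs.
have KX := kernel_integrable iX; have KXY := kernel_cond_exp iX XY.
have Ks := kernel_const ms.
apply: integral_ae_ext; apply: filterS3 KX KXY Ks => om KX KXY Ks.
transitivity (\int[K om]_om' ((X om')%:E * (s om)%:E)).
  by apply: integral_ae_ext; apply: filterS Ks => om' ->.
by rewrite integralZr// KXY.
Qed.

End regular_conditional_probability.

(** * Independence and supports *)

Section independence.
Context {R : realType} {disp : measure_display} {Omega : measurableType disp}.
Variable P : probability Omega R.
Local Open Scope ereal_scope.

(** Both sides are finite measures of [C]; they agree on the pi-system [G], hence on the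
    sigma-algebra it generates. *)
Lemma product_on_sigma_algebra (G : set (set Omega)) (E : set Omega) :
  G `<=` measurable -> setI_closed G -> G setT -> measurable E ->
  (forall C, G C -> P (E `&` C) = P E * P C) ->
  forall C, <<s G >> C -> P (E `&` C) = P E * P C.
Proof.
move=> Gm GI GT mE H C GC.
pose r : {nonneg R} := NngNum (fine_ge0 (measure_ge0 P E)).
have PE : P E = r%:num%:E by rewrite /= fineK// fin_num_measure.
transitivity (mrestr P mE C); first by rewrite /mrestr setIC.
transitivity (mscale r P C); last by rewrite /mscale PE.
apply: (@g_sigma_algebra_measure_unique _ _ _ G Gm (fun=> setT)) => //.
- by apply/seteqP; split => // x _; exists 0%N.
- by move=> A GA; rewrite /= /mrestr /mscale setIC H// PE.
- move=> _; rewrite /mrestr /= (le_lt_trans (probability_le1 _ _)) ?ltry//.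
  exact: measurableI.
Qed.

(** Intersections of one event per index of [L] form a pi-system generating the joint sigma-algebra.
    On it the product rule follows by applying independence to [J], to [L] and to [J ++ L]. *)
Lemma mutually_independent_split (I : eqType) (D : set I) (F : I -> set (set Omega))
    (J L : seq I) (A : I -> set Omega) :
  (forall i, F i `<=` measurable) -> (forall i, setI_closed (F i)) ->
  (forall i, F i setT) ->
  mutually_independent P D F -> uniq (J ++ L) -> (forall i, i \in J ++ L -> D i) ->
  (forall i, i \in J -> F i (A i)) ->
  forall C, <<s \bigcup_(i in [set` L]) F i >> C ->
  P ((\bigcap_(i in [set` J]) A i) `&` C) = P (\bigcap_(i in [set` J]) A i) * P C.
Proof.
move=> Fm FI FT indep uJL JLD FA C LC.
pose G := [set C | exists2 B : I -> set Omega, (forall i, F i (B i)) &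
  C = \bigcap_(i in [set` L]) B i].
have mcap (s : seq I) (B : I -> set Omega) : (forall i, i \in s -> measurable (B i)) ->
    measurable (\bigcap_(i in [set` s]) B i).
  by move=> mB; apply: fin_bigcap_measurable.
apply: (@product_on_sigma_algebra G).
- by move=> _ [B FB ->]; apply: mcap => i _; exact: Fm.
- move=> _ _ [B FB ->] [B' FB' ->]; exists (fun i => B i `&` B' i) => [i|].
    exact: FI.
  by rewrite bigcapI.
- by exists (fun=> setT) => //; rewrite bigcapT.
- by apply: mcap => i iJ; exact/Fm/FA.
- move=> _ [B FB ->]; have := uJL; rewrite cat_uniq => /and3P[uJ JL uL].
  pose B' i := if i \in J then A i else B i.
  have notJ i : i \in L -> i \in J = false.
    by move=> iL; apply/negbTE/negP => iJ; move/hasPn : JL => /(_ i iL); rewrite iJ.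
  have H : P (\bigcap_(i in [set` J ++ L]) B' i) = \prod_(i <- J ++ L) P (B' i).
    apply: indep => // i iJL; split; first exact: JLD.
    by rewrite /B'; case: ifPn => // iJ; exact: FA.
  have HJ : P (\bigcap_(i in [set` J]) A i) = \prod_(i <- J) P (A i).
    by apply: indep => // i iJ; split; [apply: JLD; rewrite mem_cat iJ|exact: FA].
  have HL : P (\bigcap_(i in [set` L]) B i) = \prod_(i <- L) P (B i).
    by apply: indep => // i iL; split => //; apply: JLD; rewrite mem_cat iL orbT.
  rewrite HJ HL; move: H; rewrite big_cat /=.
  rewrite (eq_big_seq (fun i => P (A i))) => [|i iJ]; last by rewrite /B' iJ.
  rewrite [X in _ * X](eq_big_seq (fun i => P (B i))) => [<-|i iL]; last first.
    by rewrite /B' notJ.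
  congr (P _); apply/seteqP; split => x /=.
    move=> [HA HB] i /=; rewrite mem_cat /B'; case: ifPn => [iJ _|_ /= iL].
      exact: HA.
    exact: HB.
  move=> H; split => i /= iS.
    by have := H i; rewrite /= mem_cat iS /B' iS; exact.
  by have := H i; rewrite /= mem_cat iS orbT /B' notJ//; exact.
- move: C LC; apply: smallest_sub; first exact: smallest_sigma_algebra.
  move=> C [i iL FC]; apply: sub_gen_smallest.
  exists (fun j => if j == i then C else setT) => [j|].
    by case: eqP => // ->.
  apply/seteqP; split => [x Cx j _|x /(_ i iL)]; last by rewrite eqxx.
  by case: ifP.
Qed.

(** A value outside the support lies in a null open set, hence in a null box with rational corners,
    and there are countably many such boxes. *)
Lemma ae_rv_support (f g : Omega -> R) :
  measurable_fun setT f -> measurable_fun setT g ->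
  {ae P, forall om, rv_support P (fun om => (f om, g om) : R * R) (f om, g om)}.
Proof.
move=> mf mg; pose q n : R := ratr (odflt 0%R (unpickle n)).
have qP x y : (x < y)%R -> exists n, (x < q n < y)%R.
  move=> /rat_in_itvoo[r]; rewrite in_itv/= => rxy.
  by exists (pickle r); rewrite /q pickleK.
pose box n : set (R * R) := let: (a, b, c, d) := odflt (0, 0, 0, 0)%N (unpickle n) in
  [set x | (q a < x.1 < q b /\ q c < x.2 < q d)%R].
pose X om : R * R := (f om, g om).
have mbox n : measurable (X @^-1` box n).
  rewrite /box; case: (odflt _ _) => [[[a b] c] e].
  rewrite (_ : _ @^-1` _ = f @^-1` `]q a, q b[%classic `&` g @^-1` `]q c, q e[%classic).
    by apply: measurableI; rewrite -[X in measurable X]setTI; [exact: mf|exact: mg].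
  by apply/seteqP; split => om /=; rewrite !in_itv.
have boxP (U : set (R * R)) x : open U -> U x -> exists n, box n x /\ box n `<=` U.
  move=> oU Ux; have [e /= e0 He] := (nbhs_ballP _ _).1 (open_nbhs_nbhs (conj oU Ux)).
  have [a /andP[a1 a2]] := qP (x.1 - e)%R x.1 ltac:(lra).
  have [b /andP[b1 b2]] := qP x.1 (x.1 + e)%R ltac:(lra).
  have [c /andP[c1 c2]] := qP (x.2 - e)%R x.2 ltac:(lra).
  have [d /andP[d1 d2]] := qP x.2 (x.2 + e)%R ltac:(lra).
  exists (pickle (a, b, c, d)); rewrite /box pickleK /=; split.
    by rewrite a2 b1 c2 d1.
  move=> y /= [/andP[y1 y2] /andP[y3 y4]]; apply: He; split => /=;
  by rewrite /ball /= ltr_distl; apply/andP; split; lra.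
exists (\bigcup_(n in [set n | P (X @^-1` box n) = 0]) (X @^-1` box n)); split.
- by apply: bigcup_measurable.
- apply/negligibleP; first by apply: bigcup_measurable.
  rewrite bigcup_mkcond; apply: negligible_bigcup => n.
  case: ifPn => [|_]; last exact: negligible_set0.
  by rewrite inE /= => Pn; exists (X @^-1` box n); split.
- move=> om /= /existsNP[U /not_implyP[oU /not_implyP[UX /negP]]].
  rewrite -leNgt => PU; have [n [bX bU]] := boxP _ _ oU UX.
  exists n => //=; apply/eqP; rewrite eq_le measure_ge0 andbT.
  apply: le_trans PU; apply: le_measure; rewrite ?inE//; last first.
    by move=> om'; exact: bU.
  rewrite (_ : _ @^-1` U = \bigcup_(n in [set n | box n `<=` U]) (X @^-1` box n)).
    by apply: bigcup_measurable.
  apply/seteqP; split => om' /=; last by move=> [k /= kU]; exact: kU.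
  by move=> Uom'; have [k [kX kU]] := boxP _ _ oU Uom'; exists k.
Qed.

End independence.

(** * Calendar, information and market *)

Section calendar.
Context {R : realType} (S : hydro_system R).
Let hpd_pos : (0 < hpd S)%N := hpd_gt0 S.

Lemma last_hourE d : (0 < d)%N -> last_hour S d = (prev_last_hour S d + hpd S)%N.
Proof. by case: d => // d _; rewrite /last_hour /prev_last_hour /= mulSn addnC. Qed.

Lemma in_dayP d t : (0 < d)%N -> in_day S d t = (day_of S t == d) && (0 < t)%N.
Proof.
move=> d0; rewrite /in_day /first_hour last_hourE// /prev_last_hour /day_of.
case: t => [|t] /=; first by rewrite ltn0 andbF.
rewrite andbT -[in RHS](prednK d0) eqSS; apply/idP/eqP => [/andP[le lt]|<-].
  have le' : (d.-1 * hpd S <= t)%N by rewrite -ltnS.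
  rewrite -(subnK le') addnC divnMDl// divn_small ?addn0//.
  by move: le' lt; lia.
by have := leq_divM t (hpd S); have := ltn_ceil t hpd_pos; rewrite mulSn; lia.
Qed.

Lemma in_day_hour d t : is_day S d -> in_day S d t -> is_hour S t.
Proof.
rewrite /is_day /in_day /is_hour /first_hour /last_hour /nhours => /andP[d1 dD] /andP[t1 t2].
rewrite (leq_trans _ t1)//= (leq_trans t2)//.
by rewrite leq_mul2r dD orbT.
Qed.

Lemma day_of_in_day d t : (0 < d)%N -> in_day S d t -> day_of S t = d.
Proof. by move=> d0; rewrite in_dayP// => /andP[/eqP]. Qed.

Lemma is_hour_day t : is_hour S t -> is_day S (day_of S t) /\ in_day S (day_of S t) t.
Proof.
rewrite /is_hour /nhours => /andP[t0 tT]; split; last by rewrite in_dayP// eqxx t0.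
rewrite /is_day /day_of /= ltn_divLR//; case: t t0 tT => // t _; exact.
Qed.

Lemma prev_last_hour_mono d d' : (d <= d')%N -> (prev_last_hour S d <= prev_last_hour S d')%N.
Proof. by move=> dd; rewrite leq_mul2r; apply/orP; right; lia. Qed.

Lemma prev_last_hour_le d : is_day S d -> (prev_last_hour S d <= nhours S)%N.
Proof. by move=> /andP[d0 dD]; rewrite leq_mul2r; apply/orP; right; lia. Qed.

Lemma sum_hours_days (V : nmodType) (F : nat -> V) :
  \sum_(1 <= t < (nhours S).+1) F t =
  \sum_(1 <= d < (ndays S).+1) \sum_(first_hour S d <= t < (last_hour S d).+1) F t.
Proof.
rewrite /nhours; elim: (ndays S) => [|D IH].
  by rewrite mul0n !big_geq.
rewrite [RHS]big_nat_recr//= -IH /first_hour /last_hour /= -big_cat_nat//.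
by rewrite ltnS leq_mul2r leqnSn orbT.
Qed.

End calendar.

Section information.
Context {R : realType} {S : hydro_system R} {disp : measure_display}
  {Omega : measurableType disp} {P : probability Omega R} (X : market S P).

Lemma measurable_natr_bool (b : {RV P >-> bool}) :
  measurable_fun setT (fun om => (b om)%:R : R).
Proof.
rewrite (_ : (fun _ => _) = fun om => if b om then 1 else 0); last first.
  by apply/funext => om; case: (b om).
by apply: measurable_fun_ifT; [|exact: measurable_cst|exact: measurable_cst].
Qed.

Lemma measurable_spot t : all_measurable (spot_rvs X t).
Proof. by move=> Y [[[->|->]|->]|[r _ <-]]. Qed.

Lemma measurable_psi t : all_measurable (psi_rvs X t).
Proof. by move=> Y [->|->]. Qed.

Lemma measurable_rho t : all_measurable (rho_rvs X t).
Proof. by move=> Y [->|->]. Qed.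

Lemma measurable_kappa t : all_measurable (kappa_rvs X t).
Proof.
by move=> Y [->|->]; exact: measurable_natr_bool.
Qed.

Lemma measurable_info t t' : all_measurable (info X t t').
Proof.
move=> Y [tau _ [[[_ [HY|HY]]|[_ [tau' _ HY]]]|[_ [tau' _ HY]]]].
- exact: measurable_psi HY.
- exact: measurable_rho HY.
- exact: measurable_kappa HY.
- exact: measurable_spot HY.
Qed.

Lemma info_mono t0 t1 t0' t1' : (t0' <= t0)%N -> (t1 <= t1')%N ->
  info X t0 t1 `<=` info X t0' t1'.
Proof.
move=> H0 H1 Y [tau /= /andP[h0 h1] HY]; exists tau => //=.
by rewrite (leq_trans H0)//= (leq_trans h1).
Qed.

Lemma info_bid_mono d d' : (d <= d')%N -> info_bid X d `<=` info_bid X d'.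
Proof. by move=> dd; apply: info_mono => //; exact: prev_last_hour_mono. Qed.

Lemma spot_info_bid d t : is_day S d -> in_day S d t -> spot_rvs X t `<=` info_bid X d.
Proof.
move=> hd dt Y HY; have d0 : (0 < d)%N by case/andP: hd.
exists (prev_last_hour S d) => /=; first by rewrite leqnn.
right; split.
  by exists t; [exact: in_day_hour dt|rewrite (day_of_in_day d0 dt)].
exists t => //; move: dt; rewrite /in_day last_hourE// /first_hour /prev_last_hour.
by rewrite addn1.
Qed.

Lemma kappa_info d t : is_day S d -> in_day S d t ->
  kappa_rvs X t `<=` info X (first_hour S d) t.
Proof.
move=> hd dt Y HY; have d0 : (0 < d)%N by case/andP: hd.
exists (first_hour S d) => /=; first by rewrite leqnn; case/andP: dt.
left; right; split; first by exists d.
exists t => //; move: dt; rewrite /in_day last_hourE// /first_hour /prev_last_hour.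
by have := hpd_gt0 S; lia.
Qed.

Lemma rho_info d t : is_day S d -> in_day S d t ->
  rho_rvs X t `<=` info X (first_hour S d) t.
Proof.
move=> hd dt Y HY; exists t => /=; first by rewrite leqnn andbT; case/andP: dt.
by left; left; split; [exact: in_day_hour dt|right].
Qed.

(** Independence needs every activation and allocation known at the closing time of day [d] to come
    from an earlier day. The allocations of a day are all revealed in its first hour; if that hour
    precedes the closing time, then so does the whole day. *)
Lemma info_bid_sources d Y : is_day S d -> info_bid X d Y ->
  all_hours (S := S) (spot_rvs X) Y \/ all_hours (S := S) (psi_rvs X) Y \/
  exists t, [/\ is_hour S t, (t <= prev_last_hour S d)%N &
    rho_rvs X t Y \/ kappa_rvs X t Y].
Proof.
move=> hd [tau /= taud [[[htau [HY|HY]]|[[d' hd' tauE] [tau' tau'P HY]]]|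
  [[t ht tauE] [tau' tau'P HY]]]].
- by right; left; exists tau.
- by right; right; exists tau; split => //; left.
- have d0 : (0 < d')%N by case/andP: hd'.
  have dt : in_day S d' tau'.
    rewrite /in_day last_hourE//; move: tau'P; rewrite tauE /first_hour /prev_last_hour.
    by have := hpd_gt0 S; lia.
  right; right; exists tau'; split; [exact: in_day_hour dt| |by right].
  have dd : (d' < d)%N.
    move: taud; rewrite tauE /first_hour /prev_last_hour ltn_pmul2r ?hpd_gt0//.
    by lia.
  move: dt => /andP[_ /leq_trans]; apply.
  by rewrite /last_hour /prev_last_hour leq_mul2r; apply/orP; right; lia.
- left; exists tau' => //=; have [hd' dt] := is_hour_day ht.
  apply: (in_day_hour hd'); move: tau'P; rewrite /in_day last_hourE// tauE /first_hour.
  by rewrite /prev_last_hour addn1.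
Qed.

End information.

Lemma ae_le_integrable {d : measure_display} {T : measurableType d} {R : realType}
    (mu : {measure set T -> \bar R}) (f g : T -> R) :
  measurable_fun setT f -> mu.-integrable setT (EFin \o g) ->
  {ae mu, forall t, `|f t| <= `|g t|} -> mu.-integrable setT (EFin \o f).
Proof.
move=> mf /integrableP[mg gi] fg; apply/integrableP; split; first exact/measurable_EFinP.
apply: le_lt_trans gi; apply: ae_ge0_le_integral => //.
- by apply: measurableT_comp => //; exact/measurable_EFinP.
- exact: measurableT_comp.
- by apply: filterS fg => t H _; rewrite /= lee_fin.
Qed.

Lemma open_prod (T U : topologicalType) (A : set T) (B : set U) : open A -> open B ->
  open [set x : T * U | A x.1 /\ B x.2].
Proof.
move=> oA oB; rewrite openE => x /= [Ax Bx]; exists (A, B) => //.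
by split; exact: open_nbhs_nbhs.
Qed.

Section market_consequences.
Context {R : realType} {S : hydro_system R} {disp : measure_display}
  {Omega : measurableType disp} {P : probability Omega R} (X : market S P).
Hypothesis hX : market_assumptions X.

Lemma rho_bounds_ae t : is_hour S t -> {ae P, forall om,
  0 <= rho_u X t om <= rhobar_u X t /\ 0 <= rho_v X t om <= rhobar_v X t}.
Proof.
move=> ht; have := @ae_rv_support _ _ _ P (rho_u X t) (rho_v X t)
  (measurable_funPT _) (measurable_funPT _).
by rewrite (rho_support hX ht); apply: filterS => om [].
Qed.

(** Since [rhobar_u <= 1], the corner [(rhobar_u, 0)] satisfies the sum constraint and belongs to
    the support, so its neighbourhoods are charged. The corner itself may be null, whence the slack
    [e]. *)
Lemma rho_u_corner t e : is_hour S t -> 0 < e ->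
  (0 < P [set om | (rhobar_u X t - e < rho_u X t om)%R /\ (rho_v X t om < e)%R])%E.
Proof.
move=> ht e0; have [/andP[u0 u1] /andP[v0 v1]] := rhobar_bounds hX ht.
have : rv_support P (fun om => (rho_u X t om, rho_v X t om) : R * R) (rhobar_u X t, 0).
  by rewrite (rho_support hX ht) /=; split; rewrite ?lexx ?andbT; lra.
move=> /(_ [set x : R * R | rhobar_u X t - e < x.1 /\ x.2 < e]); apply.
  exact: (open_prod (@open_gt _ _) (@open_lt _ _)).
by rewrite /=; split; lra.
Qed.

Lemma rho_v_corner t e : is_hour S t -> 0 < e ->
  (0 < P [set om | (rho_u X t om < e)%R /\ (rhobar_v X t - e < rho_v X t om)%R])%E.
Proof.
move=> ht e0; have [/andP[u0 u1] /andP[v0 v1]] := rhobar_bounds hX ht.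
have : rv_support P (fun om => (rho_u X t om, rho_v X t om) : R * R) (0, rhobar_v X t).
  by rewrite (rho_support hX ht) /=; split; rewrite ?lexx ?andbT; lra.
move=> /(_ [set x : R * R | x.1 < e /\ rhobar_v X t - e < x.2]); apply.
  exact: (open_prod (@open_lt _ _) (@open_gt _ _)).
by rewrite /=; split; lra.
Qed.

Lemma bernoulli_positive (Y : {RV P >-> bool}) : bernoulli_rv Y ->
  (0 < P [set om | ((Y om)%:R = 1 :> R)%R])%E.
Proof.
move=> [p [/andP[p0 p1] /(_ [set true])]].
rewrite bernoulli_probE ?(ltW p0) ?(ltW p1)// /distribution /pushforward.
rewrite !diracE mem_set//= memNset//= mule1 mule0 adde0 => E.
suff -> : [set om | (Y om)%:R = 1 :> R] = Y @^-1` [set true] by rewrite E lte_fin.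
apply/seteqP; split => om /=; last by move=> ->.
by case: (Y om) => // /eqP; rewrite eq_sym oner_eq0.
Qed.

Lemma kapu_positive t : is_hour S t -> (0 < P [set om | (kapu X t om = 1)%R])%E.
Proof. by move=> /(kappa_bernoulli hX)[/bernoulli_positive]. Qed.

Lemma kapv_positive t : is_hour S t -> (0 < P [set om | (kapv X t om = 1)%R])%E.
Proof. by move=> /(kappa_bernoulli hX)[_ /bernoulli_positive]. Qed.

Lemma integrable_spot t Y : is_hour S t -> spot_rvs X t Y ->
  P.-integrable setT (EFin \o Y).
Proof. by move=> ht HY; apply: (finite_expectations hX); do 3 left; exists t. Qed.

Lemma integrable_psi t Y : is_hour S t -> psi_rvs X t Y ->
  P.-integrable setT (EFin \o Y).
Proof. by move=> ht HY; apply: (finite_expectations hX); do 2 left; right; exists t. Qed.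

Lemma integrable_pi_s t : is_hour S t -> P.-integrable setT (EFin \o pi_s X t).
Proof. by move=> ht; apply: (integrable_spot ht); left; left; left. Qed.

(** The allocation and the activation take values in [[0, 1]], so the revenue is dominated by the
    sum of the two absolute prices. *)
Lemma integrable_revenue (k : {RV P >-> bool}) (rho : {RV P >-> R}) (pi psi : Omega -> R) :
  measurable_fun setT pi -> measurable_fun setT psi ->
  P.-integrable setT (EFin \o pi) -> P.-integrable setT (EFin \o psi) ->
  {ae P, forall om, 0 <= rho om <= 1} ->
  P.-integrable setT (EFin \o (fun om => (k om)%:R * (pi om + rho om * psi om))).
Proof.
move=> mpi mpsi ipi ipsi rho01.
have mk := measurable_natr_bool k.
apply: (@ae_le_integrable _ _ _ _ _ (fun om => `|pi om| + `|psi om|)).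
- apply: measurable_funM => //; apply: measurable_funD => //.
  exact: measurable_funM.
- by apply: (@integrableD _ _ _ P setT measurableT (EFin \o (fun om => `|pi om|))
    (EFin \o (fun om => `|psi om|))); exact: integrable_norm.
- apply: filterS rho01 => om /andP[r0 r1].
  rewrite normrM (ger0_norm (addr_ge0 (normr_ge0 _) (normr_ge0 _))).
  have kn : `|(k om)%:R : R| <= 1 by case: (k om); rewrite ?normr1 ?normr0.
  have H : `|pi om + rho om * psi om| <= `|pi om| + `|psi om|.
    rewrite (le_trans (ler_normD _ _))// lerD2l normrM ger0_norm// -[leRHS]mul1r.
    by rewrite ler_wpM2r.
  by rewrite (le_trans (ler_wpM2r _ kn))// mul1r.
Qed.

Lemma integrable_rev_u t : is_hour S t -> P.-integrable setT (EFin \o rev_u X t).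
Proof.
move=> ht; apply: integrable_revenue => //.
- by apply: (integrable_spot ht); left; left; right.
- by apply: (integrable_psi ht); left.
- have [/andP[_ u1] _] := rhobar_bounds hX ht.
  apply: filterS (rho_bounds_ae ht) => om [/andP[-> H] _] /=.
  exact: le_trans u1.
Qed.

Lemma integrable_rev_v t : is_hour S t -> P.-integrable setT (EFin \o rev_v X t).
Proof.
move=> ht; apply: integrable_revenue => //.
- by apply: (integrable_spot ht); left; right.
- by apply: (integrable_psi ht); right.
- have [_ /andP[_ u1]] := rhobar_bounds hX ht.
  apply: filterS (rho_bounds_ae ht) => om [_ /andP[-> H]] /=.
  exact: le_trans u1.
Qed.

End market_consequences.

Section day_events.
Context {R : realType} {S : hydro_system R} {disp : measure_display}
  {Omega : measurableType disp} {P : probability Omega R} (X : market S P).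

Lemma sigma_rvT (G : set (Omega -> R)) : sigma_rv G setT.
Proof. by rewrite -setC0; apply: sigma_algebraC; exact: sigma_algebra0. Qed.

Lemma sigma_rvI (G : set (Omega -> R)) : setI_closed (sigma_rv G).
Proof. by move=> A B GA GB; exact: (@measurableI _ (g_sigma_algebraType (rv_gen G))). Qed.

Lemma sigma_rv_day (G : set (Omega -> R)) d (A : nat -> set Omega) :
  (forall t, in_day S d t -> sigma_rv G (A t)) ->
  sigma_rv G [set om | forall t, in_day S d t -> A t om].
Proof.
move=> GA; rewrite (_ : mkset _ =
    \bigcap_(t in [set` index_iota (first_hour S d) (last_hour S d).+1]) A t).
  apply: (@fin_bigcap_measurable _ (g_sigma_algebraType (rv_gen G))) => // t.
  by rewrite /= mem_index_iota => dt; exact: GA.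
by apply/seteqP; split => om /= H t; have := H t; rewrite /= mem_index_iota.
Qed.

(** The pairs of day [d] form the block [J]; the pairs of all earlier hours and the remaining
    variables, at index [None], form the group [L], which covers whatever [G] may contain. *)
Lemma independent_day_event (V : nat -> set (Omega -> R)) (rest : set (Omega -> R))
    (d : nat) (A : nat -> set Omega) (E := [set om | forall t, in_day S d t -> A t om]) :
  independent_pairs (S := S) (P := P) V rest ->
  (forall t, all_measurable (V t)) -> all_measurable rest -> is_day S d ->
  (forall t, in_day S d t -> sigma_rv (V t) (A t) /\ (0 < P (A t))%E) ->
  [/\ measurable E, (0 < P E)%E &
    forall G : set (Omega -> R),
    (forall Y, G Y -> rest Y \/
      exists t, [/\ is_hour S t, (t <= prev_last_hour S d)%N & V t Y]) ->
    forall C, sigma_rv G C -> P (E `&` C) = (P E * P C)%E].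
Proof.
move=> indep mV mrest hd HA.
pose J := map Some (index_iota (first_hour S d) (last_hour S d).+1).
pose L := None :: map Some (index_iota 1 (first_hour S d)).
pose F := pair_vs_rest V rest.
pose A' i := if i is Some t then A t else setT.
have memJ t : Some t \in J = in_day S d t.
  by rewrite (mem_map (fun x y => @Some_inj _ x y)) mem_index_iota.
have noneJ : None \notin J by apply/negP => /mapP[].
have EE : E = \bigcap_(i in [set` J]) A' i.
  apply/seteqP; split => om /=; first by move=> H [t|//] /=; rewrite memJ; exact: H.
  by move=> H t dt; apply: (H (Some t)); rewrite /= memJ.
have FmE i : F i `<=` measurable.
  by case: i => [t|]; apply: sigma_rv_sub.
have FI i : setI_closed (F i) by exact: sigma_rvI.
have FT i : F i setT by exact: sigma_rvT.
have FA i : i \in J -> F i (A' i).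
  by case: i => [t|] //; rewrite memJ => /HA[].
have uJL : uniq (J ++ L).
  have SI : injective (@Some nat) by move=> x y [].
  rewrite cat_uniq /L [has _ _]/= cons_uniq !map_inj_uniq ?iota_uniq//= (negbTE noneJ) /=.
  rewrite andbT; apply/andP; split; last by apply/negP => /mapP[].
  apply/hasPn => _ /mapP[t + ->]; rewrite mem_index_iota memJ => /andP[_ tf].
  by rewrite /in_day leqNgt tf.
have JLD i : i \in J ++ L -> [set i | if i is Some t then is_hour S t else true] i.
  rewrite mem_cat => /orP[]; case: i => [t|] //=.
    by rewrite memJ => dt; exact: in_day_hour dt.
  rewrite /L inE /= (mem_map (fun x y => @Some_inj _ x y)) mem_index_iota => /andP[t1 tf].
  rewrite /is_hour t1 /=; apply: leq_trans (prev_last_hour_le hd); exact: tf.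
split.
- by rewrite EE; apply: fin_bigcap_measurable => // i /= iJ; exact: (FmE i _ (FA i iJ)).
- rewrite EE (indep J A'); last 2 first.
  + by move: uJL; rewrite cat_uniq => /and3P[].
  + by move=> i iJ; split; [apply: JLD; rewrite mem_cat iJ|exact: FA].
  rewrite big_seq; apply: (big_ind (fun x => 0 < x)%E) => //.
    by move=> x y; exact: mule_gt0.
  by case=> [t|]; [rewrite memJ => /HA[]|rewrite (negbTE noneJ)].
- move=> G HG C GC; rewrite EE.
  apply: (mutually_independent_split FmE FI FT indep uJL JLD FA).
  move: C GC; apply: smallest_sub; first exact: smallest_sigma_algebra.
  move=> _ [Y GY [B mB <-]]; rewrite setTI; apply: sub_gen_smallest.
  case: (HG Y GY) => [rY|[t [ht tp VY]]].
    by exists None => //; exact: sigma_rv_preimage.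
  exists (Some t); last exact: sigma_rv_preimage.
  rewrite /= inE /= (mem_map (fun x y => @Some_inj _ x y)) mem_index_iota.
  by case/andP: ht => -> _.
Qed.

Hypothesis hX : market_assumptions X.

(** The two independence assumptions are chained. The activation event [EA] is independent of the
    closing information enlarged by all allocations, which contains [EB ∩ C]; the allocation event
    [EB] is in turn independent of [C]. *)
Lemma day_event d (A B : nat -> set Omega)
    (E := [set om | forall t, in_day S d t -> A t om /\ B t om]) : is_day S d ->
  (forall t, in_day S d t -> sigma_rv (rho_rvs X t) (A t) /\ (0 < P (A t))%E) ->
  (forall t, in_day S d t -> sigma_rv (kappa_rvs X t) (B t) /\ (0 < P (B t))%E) ->
  [/\ measurable E, (0 < P E)%E &
    forall C, sigma_rv (info_bid X d) C -> P (E `&` C) = (P E * P C)%E].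
Proof.
move=> hd HA HB.
have mall V : (forall t, all_measurable (V t)) ->
    all_measurable (all_hours (S := S) V : set (Omega -> R)).
  by move=> mV Y [t _ /mV].
have ms := mall _ (@measurable_spot _ _ _ _ _ X).
have mp := mall _ (@measurable_psi _ _ _ _ _ X).
have mr := mall _ (@measurable_rho _ _ _ _ _ X).
have mk := mall _ (@measurable_kappa _ _ _ _ _ X).
have mU (G1 G2 G3 : set (Omega -> R)) : all_measurable G1 -> all_measurable G2 ->
    all_measurable G3 -> all_measurable (G1 `|` G2 `|` G3).
  by move=> m1 m2 m3 Y [[/m1|/m2]|/m3].
have [mA PA HA'] := independent_day_event (rho_indep hX)
  (@measurable_rho _ _ _ _ _ X) (mU _ _ _ ms mp mk) hd HA.
have [mB PB HB'] := independent_day_event (kappa_indep hX)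
  (@measurable_kappa _ _ _ _ _ X) (mU _ _ _ ms mp mr) hd HB.
set EA := (X in measurable X) in mA PA HA'; set EB := (X in measurable X) in mB PB HB'.
have EE : E = EA `&` EB.
  apply/seteqP; split => om /=; first by move=> H; split => t /H[].
  by move=> [H1 H2] t dt; split; [exact: H1|exact: H2].
have HBC C : sigma_rv (info_bid X d) C -> P (EB `&` C) = (P EB * P C)%E.
  apply: HB' => Y /(info_bid_sources hd)[HY|[HY|[t [ht tp [HY|HY]]]]].
  - by left; left; left.
  - by left; left; right.
  - by left; right; exists t.
  - by right; exists t.
have HAC C : sigma_rv (info_bid X d) C -> P (EA `&` (EB `&` C)) = (P EA * P (EB `&` C))%E.
  move=> IC; apply: (HA' (info_bid X d `|` all_hours (S := S) (kappa_rvs X))).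
    move=> Y [/(info_bid_sources hd)[HY|[HY|[t [ht tp [HY|HY]]]]]|HY].
    - by left; left; left.
    - by left; left; right.
    - by right; exists t.
    - by left; right; exists t.
    - by left; right.
  apply: sigma_rvI; last by apply: sigma_rv_mono IC; exact: subsetUl.
  apply: sigma_rv_day => t dt; have [+ _] := HB t dt.
  apply: sigma_rv_mono; apply: subset_trans (@subsetUr _ _ _) => Y HY.
  by exists t => //; exact: in_day_hour dt.
have PE : P E = (P EA * P EB)%E.
  have := HAC _ (@sigma_rvT _).
  by rewrite !setIT -EE.
split.
- by rewrite EE; exact: measurableI.
- by rewrite PE; exact: mule_gt0.
- by move=> C IC; rewrite EE -setIA HAC// HBC// -EE PE muleA.
Qed.

End day_events.

(** * The trader's problem as a linear program *)

Section interpolation.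
Context {R : realType} {S : hydro_system R}.
Implicit Types (t : nat) (g p z : flow S) (l : R).

Lemma dotvE n (x y : 'cV[R]_n) : dotv x y = \sum_i x i ord0 * y i ord0.
Proof. by rewrite /dotv !mxE; apply: eq_bigr => i _; rewrite mxE. Qed.

Lemma dotvDr n (x y y' : 'cV[R]_n) : dotv x (y + y') = dotv x y + dotv x y'.
Proof. by rewrite /dotv mulmxDr mxE. Qed.

Lemma dotvZr n a (x y : 'cV[R]_n) : dotv x (a *: y) = a * dotv x y.
Proof. by rewrite /dotv -scalemxAr mxE. Qed.

(* Moving from [(g, p)] towards [(0, pmax)] covers every energy between
   [energy t g p] and [- zeta^T pmax]; the water withheld is spilled, so that the
   net flow, hence every filling level, is unchanged. *)
Definition mix_g l g : flow S := l *: g.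
Definition mix_p t l p : flow S := l *: p + (1 - l) *: pmax S t.
Definition mix_z t l g p z : flow S := z + (1 - l) *: (g - p + pmax S t).

Lemma mix_net t l g p z :
  mix_g l g - mix_p t l p + mix_z t l g p z = g - p + z.
Proof. by apply/matrixP => i j; rewrite !mxE; ring. Qed.

(** Capacities survive by convexity, and the added spill is nonnegative because [0 <= g] and
    [p <= pmax]. *)
Lemma mix_bounds t l (u v : R) g p z : is_hour S t -> 0 <= l <= 1 ->
  bounds t u v g p z -> bounds t u v (mix_g l g) (mix_p t l p) (mix_z t l g p z).
Proof.
move=> ht /andP[l0 l1] [u0 v0 [g0 gm] [p0 pm] z0].
have P0 := pmax_ge0 ht.
split => //; [split|split|] => i; rewrite !mxE.
- by have := g0 i; rewrite mxE; nra.
- by have := g0 i; have := gm i; rewrite mxE; nra.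
- by have := p0 i; have := P0 i; rewrite mxE; nra.
- by have := pm i; nra.
- by have := z0 i; have := g0 i; have := pm i; rewrite mxE; nra.
Qed.

Lemma mix_energy t l g p :
  energy t (mix_g l g) (mix_p t l p) =
  l * energy t g p + (1 - l) * - dotv (zeta S t) (pmax S t).
Proof. by rewrite /energy /mix_g /mix_p dotvDr !dotvZr; ring. Qed.

(** The root [l] of [l * energy t g p + (1 - l) * - Z = e], with
    [Z = dotv (zeta S t) (pmax S t)]. *)
Definition mix_weight t (e : R) g p : R :=
  (e + dotv (zeta S t) (pmax S t)) / (energy t g p + dotv (zeta S t) (pmax S t)).

Lemma mix_weightP t (e : R) g p (l := mix_weight t e g p) :
  - dotv (zeta S t) (pmax S t) <= e <= energy t g p ->
  0 <= l <= 1 /\ energy t (mix_g l g) (mix_p t l p) = e.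
Proof.
rewrite mix_energy /l /mix_weight; set Z := dotv _ _; set E := energy _ _ _.
(* In the degenerate case the range of energies is a single point, which is [e]; division by [0]
   gives the weight [0]. *)
move=> /andP[Ze eE]; have [EZ|EZ] := eqVneq (E + Z) 0.
  rewrite EZ invr0 mulr0 lexx ler01; split => //; lra.
have EZ0 : 0 < E + Z by rewrite lt_neqAle eq_sym EZ; lra.
split; last by field.
by rewrite divr_ge0 ?ler_pdivrMr//; lra.
Qed.

End interpolation.

Section daily_program.
Context {R : realType} {S : hydro_system R} {disp : measure_display}
  {Omega : measurableType disp} {P : probability Omega R} (X : market S P).
Variables tpi_s tpi_u tpi_v : nat -> Omega -> R.

Lemma level_after_ext d t (w : level S) (g p z g' p' z' : nat -> Omega -> flow S) om om' :
  (forall tau, (first_hour S d <= tau <= t)%N ->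
    inflow X tau om = inflow X tau om' /\
    g tau om - p tau om + z tau om = g' tau om' - p' tau om' + z' tau om') ->
  level_after X d t w g p z om = level_after X d t w g' p' z' om'.
Proof.
move=> H; congr (_ + _); apply: eq_big_nat => tau; rewrite ltnS => /H[-> ->].
by [].
Qed.

Definition fixed_level d t (w : level S) (g p z : nat -> flow S) om : level S :=
  level_after X d t w (fun tau _ => g tau) (fun tau _ => p tau) (fun tau _ => z tau) om.

(* The constraints of the reduced bidding model for day [d] in the outcome [om]. *)
Record lp_feasible d (wprev wend : level S) om (s u v : nat -> R)
    (g p z : nat -> flow S) : Prop := LpFeasible {
  lp_hour : forall t, in_day S d t ->
    [/\ bounds t (u t) (v t) (g t) (p t) (z t),
        s t + rhobar_u X t * u t = energy t (g t) (p t),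
        s t - rhobar_v X t * v t >= - dotv (zeta S t) (pmax S t)
      & level_bounds t (fixed_level d t wprev g p z om)];
  lp_target : lev wend (fixed_level d (last_hour S d) wprev g p z om) }.

Definition lp_objective d om (s u v : nat -> R) : R :=
  \sum_(first_hour S d <= t < (last_hour S d).+1)
    (tpi_s t om * s t + tpi_u t om * u t + tpi_v t om * v t).

Definition lp_value d (wprev wend : level S) om : \bar R :=
  ereal_sup [set x | exists s u v g p z,
    lp_feasible d wprev wend om s u v g p z /\ x = (lp_objective d om s u v)%:E].

(** [Q] stands for the law conditioned on the closing information observed in [om]. The last two
    fields quantify over every almost sure property [C], so a single null set of outcomes [om]
    serves the uncountably many strategies of the trader. *)
Record generic_outcome (Q : probability Omega R) d om : Prop := GenericOutcome {
  gen_inflow : forall t, in_day S d t ->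
    {ae Q, forall om', inflow X t om' = inflow X t om};
  gen_rho : forall t, in_day S d t -> {ae Q, forall om',
    0 <= rho_u X t om' <= rhobar_u X t /\ 0 <= rho_v X t om' <= rhobar_v X t};
  gen_pi_s : forall t, in_day S d t -> Q.-integrable setT (EFin \o pi_s X t) /\
    (\int[Q]_om' (pi_s X t om')%:E = (tpi_s t om)%:E)%E;
  gen_rev_u : forall t, in_day S d t -> Q.-integrable setT (EFin \o rev_u X t) /\
    (\int[Q]_om' (rev_u X t om')%:E = (tpi_u t om)%:E)%E;
  gen_rev_v : forall t, in_day S d t -> Q.-integrable setT (EFin \o rev_v X t) /\
    (\int[Q]_om' (rev_v X t om')%:E = (tpi_v t om)%:E)%E;
  gen_full_u : forall (e : R) (C : Omega -> Prop), 0 < e -> {ae Q, forall om', C om'} ->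
    exists2 om', C om' & forall t, in_day S d t ->
      [/\ kapu X t om' = 1, rhobar_u X t - e < rho_u X t om' & rho_v X t om' < e];
  gen_full_v : forall (e : R) (C : Omega -> Prop), 0 < e -> {ae Q, forall om', C om'} ->
    exists2 om', C om' & forall t, in_day S d t ->
      [/\ kapv X t om' = 1, rho_u X t om' < e & rhobar_v X t - e < rho_v X t om'] }.

Lemma kapu01 t om : kapu X t om = 0 \/ kapu X t om = 1.
Proof. by rewrite /kapu; case: (kappa_u X t om); [right|left]. Qed.

Lemma kapv01 t om : kapv X t om = 0 \/ kapv X t om = 1.
Proof. by rewrite /kapv; case: (kappa_v X t om); [right|left]. Qed.

Lemma expected_revenue (Q : probability Omega R) d om t (s u v : R) :
  generic_outcome Q d om -> in_day S d t ->
  ('E_Q[fun om' => revenue X t om' s u v] =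
    (tpi_s t om * s + tpi_u t om * u + tpi_v t om * v)%R%:E)%E.
Proof.
move=> gen dt; have [is_ Es] := gen_pi_s gen dt.
have [iu Eu] := gen_rev_u gen dt; have [iv Ev] := gen_rev_v gen dt.
rewrite expectation.unlock /revenue.
have iZ (f : Omega -> R) c : Q.-integrable setT (EFin \o f) ->
    Q.-integrable setT (fun om' => (f om')%:E * c%:E)%E.
  by move=> fi; exact: integrableZr.
under eq_integral do rewrite !EFinD !EFinM.
rewrite integralD//; [|apply: integrableD => //; exact: iZ|exact: iZ].
rewrite integralD//; [|exact: iZ|exact: iZ].
by rewrite !integralZr// Es Eu Ev -!EFinM -!EFinD.
Qed.

End daily_program.

Lemma measurable_wrt_cst {disp : measure_display} {T : measurableType disp} {R : realType}
    (G : set (T -> R)) (c : R) :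
  measurable_wrt G (fun=> c).
Proof. exact: measurable_cst. Qed.

Lemma inL_bounded {R : realType} {disp : measure_display} {Omega : measurableType disp}
    (mu : probability Omega R) (G : set (Omega -> R)) (f : Omega -> R) (M : R) :
  all_measurable G -> measurable_wrt G f -> (forall om, `|f om| <= M) -> inL mu G f.
Proof.
move=> mG mf fM; split => //.
have mf' : measurable_fun setT f by exact: measurable_sub mf.
apply: (@ae_le_integrable _ _ _ _ _ (cst M)) => //.
  exact: (finite_measure_integrable_cst mu M measurableT).
apply/aeW => om; rewrite (le_trans (fM om))//; exact: ler_norm.
Qed.

Lemma min_positive {R : realType} (f : nat -> R) n :
  (forall t, (t < n)%N -> 0 < f t) -> exists2 e, 0 < e & forall t, (t < n)%N -> e <= f t.
Proof.
elim: n => [|n IH] f0; first by exists 1.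
have [t tn|e e0 He] := IH; first by apply: f0; rewrite ltnS ltnW.
exists (Num.min e (f n)); first by rewrite lt_min e0 f0.
move=> t; rewrite ltnS leq_eqVlt => /orP[/eqP ->|/He le]; rewrite ge_min.
  by rewrite lexx orbT.
by rewrite le.
Qed.

(** The limit [e -> 0], used to get from nearly full activation to full activation. *)
Lemma le_of_small_perturbation {R : realFieldType} (x y c e0 : R) : 0 < e0 ->
  (forall e, 0 < e <= e0 -> x - e * c <= y) -> x <= y.
Proof.
move=> e00 H; apply/ler_addgt0Pr => eta0 eta_gt0.
have c1 : 0 < `|c| + 1 by rewrite ltr_pwDr.
pose e := Num.min e0 (eta0 / (`|c| + 1)).
have e_gt0 : 0 < e by rewrite lt_min e00 divr_gt0.
have := H e; rewrite e_gt0 ge_min lexx => /(_ isT) xy.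
have : e * c <= eta0.
  apply: (@le_trans _ _ (e * (`|c| + 1))).
    apply: ler_wpM2l; first exact: ltW.
    by rewrite (le_trans (ler_norm c))// lerDl.
  by rewrite -ler_pdivlMr// ge_min lexx orbT.
by lra.
Qed.

Section trader.
Context {R : realType} {S : hydro_system R} {disp : measure_display}
  {Omega : measurableType disp} {P : probability Omega R} (X : market S P).
Variables tpi_s tpi_u tpi_v : nat -> Omega -> R.
Hypothesis hX : market_assumptions X.

(** [mix_weight] lies in [[0, 1]] only where the activations respect their bounds, that is almost
    surely; clamped, it is bounded for every outcome, which integrability requires least effort to
    exploit. *)
Definition clamp01 (x : R) : R := Num.max 0 (Num.min 1 x).

Lemma clamp01_ge0_le1 x : 0 <= clamp01 x <= 1.
Proof. by rewrite /clamp01 le_max lexx ge_max ler01 ge_min lexx. Qed.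

Lemma clamp01_id x : 0 <= x <= 1 -> clamp01 x = x.
Proof.
by move=> /andP[x0 x1]; rewrite /clamp01 (min_idPr x1); exact/max_idPr.
Qed.

Lemma measurable_clamp01 {d : measure_display} {T : measurableType d} (f : T -> R) :
  measurable_fun setT f -> measurable_fun setT (fun t => clamp01 (f t)).
Proof.
move=> mf; apply: measurable_maxr; first exact: measurable_cst.
by apply: measurable_minr => //; exact: measurable_cst.
Qed.

Definition mix_rv t (s u v : R) (g p : flow S) (om : Omega) : R :=
  clamp01 (mix_weight t (delivery X t om s u v) g p).

Lemma delivery_bounds t om (u v s : R) : 0 <= u -> 0 <= v ->
  0 <= rho_u X t om <= rhobar_u X t -> 0 <= rho_v X t om <= rhobar_v X t ->
  s - rhobar_v X t * v <= delivery X t om s u v <= s + rhobar_u X t * u.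
Proof.
rewrite /delivery => u0 v0 /andP[a0 a1] /andP[b0 b1].
by case: (kapu01 X t om) => ->; case: (kapv01 X t om) => ->;
  rewrite ?mul0r ?mul1r; apply/andP; split; nra.
Qed.

Lemma mix_rvP t om (s u v : R) (g p z : flow S) : is_hour S t ->
  0 <= rho_u X t om <= rhobar_u X t -> 0 <= rho_v X t om <= rhobar_v X t ->
  bounds t u v g p z -> s + rhobar_u X t * u = energy t g p ->
  s - rhobar_v X t * v >= - dotv (zeta S t) (pmax S t) ->
  let l := mix_rv t s u v g p om in
  bounds t u v (mix_g l g) (mix_p t l p) (mix_z t l g p z) /\
  delivery X t om s u v = energy t (mix_g l g) (mix_p t l p).
Proof.
move=> ht ru rv bd su sv l; have [u0 v0 _ _ _] := bd.
have /andP[d1 d2] := delivery_bounds s u0 v0 ru rv.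
have [|l01 El] := @mix_weightP _ S t (delivery X t om s u v) g p.
  by rewrite (le_trans sv d1) -su.
rewrite /l /mix_rv clamp01_id// El; split => //.
exact: mix_bounds.
Qed.

Lemma measurable_delivery t (G : set (Omega -> R)) (s u v : Omega -> R) :
  kappa_rvs X t `<=` G -> rho_rvs X t `<=` G ->
  measurable_wrt G s -> measurable_wrt G u -> measurable_wrt G v ->
  measurable_wrt G (fun om => delivery X t om (s om) (u om) (v om)).
Proof.
move=> kG rG ms mu mv.
have mk Y : kappa_rvs X t Y -> measurable_wrt G Y.
  by move=> HY; apply: measurable_wrt_mem; exact: kG.
have mr Y : rho_rvs X t Y -> measurable_wrt G Y.
  by move=> HY; apply: measurable_wrt_mem; exact: rG.
apply: measurable_funB; first apply: measurable_funD => //.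
  apply: measurable_funM => //.
  by apply: measurable_funM; [apply: mk; left|apply: mr; left].
apply: measurable_funM => //.
by apply: measurable_funM; [apply: mk; right|apply: mr; right].
Qed.

Lemma lp_trader_feasible (K : Omega -> probability Omega R) d (wprev wend : level S) om
    s u v g p z :
  is_day S d -> generic_outcome X tpi_s tpi_u tpi_v (K om) d om ->
  lp_feasible X d wprev wend om s u v g p z ->
  exists g' p' z', trader_feasible X K d wprev wend om s u v g' p' z'.
Proof.
move=> hd gen [Hh Ht].
pose l t om' := mix_rv t (s t) (u t) (v t) (g t) (p t) om'.
pose g' t om' := mix_g (l t om') (g t).
pose p' t om' := mix_p t (l t om') (p t).
pose z' t om' := mix_z t (l t om') (g t) (p t) (z t).
have infl : {ae K om, forall om', forall tau, in_day S d tau ->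
    inflow X tau om' = inflow X tau om}.
  exact/ae_forall_imply/(gen_inflow gen).
have lvl t om' : (t <= last_hour S d)%N ->
    (forall tau, in_day S d tau -> inflow X tau om' = inflow X tau om) ->
    level_after X d t wprev g' p' z' om' = fixed_level X d t wprev g p z om.
  move=> tl infl'; apply: level_after_ext => tau /andP[t1 t2]; split.
    by apply: infl'; rewrite /in_day t1 (leq_trans t2).
  exact: mix_net.
exists g', p', z'; split.
- move=> t dt; set G := info _ _ _.
  have mG : all_measurable G by exact: measurable_info.
  have ml : measurable_wrt G (l t).
    apply: measurable_clamp01; apply: measurable_funM; last exact: measurable_cst.
    apply: measurable_funD; last exact: measurable_cst.
    apply: (@measurable_delivery t G (fun=> s t) (fun=> u t) (fun=> v t));
      [exact: kappa_info|exact: rho_info|exact: measurable_wrt_cst..].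
  (* Every mixed flow is affine in the weight, with coefficients that are constants once [om] is
     fixed. *)
  have bnd (a b : R) : inL (K om) G (fun om' => a + l t om' * b).
    apply: (@inL_bounded _ _ _ _ _ _ (`|a| + `|b|)) => //.
      apply: measurable_funD; first exact: measurable_cst.
      by apply: measurable_funM => //; exact: measurable_cst.
    move=> om'; rewrite (le_trans (ler_normD _ _))// lerD2l normrM -[leRHS]mul1r.
    rewrite ler_wpM2r//; have /andP[l0 l1] :=
      clamp01_ge0_le1 (mix_weight t (delivery X t om' (s t) (u t) (v t)) (g t) (p t)).
    by rewrite ger0_norm.
  split => i.
  + rewrite (_ : (fun _ => _) = fun om' => 0 + l t om' * g t i ord0); first exact: bnd.
    by apply/funext => om'; rewrite !mxE; ring.
  + rewrite (_ : (fun _ => _) = fun om' => pmax S t i ord0 +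
      l t om' * (p t i ord0 - pmax S t i ord0)); first exact: bnd.
    by apply/funext => om'; rewrite !mxE; ring.
  + rewrite (_ : (fun _ => _) = fun om' => (z t + g t - p t + pmax S t) i ord0 +
      l t om' * - (g t - p t + pmax S t) i ord0); first exact: bnd.
    by apply/funext => om'; rewrite !mxE; ring.
- move=> t dt; have [bd su sv lb] := Hh t dt; have ht := in_day_hour hd dt.
  have rb := gen_rho gen dt.
  apply: filterS2 infl rb => om' infl' [ru rv].
  have [bd' de] := mix_rvP ht ru rv bd su sv.
  by split => //; rewrite lvl//; case/andP: dt.
- by apply: filterS infl => om' infl'; rewrite lvl.
Qed.

Lemma lp_le_trader (K : Omega -> probability Omega R) d (wprev wend : level S) om :
  is_day S d -> generic_outcome X tpi_s tpi_u tpi_v (K om) d om ->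
  (lp_value X tpi_s tpi_u tpi_v d wprev wend om <= trader_value X K d wprev wend om)%E.
Proof.
move=> hd gen; apply: ge_ereal_sup => _ [s [u [v [g [p [z [lpf ->]]]]]]].
have [g' [p' [z' tf]]] := lp_trader_feasible hd gen lpf.
apply: ereal_sup_ubound; exists s, u, v, g', p', z'; split => //.
rewrite /lp_objective -sumEFin; apply: eq_big_nat => t; rewrite ltnS => dt.
by rewrite (expected_revenue _ _ _ gen).
Qed.

(** Bids perturbed by order [e] are feasible for the program and lose only [e * c] of the objective,
    with [c] independent of [e]; the supremum of the program absorbs this as [e] tends to [0]. *)
Lemma trader_le_lp (K : Omega -> probability Omega R) d (wprev wend : level S) om :
  is_day S d -> generic_outcome X tpi_s tpi_u tpi_v (K om) d om ->
  (trader_value X K d wprev wend om <= lp_value X tpi_s tpi_u tpi_v d wprev wend om)%E.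
Proof.
move=> hd gen; apply: ge_ereal_sup => _ [s [u [v [g [p [z [[_ tc tt] ->]]]]]]].
have -> : (\sum_(first_hour S d <= t < (last_hour S d).+1)
    'E_(K om)[fun om' => revenue X t om' (s t) (u t) (v t)])%E =
    (lp_objective (S := S) tpi_s tpi_u tpi_v d om s u v)%:E.
  rewrite /lp_objective -sumEFin; apply: eq_big_nat => t; rewrite ltnS => dt.
  by rewrite (expected_revenue _ _ _ gen).
have infl : {ae K om, forall om', forall tau, in_day S d tau ->
    inflow X tau om' = inflow X tau om}.
  exact/ae_forall_imply/(gen_inflow gen).
have tc' := ae_forall_imply tc.
pose good om' :=
  [/\ forall tau, in_day S d tau -> inflow X tau om' = inflow X tau om,
      forall t, in_day S d t -> [/\ bounds t (u t) (v t) (g t om') (p t om') (z t om'),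
        delivery X t om' (s t) (u t) (v t) = energy t (g t om') (p t om')
        & level_bounds t (level_after X d t wprev g p z om')]
    & lev wend (level_after X d (last_hour S d) wprev g p z om')].
have all : {ae K om, forall om', good om'}.
  by apply: filterS3 infl tc' tt => om' ? ? ?; split.
have sv t : in_day S d t -> s t - rhobar_v X t * v t >= - dotv (zeta S t) (pmax S t).
  (* Under nearly full downward activation the delivery is at most [s - rhobar_v * v + e * (u + v)],
     whereas every admissible decision yields at least [-zeta^T pmax]. *)
  move=> dt; apply: (@le_of_small_perturbation _ _ _ (u t + v t) 1) => // e /andP[e0 _].
  have [om' [_ tcom _] /(_ t dt)[kv ru rv]] := gen_full_v gen e0 all.
  have [[u0 v0 [g0 _] [_ pm] _] de _] := tcom t dt.
  have ez : - dotv (zeta S t) (pmax S t) <= energy t (g t om') (p t om').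
    rewrite /energy !dotvE.
    have ht := in_day_hour hd dt.
    have H1 : 0 <= \sum_i eta S t i ord0 * g t om' i ord0.
      apply: sumr_ge0 => i _; have := eta_ge0 ht i; have := g0 i; rewrite !mxE.
      by move=> *; exact: mulr_ge0.
    have H2 : \sum_i zeta S t i ord0 * p t om' i ord0 <=
        \sum_i zeta S t i ord0 * pmax S t i ord0.
      apply: ler_sum => i _; apply: ler_wpM2l; last exact: pm.
      by have := zeta_ge0 ht i; rewrite mxE.
    by lra.
  move: de ez; rewrite /delivery kv => <-; case: (kapu01 X t om') => ->; nra.
(* For [e <= e0] the factors [1 - e / rhobar_u] and [1 - e / rhobar_v] are nonnegative in every
   hour, and so are the perturbed bids. *)
have [e0 e00 He0] : exists2 e0, 0 < e0 & forall t, is_hour S t ->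
    e0 <= rhobar_u X t /\ e0 <= rhobar_v X t.
  have [t tn|e e0 He] := @min_positive _ (fun t => if is_hour S t then
      Num.min (rhobar_u X t) (rhobar_v X t) else 1) (nhours S).+1.
    case: ifP => // ht; have [/andP[a _] /andP[b _]] := rhobar_bounds hX ht.
    by rewrite lt_min a b.
  exists e => // t ht; have tn : (t < (nhours S).+1)%N by case/andP: ht.
  by have := He t tn; rewrite ht le_min => /andP.
pose c := \sum_(first_hour S d <= t < (last_hour S d).+1)
  (tpi_s t om * v t + tpi_u t om * (u t / rhobar_u X t)
    + tpi_v t om * (v t / rhobar_v X t)).
have key e : 0 < e <= e0 ->
    ((lp_objective (S := S) tpi_s tpi_u tpi_v d om s u v - e * c)%:E <=
      lp_value X tpi_s tpi_u tpi_v d wprev wend om)%E.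
  move=> /andP[e_gt0 ee0].
  (* These bids absorb the activation error. Since [rhobar_u * u' = (rhobar_u - e) * u], the energy
     [s' + rhobar_u * u'] is at most the one delivered under nearly full upward activation, and can
     be reached by mixing; and [s' - rhobar_v * v' = s - rhobar_v * v], so the downward constraint
     is kept. *)
  pose s' t := s t - e * v t.
  pose u' t := (1 - e / rhobar_u X t) * u t.
  pose v' t := (1 - e / rhobar_v X t) * v t.
  (* The filling levels couple the hours, so the decisions of the whole day are read off one
     scenario, in which all hours are nearly fully activated. *)
  have [om' [infl' tcom ttom] full] := gen_full_u gen e_gt0 all.
  pose l t := mix_weight t (s' t + rhobar_u X t * u' t) (g t om') (p t om').
  pose g' t := mix_g (l t) (g t om').
  pose p' t := mix_p t (l t) (p t om').
  pose z' t := mix_z t (l t) (g t om') (p t om') (z t om').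
  have lvl t : (t <= last_hour S d)%N -> fixed_level X d t wprev g' p' z' om =
      level_after X d t wprev g p z om'.
    move=> tl; apply: level_after_ext => tau /andP[t1 t2]; split.
      by rewrite infl'// /in_day t1 (leq_trans t2).
    exact: mix_net.
  apply: ereal_sup_ubound; exists s', u', v', g', p', z'; split; last first.
    congr (_%:E); rewrite /lp_objective /c mulr_sumr -sumrB.
    by apply: eq_bigr => t _; rewrite /s' /u' /v'; ring.
  split; last by rewrite lvl.
  move=> t dt; have ht := in_day_hour hd dt.
  have [bd de lb] := tcom t dt; have [ku ru rv] := full t dt.
  have [/andP[a0 a1] /andP[b0 b1]] := rhobar_bounds hX ht.
  have [ea eb] := He0 t ht; have [u0 v0 _ _ _] := bd.
  have u'E : rhobar_u X t * u' t = (rhobar_u X t - e) * u t.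
    by rewrite /u'; field; rewrite gt_eqF.
  have v'E : rhobar_v X t * v' t = (rhobar_v X t - e) * v t.
    by rewrite /v'; field; rewrite gt_eqF.
  have u'0 : 0 <= u' t.
    rewrite mulr_ge0// subr_ge0 ler_pdivrMr// mul1r; lra.
  have v'0 : 0 <= v' t.
    rewrite mulr_ge0// subr_ge0 ler_pdivrMr// mul1r; lra.
  have [|l01 El] := @mix_weightP _ S t (s' t + rhobar_u X t * u' t) (g t om') (p t om').
    have svt := sv t dt; apply/andP; split.
      by rewrite u'E /s'; nra.
    rewrite -de /delivery ku u'E /s'; case: (kapv01 X t om') => ->; nra.
  have bd' := mix_bounds ht l01 bd.
  split.
  - by case: bd' => _ _ B1 B2 B3; split.
  - by rewrite /g' /p' /l El.
  - by have := sv t dt; rewrite v'E /s'; lra.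
  - by rewrite lvl//; case/andP: dt.
move: key; case: (lp_value _ _ _ _ _ _ _ _) => [y| |] key; last 2 first.
- by rewrite leey.
- by have := key e0; rewrite e00 lexx => /(_ isT).
rewrite lee_fin; apply: (@le_of_small_perturbation _ _ _ c _ e00) => e he.
by have := key e he; rewrite lee_fin.
Qed.

End trader.

Section generic.
Context {R : realType} {S : hydro_system R} {disp : measure_display}
  {Omega : measurableType disp} {P : probability Omega R} (X : market S P).
Variables tpi_s tpi_u tpi_v : nat -> Omega -> R.
Hypothesis hX : market_assumptions X.
Variables (d : nat) (K : Omega -> probability Omega R).
Hypothesis hd : is_day S d.
Hypothesis hK : is_regular_cond_prob P (info_bid X d) K.

Lemma positive_meets (Q : probability Omega R) (E : set Omega) (C : Omega -> Prop) :
  measurable E -> (0 < Q E)%E -> {ae Q, forall om, C om} -> exists2 om, C om & E om.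
Proof.
move=> mE QE [N [mN QN CN]]; apply: contrapT => H.
have EN : E `<=` N by move=> om Eom; apply: CN => Com; apply: H; exists om.
have : (Q E <= Q N)%E by apply: le_measure; rewrite ?inE.
by rewrite QN leNgt QE.
Qed.

(** By monotonicity in [e] the values [1 / (n + 1)] suffice, which leaves countably many null
    sets. *)
Lemma day_event_ae (A B : R -> nat -> set Omega) :
  (forall e e' t, e <= e' -> A e t `<=` A e' t) ->
  (forall e e' t, e <= e' -> B e t `<=` B e' t) ->
  (forall e t, 0 < e -> in_day S d t -> sigma_rv (rho_rvs X t) (A e t) /\ (0 < P (A e t))%E) ->
  (forall e t, 0 < e -> in_day S d t -> sigma_rv (kappa_rvs X t) (B e t) /\ (0 < P (B e t))%E) ->
  {ae P, forall om, forall (e : R) (C : Omega -> Prop), 0 < e -> {ae K om, forall om', C om'} ->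
    exists2 om', C om' & forall t, in_day S d t -> A e t om' /\ B e t om'}.
Proof.
move=> Amono Bmono HA HB.
pose E n := [set om | forall t, in_day S d t -> A n.+1%:R^-1 t om /\ B n.+1%:R^-1 t om].
have HE n := day_event hX hd (fun t => @HA n.+1%:R^-1 t ltac:(by rewrite invr_gt0))
  (fun t => @HB n.+1%:R^-1 t ltac:(by rewrite invr_gt0)).
have mS : all_measurable (info_bid X d) by exact: measurable_info.
have : {ae P, forall om, forall n, (0 < K om (E n))%E}.
  apply: ae_foralln => n; have [mE PE indep] := HE n.
  exact: (kernel_positive mS hK mE PE indep).
apply: filterS => om KE e C e0 HC.
pose n := Num.trunc e^-1.
have ne : n.+1%:R^-1 <= e.
  by rewrite invf_ple ?posrE// ltW// truncnS_gt.
have [mE _ _] := HE n; have [om' Com' Eom'] := positive_meets mE (KE n) HC.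
exists om' => // t dt; have [a b] := Eom' t dt.
by split; [exact: Amono a|exact: Bmono b].
Qed.

Hypothesis htpi : forall t, in_day S d t ->
  [/\ is_cond_exp P (info_bid X d) (pi_s X t) (tpi_s t),
      is_cond_exp P (info_bid X d) (rev_u X t) (tpi_u t) &
      is_cond_exp P (info_bid X d) (rev_v X t) (tpi_v t)].

Lemma generic_ae : {ae P, forall om, generic_outcome X tpi_s tpi_u tpi_v (K om) d om}.
Proof.
have mS : all_measurable (info_bid X d) by exact: measurable_info.
have hour t : in_day S d t -> is_hour S t by exact: in_day_hour.
have Ainfl : {ae P, forall om, forall t, in_day S d t ->
    {ae K om, forall om', inflow X t om' = inflow X t om}}.
  apply: ae_forall_imply => t dt.
  have : {ae P, forall om, forall r, {ae K om, forall om', phi X t r om' = phi X t r om}}.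
    apply: ae_forall_fin => r; apply: (kernel_const mS hK).
    by apply: measurable_wrt_mem; apply: (spot_info_bid hd dt); right; exists r.
  apply: filterS => om /ae_forall_fin; apply: filterS => om' H.
  by apply/matrixP => i j; rewrite !mxE H.
have Arho : {ae P, forall om, forall t, in_day S d t -> {ae K om, forall om',
    0 <= rho_u X t om' <= rhobar_u X t /\ 0 <= rho_v X t om' <= rhobar_v X t}}.
  apply: ae_forall_imply => t dt; apply: (kernel_ae mS hK).
  exact/(rho_bounds_ae hX)/hour.
have Amom (Y Z : nat -> Omega -> R) :
    (forall t, in_day S d t -> P.-integrable setT (EFin \o Y t)) ->
    (forall t, in_day S d t -> is_cond_exp P (info_bid X d) (Y t) (Z t)) ->
    {ae P, forall om, forall t, in_day S d t -> (K om).-integrable setT (EFin \o Y t) /\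
      (\int[K om]_om' (Y t om')%:E = (Z t om)%:E)%E}.
  move=> iY YZ; apply: ae_forall_imply => t dt.
  have H1 := kernel_integrable mS hK (iY t dt).
  have H2 := kernel_cond_exp mS hK (iY t dt) (YZ t dt).
  by apply: filterS2 H1 H2 => om ? ?; split.
have As := Amom (pi_s X) tpi_s (fun t dt => integrable_pi_s hX (hour t dt))
  (fun t dt => let: And3 H _ _ := htpi dt in H).
have Au := Amom (rev_u X) tpi_u (fun t dt => integrable_rev_u hX (hour t dt))
  (fun t dt => let: And3 _ H _ := htpi dt in H).
have Av := Amom (rev_v X) tpi_v (fun t dt => integrable_rev_v hX (hour t dt))
  (fun t dt => let: And3 _ _ H := htpi dt in H).
have rS t (Y : Omega -> R) B : measurable B -> rho_rvs X t Y ->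
    sigma_rv (rho_rvs X t) (Y @^-1` B).
  by move=> mB HY; exact: sigma_rv_preimage.
have kS t (Y : Omega -> R) B : measurable B -> kappa_rvs X t Y ->
    sigma_rv (kappa_rvs X t) (Y @^-1` B).
  by move=> mB HY; exact: sigma_rv_preimage.
have mgt (c : R) : measurable [set y | c < y] by apply: open_measurable; exact: open_gt.
have mlt (c : R) : measurable [set y | y < c] by apply: open_measurable; exact: open_lt.
have Fu := @day_event_ae
  (fun e t => [set om | rhobar_u X t - e < rho_u X t om /\ rho_v X t om < e])
  (fun _ t => [set om | kapu X t om = 1]).
have Fv := @day_event_ae
  (fun e t => [set om | rho_u X t om < e /\ rhobar_v X t - e < rho_v X t om])
  (fun _ t => [set om | kapv X t om = 1]).
have Gu : {ae P, forall om, forall (e : R) (C : Omega -> Prop), 0 < e ->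
    {ae K om, forall om', C om'} -> exists2 om', C om' & forall t, in_day S d t ->
    (rhobar_u X t - e < rho_u X t om' /\ rho_v X t om' < e) /\ kapu X t om' = 1}.
  apply: Fu => //.
  - by move=> e e' t ee om /= [h1 h2]; split; lra.
  - by move=> e e' t _ om.
  - move=> e t e0 dt; split; last exact: (rho_u_corner hX (hour t dt) e0).
    exact: (@sigma_rvI _ _ _ _ _ _ (rS t (rho_u X t) _ (mgt _) (or_introl erefl))
      (rS t (rho_v X t) _ (mlt _) (or_intror erefl))).
  - move=> e t e0 dt; split; last exact: (kapu_positive hX (hour t dt)).
    exact: (kS t (kapu X t) [set 1] (measurable_set1 1) (or_introl erefl)).
have Gv : {ae P, forall om, forall (e : R) (C : Omega -> Prop), 0 < e ->
    {ae K om, forall om', C om'} -> exists2 om', C om' & forall t, in_day S d t ->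
    (rho_u X t om' < e /\ rhobar_v X t - e < rho_v X t om') /\ kapv X t om' = 1}.
  apply: Fv => //.
  - by move=> e e' t ee om /= [h1 h2]; split; lra.
  - by move=> e e' t _ om.
  - move=> e t e0 dt; split; last exact: (rho_v_corner hX (hour t dt) e0).
    exact: (@sigma_rvI _ _ _ _ _ _ (rS t (rho_u X t) _ (mlt _) (or_introl erefl))
      (rS t (rho_v X t) _ (mgt _) (or_intror erefl))).
  - move=> e t e0 dt; split; last exact: (kapv_positive hX (hour t dt)).
    exact: (kS t (kapv X t) [set 1] (measurable_set1 1) (or_intror erefl)).
move: Gv; apply: filter_app; move: Gu; apply: filter_app; move: Av; apply: filter_app.
move: Au; apply: filter_app; move: As; apply: filter_app; move: Arho; apply: filter_app.
move: Ainfl; apply: filterS => om h1 h2 h3 h4 h5 h6 h7; split => //.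
- move=> e C e0 HC; have [om' Com' H] := h6 e C e0 HC.
  by exists om' => // t dt; have [[? ?] ?] := H t dt.
- move=> e C e0 HC; have [om' Com' H] := h7 e C e0 HC.
  by exists om' => // t dt; have [[? ?] ?] := H t dt.
Qed.

End generic.

(** * Measurable near-optimal day plans *)

Lemma measurable_fun_of_gt {d : measure_display} {T : measurableType d} {R : realType}
    (f : T -> \bar R) :
  (forall y : R, measurable [set t | (y%:E < f t)%E]) -> measurable_fun setT f.
Proof.
move=> H; apply: (measurability _ (ErealGenOInfty.measurableE R)) => //.
move=> _ [_ [y ->] <-]; rewrite setTI.
by have := H y; congr measurable; apply/seteqP; split => t /=; rewrite in_itv/= andbT.
Qed.

Section daily_selection.
Context {R : realType} {S : hydro_system R} {disp : measure_display}
  {Omega : measurableType disp} {P : probability Omega R} (X : market S P).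
Variables tpi_s tpi_u tpi_v : nat -> Omega -> R.
Variable d : nat.
Hypothesis hd : is_day S d.

Let G := info_bid X d.
Let T := g_sigma_algebraType (rv_gen G).

Variables wprev wend : Omega -> level S.
Hypothesis mwprev : forall r, measurable_wrt G (fun om => wprev om r ord0).
Hypothesis mwend : forall r, measurable_wrt G (fun om => wend om r ord0).
Hypothesis mtpi_s : forall t, in_day S d t -> measurable_wrt G (tpi_s t).
Hypothesis mtpi_u : forall t, in_day S d t -> measurable_wrt G (tpi_u t).
Hypothesis mtpi_v : forall t, in_day S d t -> measurable_wrt G (tpi_v t).

Let N := (nhours S).+1.
Let A := narcs S.
(** One coordinate per hour for each bid, and per hour and arc for each flow. All hours, including
    [0], have coordinates, so that [inord t] addresses hour [t] without a shift; those outside day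
    [d] stay unconstrained. *)
Let J : finType := ('I_N + 'I_N + 'I_N + ('I_N * 'I_A + 'I_N * 'I_A + 'I_N * 'I_A))%type.

Implicit Types (x : J -> R).

Let xs x t := x (inl (inl (inl (inord t)))).
Let xu x t := x (inl (inl (inr (inord t)))).
Let xv x t := x (inl (inr (inord t))).
Let xg x t : flow S := \col_a x (inr (inl (inl (inord t, a)))).
Let xp x t : flow S := \col_a x (inr (inl (inr (inord t, a)))).
Let xz x t : flow S := \col_a x (inr (inr (inord t, a))).

Let encode (s u v : nat -> R) (g p z : nat -> flow S) : J -> R := fun j =>
  match j with
  | inl (inl (inl t)) => s t
  | inl (inl (inr t)) => u t
  | inl (inr t) => v t
  | inr (inl (inl (t, a))) => g t a ord0
  | inr (inl (inr (t, a))) => p t a ord0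
  | inr (inr (t, a)) => z t a ord0
  end.

Lemma in_day_lt t : in_day S d t -> (t < N)%N.
Proof. by move=> dt; have /andP[] := in_day_hour hd dt. Qed.

Let feas x om := lp_feasible X d (wprev om) (wend om) om
  (xs x) (xu x) (xv x) (xg x) (xp x) (xz x).

Lemma lp_feasible_ext (wp we : level S) om s u v g p z s' u' v' g' p' z' :
  (forall t, in_day S d t -> [/\ s t = s' t, u t = u' t & v t = v' t] /\
     [/\ g t = g' t, p t = p' t & z t = z' t]) ->
  lp_feasible X d wp we om s u v g p z -> lp_feasible X d wp we om s' u' v' g' p' z'.
Proof.
move=> E [Hh Ht].
have lvl t : (t <= last_hour S d)%N ->
    fixed_level X d t wp g' p' z' om = fixed_level X d t wp g p z om.
  move=> tl; apply: level_after_ext => tau /andP[t1 t2]; split => //.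
  have [|_ [-> -> ->]//] := E tau.
  by rewrite /in_day t1 (leq_trans t2).
split; last by rewrite lvl.
move=> t dt; have [[<- <- <-] [<- <- <-]] := E t dt.
by rewrite lvl; [exact: Hh|case/andP: dt].
Qed.

Let encodeE s u v g p z t : in_day S d t -> let x := encode s u v g p z in
  [/\ s t = xs x t, u t = xu x t & v t = xv x t] /\
  [/\ g t = xg x t, p t = xp x t & z t = xz x t].
Proof.
move=> dt x; have tN := in_day_lt dt.
rewrite /xs /xu /xv /xg /xp /xz /= inordK//; split; split => //;
  by apply/matrixP => i j; rewrite !mxE ord1.
Qed.

Let aff (F : (J -> R) -> Omega -> R) := @affine _ T R J F.

Let acst (c : R) : aff (fun _ _ => c).
Proof. exact: affine_cst. Qed.

Let ag t i : aff (fun x _ => xg x t i ord0).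
Proof. by apply: affine_ext (affine_var _) => x om; rewrite mxE. Qed.

Let ap t i : aff (fun x _ => xp x t i ord0).
Proof. by apply: affine_ext (affine_var _) => x om; rewrite mxE. Qed.

Let az t i : aff (fun x _ => xz x t i ord0).
Proof. by apply: affine_ext (affine_var _) => x om; rewrite mxE. Qed.

Let aZ (c : R) (F : (J -> R) -> Omega -> R) : aff F -> aff (fun x om => c * F x om).
Proof. exact: (@affineZ _ T R J (fun=> c) F (measurable_cst c)). Qed.

Let aenergy t : aff (fun x _ => energy t (xg x t) (xp x t)).
Proof.
have H c (F : (J -> R) -> flow S) : (forall i, aff (fun x _ => F x i ord0)) ->
    aff (fun x _ => dotv c (F x)).
  move=> aF; apply: (@affine_ext _ T R J (fun x _ => \sum_i c i ord0 * F x i ord0)).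
    by move=> x om; rewrite dotvE.
  by apply: affine_sum => i; exact: aZ.
by apply: affineB; apply: H.
Qed.

Let alevel t r : (t <= last_hour S d)%N ->
  aff (fun x om => fixed_level X d t (wprev om) (xg x) (xp x) (xz x) om r ord0).
Proof.
(* The guard is true throughout the summation range; it carries along the membership in day [d] by
   which the inflow is known at closing time. *)
move=> tl; apply: (@affine_ext _ T R J (fun x om => wprev om r ord0 +
    \sum_(tau <- index_iota (first_hour S d) t.+1)
      if in_day S d tau then phi X tau r om + \sum_a incidence S r a *
        (xg x tau a ord0 - xp x tau a ord0 + xz x tau a ord0) else 0)).
  move=> x om; rewrite /fixed_level /level_after mxE; congr (_ + _).
  rewrite summxE; apply: eq_big_nat => tau /andP[t1 t2].
  have dt : in_day S d tau by rewrite /in_day t1 (leq_trans _ tl).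
  rewrite dt.
  by rewrite !mxE; congr (_ + _); apply: eq_bigr => a _; rewrite !mxE.
apply: affineD; first exact: affine_cst (mwprev r).
apply: affine_sum => tau; case dt: (in_day S d _); last exact: acst.
apply: affineD.
  apply: affine_cst; apply: measurable_wrt_mem; apply: (spot_info_bid hd dt).
  by right; exists r.
apply: affine_sum => a; apply: aZ.
exact: (@affineD _ T R J _ _ (@affineB _ T R J _ _ (ag tau a) (ap tau a)) (az tau a)).
Qed.

Let poly (C : (J -> R) -> Omega -> Prop) := @polyhedral _ T R J C.

Let poly_lev n (F F' : (J -> R) -> Omega -> 'cV[R]_n) :
  (forall i, aff (fun x om => F x om i ord0)) -> (forall i, aff (fun x om => F' x om i ord0)) ->
  poly (fun x om => lev (F x om) (F' x om)).
Proof.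
move=> aF aF'; apply: (@polyhedral_forall _ T R J _
  (fun i x om => F x om i ord0 <= F' x om i ord0)) => i.
exact: polyhedral_le (aF i) (aF' i).
Qed.

Let poly_feas : poly feas.
Proof.
have pb (t : 'I_N) : poly (fun x om => bounds t (xu x t) (xv x t) (xg x t) (xp x t) (xz x t)).
  apply: (@polyhedral_ext _ T R J (fun x om => (0 <= xu x t) /\ (0 <= xv x t) /\
    lev 0 (xg x t) /\ lev (xg x t) (gmax S t) /\ lev 0 (xp x t) /\
    lev (xp x t) (pmax S t) /\ lev 0 (xz x t))).
    by move=> x om; split => [[? [? [? [? [? [? ?]]]]]]|[? ? [? ?] [? ?] ?]]; do ?split.
  do 2 (apply: polyhedral_and; first by apply: polyhedral_le; [exact: acst|exact: affine_var]).
  do 4 (apply: polyhedral_and; first by apply: poly_lev).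
  by apply: poly_lev.
have plb (t : 'I_N) : in_day S d t -> poly (fun x om =>
    level_bounds t (fixed_level X d t (wprev om) (xg x) (xp x) (xz x) om)).
  move=> dt; have tl : (t <= last_hour S d)%N by case/andP: dt.
  apply: polyhedral_and.
    by apply: poly_lev => // i; exact: alevel.
  apply: polyhedral_forall => i.
  (* An infinite upper bound imposes nothing, and nonnegativity excludes [-oo]. *)
  have := whi_ge0 (in_day_hour hd dt) i.
  case: (whi S t i ord0) => [b _| _|]; last by rewrite leeNy_eq.
    apply: (@polyhedral_ext _ T R J (fun x om =>
      fixed_level X d t (wprev om) (xg x) (xp x) (xz x) om i ord0 <= b)).
      by move=> x om; rewrite lee_fin.
    exact: polyhedral_le (alevel i tl) (acst b).
  apply: (@polyhedral_ext _ T R J (fun _ _ => True)); last exact: polyhedral_true.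
  by move=> x om; rewrite leey.
apply: (@polyhedral_ext _ T R J (fun x om => (forall t : 'I_N, in_day S d t ->
    bounds t (xu x t) (xv x t) (xg x t) (xp x t) (xz x t) /\
    xs x t + rhobar_u X t * xu x t = energy t (xg x t) (xp x t) /\
    - dotv (zeta S t) (pmax S t) <= xs x t - rhobar_v X t * xv x t /\
    level_bounds t (fixed_level X d t (wprev om) (xg x) (xp x) (xz x) om)) /\
    lev (wend om) (fixed_level X d (last_hour S d) (wprev om) (xg x) (xp x) (xz x) om))).
  move=> x om; split => [[H1 H2]|[H1 H2]]; split => //.
    move=> t dt; have [? [? [? ?]]] := H1 (Ordinal (in_day_lt dt)) dt.
    by split.
  by move=> t dt; have [? ? ? ?] := H1 t dt.
apply: polyhedral_and.
  apply: polyhedral_forall => t; apply: polyhedral_imply => dt.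
  apply: polyhedral_and; first exact: pb.
  apply: polyhedral_and.
    apply: (@polyhedral_eq _ T R J _ _ _ (aenergy t)).
    exact: (@affineD _ T R J (fun x _ => xs x t) _ (affine_var _)
      (@aZ (rhobar_u X t) (fun x _ => xu x t) (affine_var _))).
  apply: polyhedral_and; last exact: plb.
  apply: (polyhedral_le (acst _)).
  exact: (@affineB _ T R J (fun x _ => xs x t) _ (affine_var _)
    (@aZ (rhobar_v X t) (fun x _ => xv x t) (affine_var _))).
apply: poly_lev => i; last exact: alevel.
by apply: affine_cst; exact: mwend.
Qed.

(** A threshold on the objective is one more linear constraint. Constant thresholds give the
    measurability of the value, and the threshold [V - e] gives near-optimal points. *)
Let feas_ge (c : Omega -> R) x om := feas x om /\
  c om <= lp_objective (S := S) tpi_s tpi_u tpi_v d om (xs x) (xu x) (xv x).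

Let poly_feas_ge c : measurable_wrt G c -> poly (feas_ge c).
Proof.
move=> mc; apply: polyhedral_and; first exact: poly_feas.
apply: polyhedral_le; first exact: affine_cst.
apply: (@affine_ext _ T R J (fun x om =>
   \sum_(t <- index_iota (first_hour S d) (last_hour S d).+1)
   if in_day S d t then tpi_s t om * xs x t + tpi_u t om * xu x t + tpi_v t om * xv x t
   else 0)).
  move=> x om; apply: eq_big_nat => t /andP[t1 t2].
  by rewrite ifT// /in_day t1 -ltnS.
apply: affine_sum => t; case dt: (in_day S d _); last exact: acst.
apply: affineD; first apply: affineD.
- by apply: affineZ; [exact: mtpi_s|exact: affine_var].
- by apply: affineZ; [exact: mtpi_u|exact: affine_var].
- by apply: affineZ; [exact: mtpi_v|exact: affine_var].
Qed.

Let V om := lp_value X tpi_s tpi_u tpi_v d (wprev om) (wend om) om.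

Let feasible_encode om s u v g p z :
  lp_feasible X d (wprev om) (wend om) om s u v g p z ->
  feas (encode s u v g p z) om /\
  lp_objective (S := S) tpi_s tpi_u tpi_v d om s u v =
  lp_objective (S := S) tpi_s tpi_u tpi_v d om (xs (encode s u v g p z))
    (xu (encode s u v g p z)) (xv (encode s u v g p z)).
Proof.
move=> H; split; first by apply: lp_feasible_ext H => t dt; exact: encodeE.
apply: eq_big_nat => t; rewrite ltnS => dt.
by have [[-> -> ->] _] := @encodeE s u v g p z t dt.
Qed.

(** The strict inequality [y < V om] is a countable union of the weak thresholds [y + 1 / (n + 1)],
    each the projection of a polyhedron. *)
Lemma measurable_lp_value : measurable_fun [set: T] (V : T -> \bar R).
Proof.
apply: measurable_fun_of_gt => y.
rewrite (_ : mkset _ = \bigcup_n [set om | exists x, feas_ge (fun=> y + n.+1%:R^-1) x om]).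
  apply: bigcup_measurable => n _.
  have my := @measurable_wrt_cst _ _ _ G (y + n.+1%:R^-1).
  by have [] := polyhedral_selection (poly_feas_ge my).
apply/seteqP; split => om /=.
  move=> /ereal_sup_gt[_ [s [u [v [g [p [z [lpf ->]]]]]]]]; rewrite lte_fin => lt.
  pose n := Num.trunc (lp_objective (S := S) tpi_s tpi_u tpi_v d om s u v - y)^-1.
  exists n => //; have [fe oe] := feasible_encode lpf.
  exists (encode s u v g p z); split => //; rewrite -oe.
  have gap : 0 < lp_objective (S := S) tpi_s tpi_u tpi_v d om s u v - y by rewrite subr_gt0.
  have : n.+1%:R^-1 <= lp_objective (S := S) tpi_s tpi_u tpi_v d om s u v - y.
    by rewrite invf_ple ?posrE// ltW// truncnS_gt.
  by rewrite lerBrDl.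
move=> [n _ [x [fx ox]]].
apply: (@lt_le_trans _ _ (y + n.+1%:R^-1)%:E).
  by rewrite lte_fin ltrDl invr_gt0.
apply: (@le_trans _ _ (lp_objective (S := S) tpi_s tpi_u tpi_v d om (xs x) (xu x) (xv x))%:E).
  by rewrite lee_fin.
by apply: ereal_sup_ubound; exists (xs x), (xu x), (xv x), (xg x), (xp x), (xz x).
Qed.

(** Outcomes in which no point reaches the threshold receive the zero plan: it respects the signs
    and capacities, so these bounds hold for every outcome and not merely almost surely. *)
Lemma lp_selection (e : R) : 0 < e ->
  exists (s u v : nat -> Omega -> R) (g p z : nat -> Omega -> flow S),
  [/\ forall t, [/\ measurable_wrt G (s t), measurable_wrt G (u t) & measurable_wrt G (v t)],
      forall t i, [/\ measurable_wrt G (fun om => g t om i ord0),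
        measurable_wrt G (fun om => p t om i ord0) &
        measurable_wrt G (fun om => z t om i ord0)],
      forall om, lp_feasible X d (wprev om) (wend om) om
          (s ^~ om) (u ^~ om) (v ^~ om) (g ^~ om) (p ^~ om) (z ^~ om) \/
        (forall t, [/\ s t om = 0, u t om = 0 & v t om = 0] /\
           [/\ g t om = 0, p t om = 0 & z t om = 0]) &
      forall om, V om \is a fin_num ->
        lp_feasible X d (wprev om) (wend om) om
          (s ^~ om) (u ^~ om) (v ^~ om) (g ^~ om) (p ^~ om) (z ^~ om) /\
        fine (V om) - e <= lp_objective (S := S) tpi_s tpi_u tpi_v d om
          (s ^~ om) (u ^~ om) (v ^~ om)].
Proof.
move=> e0.
have mc : measurable_wrt G (fun om => fine (V om) - e).
  apply: measurable_funB; last exact: measurable_cst.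
  apply: (measurableT_comp (fine_measurable measurableT)).
  exact: measurable_lp_value.
have [mF [f mf fP]] := polyhedral_selection (poly_feas_ge mc).
set F := (X in measurable X) in mF.
pose f' j om := if `[< F om >] then f j om else 0.
have mf' j : measurable_wrt G (f' j).
  apply: measurable_fun_ifT; [|exact: mf|exact: measurable_cst].
  apply: (measurable_fun_bool true); rewrite setTI (_ : _ @^-1` _ = F)//.
  by apply/seteqP; split => om /=; [move/asboolP|move=> Fom; apply/asboolP].
have f'F om : F om -> f' ^~ om = f ^~ om.
  by move=> Fom; apply/funext => j; rewrite /f' asboolT.
have f'0 om j : ~ F om -> f' j om = 0 by move=> nF; rewrite /f' asboolF.
have f'P om : F om -> feas_ge (fun om => fine (V om) - e) (f' ^~ om) om.
  by move=> Fom; rewrite f'F//; exact: fP.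
exists (fun t om => xs (f' ^~ om) t), (fun t om => xu (f' ^~ om) t),
  (fun t om => xv (f' ^~ om) t), (fun t om => xg (f' ^~ om) t),
  (fun t om => xp (f' ^~ om) t), (fun t om => xz (f' ^~ om) t); split.
- by move=> t; split; exact: mf'.
- have mcol j (g : Omega -> R) : (forall om, f' j om = g om) -> measurable_wrt G g.
    by move=> /funext <-; exact: mf'.
  by move=> t i; split; [apply: (mcol (inr (inl (inl (inord t, i)))))
    |apply: (mcol (inr (inl (inr (inord t, i)))))|apply: (mcol (inr (inr (inord t, i))))]
    => om; rewrite mxE.
- move=> om; have [Fom|nF] := pselect (F om); [left|right].
    by have [] := f'P om Fom.
  move=> t; split; split; rewrite /xs /xu /xv /xg /xp /xz ?f'0//;
    by apply/matrixP => i j; rewrite !mxE f'0.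
- move=> om Vfin; suff Fom : F om by have [] := f'P om Fom.
  have /ereal_sup_gt : (V om - e%:E < V om)%E.
    by rewrite -(fineK Vfin) -EFinB lte_fin ltrBlDr ltrDl.
  move=> [_ [s [u [v [g [p [z [lpf ->]]]]]]]] lt.
  have [fe oe] := feasible_encode lpf; exists (encode s u v g p z); split => //.
  by rewrite -oe; move: lt; rewrite -(fineK Vfin) -EFinB lte_fin => /ltW.
Qed.

End daily_selection.

(** * Potential and routing on the network *)

Section network.
Context {R : realType} (S : hydro_system R).

(** The number of reachable reservoirs decreases along an arc: whatever the target reaches the
    source reaches too, and by acyclicity the target does not reach the source. *)
Lemma network_potential : exists h : 'I_(nupper S).+1 -> nat,
  forall a : 'I_(narcs S), (h (arc_tgt a) < h (arc_src a))%N.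
Proof.
pose e : rel 'I_(nupper S).+1 :=
  fun r r' => [exists a : 'I_(narcs S), (arc_src a == r) && (arc_tgt a == r')].
have ea a : e (arc_src a) (arc_tgt a) by apply/existsP; exists a; rewrite !eqxx.
exists (fun r => #|[pred x | connect e r x]|) => a; apply: proper_card.
apply/fintype.properP; split.
  apply/fintype.subsetP => x; rewrite !inE; apply: connect_trans; exact: connect1.
exists (arc_src a); rewrite !inE ?connect0//; apply/negP => /connectP[p ep lp].
have : cycle e (arc_tgt a :: p) by rewrite /= rcons_path ep -lp ea.
by move=> /(@acyclic R S).
Qed.

Lemma arc_loopless (a : 'I_(narcs S)) : arc_src a != arc_tgt a.
Proof.
have [h hP] := network_potential; apply/eqP => E.
by have := hP a; rewrite E ltnn.
Qed.

Lemma incidenceE r a :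
  incidence S r a = (r == arc_tgt a)%:R - (r == arc_src a)%:R.
Proof.
rewrite mxE !(eq_sym r); have := arc_loopless a.
case: (arc_src a =P r) => [<- /negbTE|_ _].
  by rewrite eq_sym => ->; rewrite sub0r.
by case: (_ == r); rewrite subr0.
Qed.

(** Summation by parts on the graph. *)
Lemma weighted_incidence (f : 'I_(nupper S).+1 -> R) (y : flow S) :
  \sum_r f r * (incidence S *m y) r ord0 =
  \sum_a (f (arc_tgt a) - f (arc_src a)) * y a ord0.
Proof.
under eq_bigr do rewrite mxE mulr_sumr.
rewrite exchange_big /=; apply: eq_bigr => a _.
have pick r0 : \sum_r f r * (r == r0)%:R = f r0.
  rewrite (bigD1 r0)//= eqxx mulr1 big1 ?addr0// => r /negbTE ->.
  by rewrite mulr0.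
rewrite -[in RHS]pick -[X in _ - X]pick -sumrB mulr_suml.
by apply: eq_bigr => r _; rewrite incidenceE; ring.
Qed.

(* Column [r] of [Y] routes one unit of water from [r] to the sink. *)
Lemma flush_matrix : exists Y : 'M[R]_(narcs S, (nupper S).+1),
  (forall a r, 0 <= Y a r) /\
  incidence S *m Y = \matrix_(r, r') ((r == ord_max)%:R - (r == r')%:R).
Proof.
have [h hP] := network_potential.
have route n : forall r, (h r < n)%N -> exists y : flow S, (forall a, 0 <= y a ord0) /\
    incidence S *m y = \col_r' ((r' == ord_max)%:R - (r' == r)%:R).
  (* Induction on the potential: send the unit along some arc leaving [r] and route it on from the
     target of that arc. *)
  elim: n => // n IH r; rewrite ltnS => hr.
  have [->|rs] := eqVneq r ord_max.
    exists 0; split => [a|]; first by rewrite mxE.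
    by rewrite mulmx0; apply/matrixP => i j; rewrite !mxE subrr.
  have [a ar] := nonsink_out rs.
  have [|y [y0 My]] := IH (arc_tgt a).
    by apply: leq_trans hr; rewrite -ar.
  exists (delta_mx a ord0 + y); split => [b|].
    by rewrite !mxE addr_ge0// ler0n.
  rewrite mulmxDr My -colE; apply/matrixP => i j.
  by rewrite [LHS]mxE [col a _ i j]mxE incidenceE !mxE ar; ring.
have /choice[f fP] r : exists y : flow S, (forall a, 0 <= y a ord0) /\
    incidence S *m y = \col_r' ((r' == ord_max)%:R - (r' == r)%:R).
  exact: (route (h r).+1).
exists (\matrix_(a, r) f r a ord0); split => [a r|]; first by rewrite mxE; have [] := fP r.
apply/matrixP => r r'; have [_ /matrixP/(_ r ord0)] := fP r'; rewrite !mxE => <-.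
by apply: eq_bigr => a _; rewrite !mxE.
Qed.

End network.

(** * A priori bounds on bids and spills *)

Section feasible_bounds.
Context {R : realType} {S : hydro_system R} {disp : measure_display}
  {Omega : measurableType disp} {P : probability Omega R} (X : market S P).
Hypothesis hX : market_assumptions X.

(** The width of the interval from [-zeta^T pmax] to [eta^T gmax], in which the energy of the hour
    always lies. *)
Definition energy_range t : R := dotv (eta S t) (gmax S t) + dotv (zeta S t) (pmax S t).

Lemma dotv_ge0 n (x y : 'cV[R]_n) : lev 0 x -> lev 0 y -> 0 <= dotv x y.
Proof.
move=> x0 y0; rewrite dotvE; apply: sumr_ge0 => i _.
by have := x0 i; have := y0 i; rewrite mxE => *; exact: mulr_ge0.
Qed.

Lemma dotv_le n (x y y' : 'cV[R]_n) : lev 0 x -> lev y y' -> dotv x y <= dotv x y'.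
Proof.
move=> x0 yy; rewrite !dotvE; apply: ler_sum => i _; apply: ler_wpM2l => //.
by have := x0 i; rewrite mxE.
Qed.

Lemma bids_bounds t (s u v : R) (g p z : flow S) : is_hour S t ->
  bounds t u v g p z -> s + rhobar_u X t * u = energy t g p ->
  s - rhobar_v X t * v >= - dotv (zeta S t) (pmax S t) ->
  [/\ `|s| <= energy_range t, `|u| <= energy_range t / rhobar_u X t &
      `|v| <= energy_range t / rhobar_v X t].
Proof.
move=> ht [u0 v0 [g0 gm] [p0 pm] z0] su sv.
have [/andP[a0 a1] /andP[b0 b1]] := rhobar_bounds hX ht.
have e0 := eta_ge0 ht; have z0' := zeta_ge0 ht.
have G0 := dotv_ge0 e0 (gmax_ge0 ht); have P0 := dotv_ge0 z0' (pmax_ge0 ht).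
have := dotv_le e0 gm; have := dotv_ge0 z0' p0.
move: su; rewrite /energy /energy_range => su p1 g1.
have ru : 0 <= rhobar_u X t * u by rewrite mulr_ge0// ltW.
have rv : 0 <= rhobar_v X t * v by rewrite mulr_ge0// ltW.
split; first by rewrite ler_norml; apply/andP; split; lra.
- by rewrite ger0_norm// ler_pdivlMr// mulrC; lra.
- by rewrite ger0_norm// ler_pdivlMr// mulrC; lra.
Qed.

(** Levels weighted by the potential [h] act as stored energy. Each spilled unit costs at least one,
    generation costs as well, and only pumping and inflow add to it; since the levels stay
    nonnegative, the total spill is bounded by the initial energy and these additions. *)
Lemma spill_bound (h : 'I_(nupper S).+1 -> nat) d (wp we : level S) om s u v g p z t a :
  (forall a : 'I_(narcs S), (h (arc_tgt a) < h (arc_src a))%N) -> is_day S d ->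
  lp_feasible X d wp we om s u v g p z -> in_day S d t ->
  0 <= z t a ord0 <= \sum_r (h r)%:R * wp r ord0 +
    \sum_(first_hour S d <= tau < t.+1)
      (\sum_r (h r)%:R * phi X tau r om +
       (\sum_r (h r)%:R) * \sum_b pmax S tau b ord0).
Proof.
move=> hP hd [Hh _] dt; have [[_ _ _ _ z0] _ _ [lb _]] := Hh t dt.
have ht := in_day_hour hd dt.
apply/andP; split; first by have := z0 a; rewrite mxE.
set L := fixed_level _ _ _ _ _ _ _ _ in lb.
have day tau : (first_hour S d <= tau < t.+1)%N -> in_day S d tau.
  move=> /andP[t1 t2]; rewrite /in_day t1 (leq_trans _ (_ : t <= _)%N)//.
  by case/andP: dt.
have L0 : 0 <= \sum_r (h r)%:R * L r ord0.
  apply: sumr_ge0 => r _; apply: mulr_ge0 => //.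
  have := wlo_ge0 ht r; rewrite mxE => w0; exact: le_trans w0 (lb r).
pose net tau := g tau - p tau + z tau.
have LE : \sum_r (h r)%:R * L r ord0 = \sum_r (h r)%:R * wp r ord0 +
    \sum_(first_hour S d <= tau < t.+1) (\sum_r (h r)%:R * phi X tau r om +
      \sum_b ((h (arc_tgt b))%:R - (h (arc_src b))%:R) * net tau b ord0).
  transitivity (\sum_r ((h r)%:R * wp r ord0 + \sum_(first_hour S d <= tau < t.+1)
      ((h r)%:R * phi X tau r om + (h r)%:R * (incidence S *m net tau) r ord0))).
    apply: eq_bigr => r _; rewrite /L /fixed_level /level_after mxE mulrDr; congr (_ + _).
    rewrite summxE mulr_sumr; apply: eq_bigr => tau _.
    by rewrite mxE mulrDr; congr (_ + _); rewrite mxE.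
  rewrite big_split /= exchange_big /=; congr (_ + _); apply: eq_bigr => tau _.
  by rewrite big_split /= (weighted_incidence (fun r => (h r)%:R)).
have H0 b : (h (arc_src b))%:R <= \sum_r (h r)%:R :> R.
  by rewrite (bigD1 (arc_src b))//= lerDl sumr_ge0.
have step tau : (first_hour S d <= tau < t.+1)%N ->
    \sum_b ((h (arc_tgt b))%:R - (h (arc_src b))%:R) * net tau b ord0 <=
    (\sum_r (h r)%:R) * (\sum_b pmax S tau b ord0) - \sum_b z tau b ord0.
  move=> /day dtau; have [[_ _ [g0 _] [p0 pm] z0'] _ _ _] := Hh tau dtau.
  rewrite mulr_sumr -sumrB; apply: ler_sum => b _; rewrite !mxE.
  have := g0 b; have := p0 b; have := pm b; have := z0' b; rewrite !mxE => zb pb1 pb0 gb.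
  have k1 : (h (arc_tgt b))%:R + 1 <= (h (arc_src b))%:R :> R.
    by rewrite natr1 ler_nat; exact: hP.
  have k0 : 0 <= (h (arc_tgt b))%:R :> R by [].
  have := H0 b; move: k1 k0; set x := (h (arc_tgt b))%:R; set y := (h (arc_src b))%:R.
  by set Hs := \sum_r _ => k1 k0 yH; nra.
have zt : z t a ord0 <= \sum_(first_hour S d <= tau < t.+1) \sum_b z tau b ord0.
  rewrite big_nat_recr/=; last by case/andP: dt.
  apply: (@le_trans _ _ (\sum_b z t b ord0)).
    rewrite (bigD1 a)//= lerDl; apply: sumr_ge0 => b _.
    by have := z0 b; rewrite mxE.
  rewrite lerDr big_nat; apply: sumr_ge0 => tau /andP[t1 t2].
  have dtau : in_day S d tau by apply: day; rewrite t1 ltnS ltnW.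
  have [[_ _ _ _ z0'] _ _ _] := Hh tau dtau.
  by apply: sumr_ge0 => b _; have := z0' b; rewrite mxE.
have tot : \sum_(first_hour S d <= tau < t.+1) (\sum_r (h r)%:R * phi X tau r om +
      \sum_b ((h (arc_tgt b))%:R - (h (arc_src b))%:R) * net tau b ord0) <=
    \sum_(first_hour S d <= tau < t.+1) (\sum_r (h r)%:R * phi X tau r om +
       (\sum_r (h r)%:R) * \sum_b pmax S tau b ord0) -
    \sum_(first_hour S d <= tau < t.+1) \sum_b z tau b ord0.
  rewrite -sumrB big_nat [leRHS]big_nat; apply: ler_sum => tau /step.
  by rewrite -addrA lerD2l.
by move: L0; rewrite LE; lra.
Qed.

End feasible_bounds.

(** * Closure properties of integrable functions *)

Section integrable_closure.
Context {R : realType} {disp : measure_display} {Omega : measurableType disp}.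
Variable mu : probability Omega R.
Implicit Types (G : set (Omega -> R)) (f g s : Omega -> R).

Lemma integrable_bounded_mul f s (M : R) : mu.-integrable setT (EFin \o f) ->
  measurable_fun setT s -> {ae mu, forall om, `|s om| <= M} ->
  mu.-integrable setT (EFin \o (fun om => f om * s om)).
Proof.
move=> fi ms sM; have mf : measurable_fun setT f by exact/measurable_EFinP/(measurable_int _ fi).
apply: (@ae_le_integrable _ _ _ _ _ (fun om => M * f om)).
- exact: measurable_funM.
- by have := integrableZl measurableT M fi; apply: eq_integrable.
- apply: filterS sM => om sM; rewrite !normrM mulrC ler_wpM2r//.
  by rewrite (le_trans sM)// ler_norm.
Qed.

Lemma inL_mono G G' f : G `<=` G' -> inL mu G f -> inL mu G' f.
Proof. by move=> GG' [mf fi]; split => //; exact: measurable_mono mf. Qed.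

Lemma inLv_mono G G' n (f : Omega -> 'cV[R]_n) : G `<=` G' -> inLv mu G f -> inLv mu G' f.
Proof. by move=> GG' H i; exact: inL_mono (H i). Qed.

Lemma inL_cst G (c : R) : inL mu G (fun=> c).
Proof.
split; first exact: measurable_wrt_cst.
exact: finite_measure_integrable_cst.
Qed.

Lemma inLD G f g : inL mu G f -> inL mu G g -> inL mu G (fun om => f om + g om).
Proof.
move=> [mf fi] [mg gi]; split; first exact: measurable_funD.
by have := integrableD measurableT fi gi; apply: eq_integrable.
Qed.

Lemma inLZ G f (c : R) : inL mu G f -> inL mu G (fun om => c * f om).
Proof.
move=> [mf fi]; split.
  by apply: measurable_funM => //; exact: measurable_wrt_cst.
by have := integrableZl measurableT c fi; apply: eq_integrable.
Qed.

Lemma inLN G f : inL mu G f -> inL mu G (fun om => - f om).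
Proof.
move=> /(@inLZ _ _ (-1)); rewrite (_ : (fun _ => _) = fun om => - f om)//.
by apply/funext => om; rewrite mulN1r.
Qed.

Lemma inLB G f g : inL mu G f -> inL mu G g -> inL mu G (fun om => f om - g om).
Proof. by move=> fL /inLN; exact: inLD. Qed.

Lemma inL_sum G (I : Type) (r : seq I) (f : I -> Omega -> R) :
  (forall i, inL mu G (f i)) -> inL mu G (fun om => \sum_(i <- r) f i om).
Proof.
move=> fL; elim: r => [|i r IH].
  by rewrite (_ : (fun _ => _) = fun=> 0); [exact: inL_cst|apply/funext => om; rewrite big_nil].
rewrite (_ : (fun _ => _) = fun om => f i om + \sum_(j <- r) f j om); first exact: inLD.
by apply/funext => om; rewrite big_cons.
Qed.

Lemma eq_inLv G n (f g : Omega -> 'cV[R]_n) : (forall om i, f om i ord0 = g om i ord0) ->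
  inLv mu G f -> inLv mu G g.
Proof.
by move=> E H i; have := H i; congr (inL _ _ _); apply/funext => om.
Qed.

Lemma inLvD G n (f g : Omega -> 'cV[R]_n) : inLv mu G f -> inLv mu G g ->
  inLv mu G (fun om => f om + g om).
Proof.
move=> fL gL i; rewrite (_ : (fun _ => _) = fun om => f om i ord0 + g om i ord0).
  exact: inLD.
by apply/funext => om; rewrite mxE.
Qed.

Lemma inLvB G n (f g : Omega -> 'cV[R]_n) : inLv mu G f -> inLv mu G g ->
  inLv mu G (fun om => f om - g om).
Proof.
move=> fL gL i; rewrite (_ : (fun _ => _) = fun om => f om i ord0 - g om i ord0).
  exact: inLB.
by apply/funext => om; rewrite !mxE.
Qed.

Lemma inLv_mulmx G m n (M : 'M[R]_(m, n)) (f : Omega -> 'cV[R]_n) : inLv mu G f ->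
  inLv mu G (fun om => M *m f om).
Proof.
move=> fL i; rewrite (_ : (fun _ => _) = fun om => \sum_j M i j * f om j ord0).
  by apply: inL_sum => j; exact: inLZ.
by apply/funext => om; rewrite mxE.
Qed.

Lemma inLv_cst G n (c : 'cV[R]_n) : inLv mu G (fun=> c).
Proof. by move=> i; exact: inL_cst. Qed.

Lemma inLv_sum_nat G n (m k : nat) (f : nat -> Omega -> 'cV[R]_n) :
  (forall i, (m <= i < k)%N -> inLv mu G (f i)) ->
  inLv mu G (fun om => \sum_(m <= i < k) f i om).
Proof.
move=> fL j; rewrite (_ : (fun _ => _) = fun om => \sum_(i <- index_iota m k)
    if (m <= i < k)%N then f i om j ord0 else 0).
  apply: inL_sum => i; case E : (m <= i < k)%N; [exact: fL|exact: inL_cst].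
by apply/funext => om; rewrite summxE; apply: eq_big_nat => i ->.
Qed.

Lemma ae_le_integral (f g : Omega -> \bar R) :
  mu.-integrable setT f -> mu.-integrable setT g ->
  {ae mu, forall om, (f om <= g om)%E} ->
  (\int[mu]_om f om <= \int[mu]_om g om)%E.
Proof.
move=> fi gi fg; rewrite -sube_ge0; last by apply/orP; left; exact: integrable_fin_num.
rewrite -integralB//; rewrite (integral_ae_ext (g := fun om => maxe (g om - f om) 0)%E).
  by apply: integral_ge0 => om _; rewrite le_max lexx orbT.
have ff := integrable_ae measurableT fi.
apply: filterS2 fg ff => om le /(_ I) fin; rewrite max_l// sube_ge0// fin//.
Qed.

Lemma integrable_of_ae_bounded (f : Omega -> \bar R) (B : Omega -> R) :
  measurable_fun setT f -> mu.-integrable setT (EFin \o B) ->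
  {ae mu, forall om, (`|f om| <= (B om)%:E)%E} -> mu.-integrable setT f.
Proof.
move=> mf /integrableP[mB Bi] fB; apply/integrableP; split => //.
apply: le_lt_trans Bi; apply: ae_ge0_le_integral => //.
- exact: measurableT_comp.
- exact: measurableT_comp.
- apply: filterS fB => om le _; apply: le_trans le _; rewrite /= lee_fin; exact: ler_norm.
Qed.

(** The upper bound makes the integral of the positive part finite; an infinite negative part would
    then force the integral to be [-oo]. *)
Lemma integrable_of_integral_gtNy (f : Omega -> \bar R) (B : Omega -> R) :
  measurable_fun setT f -> mu.-integrable setT (EFin \o B) ->
  (forall om, (f om <= (B om)%:E)%E) -> (\int[mu]_om f om != -oo)%E ->
  mu.-integrable setT f.
Proof.
move=> mf Bi fB fN.
have fpos : (\int[mu]_om f^\+ om < +oo)%E.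
  have /integrableP[mB] := Bi; apply: le_lt_trans; apply: ge0_le_integral => //.
  - exact: measurable_funepos.
  - exact: measurableT_comp.
  - move=> om _; rewrite funeposE ge_max abse_ge0 andbT (le_trans (fB om))//=.
    by rewrite lee_fin ler_norm.
have fneg : (\int[mu]_om f^\- om < +oo)%E.
  rewrite ltey; apply: contra fN => /eqP E; rewrite integralE E.
  by move: fpos; case: (integral _ _ _).
apply/integrableP; split => //.
under eq_integral do rewrite -/((abse \o f) _) fune_abse.
rewrite ge0_integralD//; first exact: lte_add_pinfty.
- exact: measurable_funepos.
- exact: measurable_funeneg.
Qed.

End integrable_closure.

Section near_optimal_plans.
Context {R : realType} {S : hydro_system R} {disp : measure_display}
  {Omega : measurableType disp} {P : probability Omega R} (X : market S P).
Variables tpi_s tpi_u tpi_v : nat -> Omega -> R.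
Hypothesis hX : market_assumptions X.
Hypothesis htpi : forall d t, is_day S d -> in_day S d t ->
    [/\ is_cond_exp P (info_bid X d) (pi_s X t) (tpi_s t),
        is_cond_exp P (info_bid X d) (rev_u X t) (tpi_u t) &
        is_cond_exp P (info_bid X d) (rev_v X t) (tpi_v t)].
Variable w : nat -> Omega -> level S.
Hypothesis hw : reduced_planner_feasible X w.

(** An integrable bound on the objective that is uniform in the levels and in the feasible points,
    obtained from [bids_bounds]. *)
Definition objective_bound d (om : Omega) : R :=
  \sum_(first_hour S d <= t < (last_hour S d).+1) energy_range (S := S) t *
    (`|tpi_s t om| + `|tpi_u t om| / rhobar_u X t + `|tpi_v t om| / rhobar_v X t).

Definition plan_value d om : \bar R :=
  lp_value X tpi_s tpi_u tpi_v d (w d.-1 om) (w d om) om.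

Lemma objective_le_bound d om wp we s u v g p z : is_day S d ->
  lp_feasible X d wp we om s u v g p z ->
  `|lp_objective (S := S) tpi_s tpi_u tpi_v d om s u v| <= objective_bound d om.
Proof.
move=> hd [Hh _]; apply: le_trans (ler_norm_sum _ _ _) _.
rewrite big_nat [leRHS]big_nat; apply: ler_sum => t; rewrite ltnS => dt.
have [bd su sv _] := Hh t dt; have ht := in_day_hour hd dt.
have [sb ub vb] := bids_bounds hX ht bd su sv.
have mul_le (a b E r : R) : `|b| <= E / r -> `|a * b| <= E * (`|a| / r).
  by move=> bE; rewrite normrM [leRHS]mulrCA ler_wpM2l.
rewrite (le_trans (ler_normD _ _))// mulrDr mulrDr; apply: lerD; last exact: mul_le.
rewrite (le_trans (ler_normD _ _))//; apply: lerD; last exact: mul_le.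
by rewrite normrM mulrC ler_wpM2r.
Qed.

Lemma integrable_objective_bound d : is_day S d ->
  P.-integrable setT (EFin \o objective_bound d).
Proof.
move=> hd.
have iN (Y : Omega -> R) : inL P (info_bid X d) Y -> inL P (info_bid X d) (fun om => `|Y om|).
  move=> [mY iY]; split; last exact: integrable_norm.
  by apply: measurableT_comp.
suff [] : inL P (info_bid X d) (objective_bound d) by [].
rewrite (_ : objective_bound d = fun om =>
    \sum_(t <- index_iota (first_hour S d) (last_hour S d).+1)
    if in_day S d t then energy_range (S := S) t *
    (`|tpi_s t om| + (rhobar_u X t)^-1 * `|tpi_u t om| + (rhobar_v X t)^-1 * `|tpi_v t om|) else 0).
  apply: inL_sum => t; case dt : (in_day S d t); last exact: inL_cst.
  have [[? _] [? _] [? _]] := htpi hd dt.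
  by apply: inLZ; apply: inLD; [apply: inLD; [|apply: inLZ]|apply: inLZ]; exact: iN.
apply/funext => om; apply: eq_big_nat => t; rewrite ltnS => dt.
by rewrite /in_day dt ![_^-1 * _]mulrC.
Qed.

Lemma level_inLv d : is_day S d ->
  inLv P (info_bid X d) (w d) /\ inLv P (info_bid X d) (w d.-1).
Proof.
move=> hd; split; first exact: (CPr_levels hw).
case: d hd => [|[|d]] //= hd.
  apply: (@eq_inLv _ _ _ _ _ _ (fun=> w0 S)) => [om i|]; last exact: inLv_cst.
  by rewrite (CPr_init hw).
have hd' : is_day S d.+1 by case/andP: hd => _ /ltnW.
by apply: inLv_mono (CPr_levels hw hd'); apply: info_bid_mono.
Qed.

Lemma measurable_plan_value d : is_day S d ->
  measurable_fun [set: g_sigma_algebraType (rv_gen (info_bid X d))]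
    (plan_value d : g_sigma_algebraType (rv_gen (info_bid X d)) -> \bar R).
Proof.
move=> hd; have [iw iw'] := level_inLv hd.
apply: (@measurable_lp_value _ _ _ _ _ X tpi_s tpi_u tpi_v d hd (w d.-1) (w d)) =>
  [r|r|t dt|t dt|t dt].
- by have [] := iw' r.
- by have [] := iw r.
- by have [[[]]] := htpi hd dt.
- by have [_ [[]]] := htpi hd dt.
- by have [_ _ [[]]] := htpi hd dt.
Qed.

Lemma plan_value_le_bound d om : is_day S d ->
  (plan_value d om <= (objective_bound d om)%:E)%E.
Proof.
move=> hd; apply: ge_ereal_sup => _ [s [u [v [g [p [z [lpf ->]]]]]]].
by rewrite lee_fin (le_trans (ler_norm _))//; exact: objective_le_bound lpf.
Qed.

Lemma integrable_plan_value d : is_day S d ->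
  (\int[P]_om plan_value d om != -oo)%E -> P.-integrable setT (plan_value d).
Proof.
move=> hd; apply: integrable_of_integral_gtNy.
- exact: (measurable_sub (@measurable_info _ _ _ _ _ X _ _) (measurable_plan_value hd)).
- exact: integrable_objective_bound hd.
- by move=> om; exact: plan_value_le_bound.
Qed.

Lemma inL_dominated G (f g : Omega -> R) : all_measurable G -> measurable_wrt G f ->
  P.-integrable setT (EFin \o g) -> (forall om, `|f om| <= `|g om|) -> inL P G f.
Proof.
move=> mG mf gi fg; split => //; apply: ae_le_integrable gi _; last exact/aeW.
exact: measurable_sub mf.
Qed.

(** A nominal plan fixed entirely at closing time, before activations are known; its flows are
    adapted to the activations only when the bidding model is served. *)
Record day_plan d (s u v : nat -> Omega -> R) (g p z : nat -> Omega -> flow S) : Prop :=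
  DayPlan {
  plan_bids : forall t, in_day S d t ->
    [/\ inL P (info_bid X d) (s t), inL P (info_bid X d) (u t) &
        inL P (info_bid X d) (v t)];
  plan_flows : forall t, in_day S d t ->
    [/\ inLv P (info_bid X d) (g t), inLv P (info_bid X d) (p t) &
        inLv P (info_bid X d) (z t)];
  plan_bounds : forall t om, in_day S d t ->
    [/\ bounds t (u t om) (v t om) (g t om) (p t om) (z t om),
        `|s t om| <= energy_range (S := S) t,
        `|u t om| <= energy_range (S := S) t / rhobar_u X t &
        `|v t om| <= energy_range (S := S) t / rhobar_v X t];
  plan_feasible : {ae P, forall om, lp_feasible X d (w d.-1 om) (w d om) om
    (s ^~ om) (u ^~ om) (v ^~ om) (g ^~ om) (p ^~ om) (z ^~ om)} }.

(** Once its integral differs from [-oo], the value is integrable and so almost surely finite; the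
    measurable selection is then feasible and within [e] of the value almost surely. *)
Lemma near_optimal_day d (e : R) : is_day S d -> 0 < e ->
  (\int[P]_om plan_value d om != -oo)%E ->
  exists s u v g p z, day_plan d s u v g p z /\
    (\int[P]_om plan_value d om - e%:E <=
     \int[P]_om (lp_objective (S := S) tpi_s tpi_u tpi_v d om
       (s ^~ om) (u ^~ om) (v ^~ om))%:E)%E.
Proof.
move=> hd e0 VN; have Vi := integrable_plan_value hd VN.
have [iw iw'] := level_inLv hd.
set G := info_bid X d in iw iw'.
have mG : all_measurable G by exact: measurable_info.
have [|||||s [u [v [g [p [z [mb mf feas opt]]]]]]] :=
    @lp_selection _ _ _ _ _ X tpi_s tpi_u tpi_v d hd (w d.-1) (w d) _ _ _ _ _ e e0.
- by move=> r; have [] := iw' r.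
- by move=> r; have [] := iw r.
- by move=> t dt; have [[[]]] := htpi hd dt.
- by move=> t dt; have [_ [[]]] := htpi hd dt.
- by move=> t dt; have [_ _ [[]]] := htpi hd dt.
have bnd t om : in_day S d t ->
    [/\ bounds t (u t om) (v t om) (g t om) (p t om) (z t om),
        `|s t om| <= energy_range (S := S) t,
        `|u t om| <= energy_range (S := S) t / rhobar_u X t &
        `|v t om| <= energy_range (S := S) t / rhobar_v X t].
  move=> dt; have ht := in_day_hour hd dt.
  have [[Hh _]|/(_ t)[[-> -> ->] [-> -> ->]]] := feas om.
    have [bd su sv _] := Hh t dt.
    by have [? ? ?] := bids_bounds hX ht bd su sv; split.
  have [/andP[a0 _] /andP[b0 _]] := rhobar_bounds hX ht.
  have E0 : 0 <= energy_range (S := S) t.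
    apply: addr_ge0; apply: dotv_ge0;
      [exact: eta_ge0|exact: gmax_ge0|exact: zeta_ge0|exact: pmax_ge0].
  have lev00 n : lev (0 : 'cV[R]_n) 0 by move=> i; rewrite lexx.
  have G0 := gmax_ge0 ht; have P0 := pmax_ge0 ht.
  by rewrite normr0; split => //; apply: divr_ge0 => //; exact: ltW.
have [h hP] := network_potential S.
(* The bound of [spill_bound], integrable because the previous level and the inflows are; it
   dominates the spills, zero plan included. *)
pose D t om := \sum_r (h r)%:R * w d.-1 om r ord0 +
    \sum_(first_hour S d <= tau < t.+1)
      (\sum_r (h r)%:R * phi X tau r om +
       (\sum_r (h r)%:R) * \sum_b pmax S tau b ord0).
have Di t : in_day S d t -> P.-integrable setT (EFin \o D t).
  move=> dt; suff [] : inL P G (D t) by [].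
  apply: inLD; first by apply: inL_sum => r; apply: inLZ; exact: iw'.
  rewrite (_ : (fun _ => _) = fun om => \sum_(tau <- index_iota (first_hour S d) t.+1)
      if in_day S d tau then \sum_r (h r)%:R * phi X tau r om +
       (\sum_r (h r)%:R) * \sum_b pmax S tau b ord0 else 0).
    apply: inL_sum => tau; case dtau : (in_day S d tau); last exact: inL_cst.
    apply: inLD; last exact: inL_cst.
    apply: inL_sum => r; apply: inLZ; split.
      by apply: measurable_wrt_mem; apply: (spot_info_bid hd dtau); right; exists r.
    by apply: (integrable_spot hX (in_day_hour hd dtau)); right; exists r.
  apply/funext => om; apply: eq_big_nat => tau /andP[t1 t2].
  suff -> : in_day S d tau by [].
  by rewrite /in_day t1 (leq_trans (t2 : tau <= t)%N)//; case/andP: dt.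
have zD t a om : in_day S d t -> `|z t om a ord0| <= `|D t om|.
  move=> dt; have [lpf|/(_ t)[_ [_ _ ->]]] := feas om; last first.
    by rewrite mxE normr0.
  have /andP[z0 zle] := spill_bound a hP hd lpf dt.
  by rewrite ger0_norm// (le_trans zle)// ler_norm.
have aefeas : {ae P, forall om, plan_value d om \is a fin_num}.
  by have := integrable_ae measurableT Vi; apply: filterS => om; exact.
exists s, u, v, g, p, z; split; first split.
- move=> t dt; have [ms mu mv] := mb t.
  split; [apply: (@inL_bounded _ _ _ _ _ _ (energy_range (S := S) t)) => // om
         |apply: (@inL_bounded _ _ _ _ _ _ (energy_range (S := S) t / rhobar_u X t)) => // om
         |apply: (@inL_bounded _ _ _ _ _ _ (energy_range (S := S) t / rhobar_v X t)) => // om];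
  by have [] := bnd t om dt.
- move=> t dt; split => i; have [mg mp mz] := mf t i.
  + apply: (@inL_bounded _ _ _ _ _ _ (gmax S t i ord0)) => // om.
    have [[_ _ [g0 gm] _ _] _ _ _] := bnd t om dt.
    by rewrite ger0_norm ?gm//; have := g0 i; rewrite mxE.
  + apply: (@inL_bounded _ _ _ _ _ _ (pmax S t i ord0)) => // om.
    have [[_ _ _ [p0 pm] _] _ _ _] := bnd t om dt.
    by rewrite ger0_norm ?pm//; have := p0 i; rewrite mxE.
  + by apply: (inL_dominated mG mz (Di t dt)) => om; exact: zD.
- by move=> t om dt; exact: bnd.
- by apply: filterS aefeas => om /opt[].
have iobj : P.-integrable setT (EFin \o (fun om =>
    lp_objective (S := S) tpi_s tpi_u tpi_v d om (s ^~ om) (u ^~ om) (v ^~ om))).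
  apply: (@integrable_of_ae_bounded _ _ _ _ _ (objective_bound d)).
  - apply/measurable_EFinP; rewrite /lp_objective.
    rewrite (_ : (fun _ => _) = fun om =>
      \sum_(t <- index_iota (first_hour S d) (last_hour S d).+1)
      if in_day S d t then tpi_s t om * s t om + tpi_u t om * u t om + tpi_v t om * v t om
      else 0).
      apply: measurable_sum => t; case dt : (in_day S d t); last exact: measurable_cst.
      have [[[m1 _] _] [[m2 _] _] [[m3 _] _]] := htpi hd dt.
      have [n1 n2 n3] := mb t.
      have sub (f : Omega -> R) : measurable_wrt G f -> measurable_fun setT f.
        by exact: measurable_sub.
      by apply: measurable_funD; [apply: measurable_funD|]; apply: measurable_funM;
        exact: sub.
    apply/funext => om; apply: eq_big_nat => t; rewrite ltnS => dt.
    by rewrite /in_day dt.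
  - exact: integrable_objective_bound.
  - apply: filterS aefeas => om /opt[lpf _].
    by rewrite /= lee_fin; exact: objective_le_bound lpf.
rewrite -[X in (_ - X%:E)%E]mulr1 EFinM -[X in (_ - e%:E * X)%E](probability_setT P).
rewrite -integral_cst// -integralB//; last exact: finite_measure_integrable_cst.
apply: ae_le_integral => //.
  by apply: integrableB => //; exact: finite_measure_integrable_cst.
apply: filterS aefeas => om fin; have [_ le] := opt om fin.
by rewrite -(fineK fin) /= -EFinB lee_fin.
Qed.

End near_optimal_plans.

(** * From day plans to the bidding models *)

Section bidding_from_plans.
Context {R : realType} {S : hydro_system R} {disp : measure_display}
  {Omega : measurableType disp} {P : probability Omega R} (X : market S P).
Variables tpi_s tpi_u tpi_v : nat -> Omega -> R.
Hypothesis hX : market_assumptions X.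
Hypothesis htpi : forall d t, is_day S d -> in_day S d t ->
    [/\ is_cond_exp P (info_bid X d) (pi_s X t) (tpi_s t),
        is_cond_exp P (info_bid X d) (rev_u X t) (tpi_u t) &
        is_cond_exp P (info_bid X d) (rev_v X t) (tpi_v t)].
Variable w : nat -> Omega -> level S.
Hypothesis hw : reduced_planner_feasible X w.
Variables (s u v : nat -> Omega -> R) (g p z : nat -> Omega -> flow S).
Hypothesis plan : forall d, is_day S d -> day_plan X w d s u v g p z.

Lemma info_bid_hours d : is_day S d -> info_bid X d `<=` info X 0 (nhours S).
Proof. by move=> hd; apply: info_mono => //; exact: prev_last_hour_le. Qed.

Lemma info_bid_hour d t : is_day S d -> in_day S d t -> info_bid X d `<=` info X 0 t.
Proof.
move=> hd /andP[dt _]; apply: info_mono => //.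
by rewrite ltnW// (leq_trans _ dt).
Qed.

Lemma plan_reduced_bidding : reduced_bidding_feasible X s u v g p z w.
Proof.
split.
- exact: (CPr_init hw).
- move=> t /is_hour_day[hd dt]; have [iu iv is_] := plan_bids (plan hd) dt.
  by split; apply: (inL_mono (info_bid_hours hd)).
- move=> t /is_hour_day[hd dt]; have [ig ip iz] := plan_flows (plan hd) dt.
  by split; apply: (inLv_mono (info_bid_hours hd)).
- exact: (CPr_levels hw).
- move=> d t hd dt; apply: filterS (plan_feasible (plan hd)) => om [Hh _].
  by have [? ? ? ?] := Hh t dt; split.
- by move=> d hd; apply: filterS (plan_feasible (plan hd)) => om [_ Ht].
- exact: (CPr_bounds hw).
Qed.

Variable Y : 'M[R]_(narcs S, (nupper S).+1).
Hypothesis Y_ge0 : forall a r, 0 <= Y a r.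
Hypothesis MY : incidence S *m Y = \matrix_(r, r') ((r == ord_max)%:R - (r == r')%:R).

Let weight t om := mix_rv X t (s t om) (u t om) (v t om) (g t om) (p t om) om.
Let excess d om : level S :=
  level_after X d (last_hour S d) (w d.-1 om) g p z om - w d om.
(** Earlier in the day the levels remain those of the plan. The excess is computed from the planned
    flows, so it is known at closing time; mixing does not alter it, as the net flows are the
    same. *)
Let flush t om : flow S :=
  if t == last_hour S (day_of S t) then Y *m excess (day_of S t) om else 0.
Let cg t om := mix_g (weight t om) (g t om).
Let cp t om := mix_p t (weight t om) (p t om).
Let cz t om := mix_z t (weight t om) (g t om) (p t om) (z t om) + flush t om.
Let net t om := inflow X t om + incidence S *m (cg t om - cp t om + cz t om).
Let cw := fix cw t om : level S :=
  if t is t'.+1 then cw t' om + net t'.+1 om else w 0%N om.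

Lemma inflow_inLv d t : is_day S d -> in_day S d t -> inLv P (info_bid X d) (inflow X t).
Proof.
move=> hd dt r; rewrite (_ : (fun _ => _) = phi X t r); last first.
  by apply/funext => om; rewrite mxE.
have sp : spot_rvs X t (phi X t r) by right; exists r.
split; first by apply: measurable_wrt_mem; exact: spot_info_bid sp.
exact: (integrable_spot hX (in_day_hour hd dt)).
Qed.

Lemma level_after_inLv d t : is_day S d -> in_day S d t ->
  inLv P (info_bid X d) (fun om => level_after X d t (w d.-1 om) g p z om).
Proof.
move=> hd dt; apply: inLvD; first by have [] := level_inLv hw hd.
apply: inLv_sum_nat => tau /andP[t1 t2].
have dtau : in_day S d tau.
  by rewrite /in_day t1 (leq_trans (t2 : tau <= t)%N)//; case/andP: dt.
have [ig ip iz] := plan_flows (plan hd) dtau.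
apply: inLvD; first exact: inflow_inLv.
by apply: inLv_mulmx; apply: inLvD => //; exact: inLvB.
Qed.

Lemma last_hour_in_day d : is_day S d -> in_day S d (last_hour S d).
Proof.
move=> /andP[d0 _]; rewrite /in_day leqnn andbT last_hourE// /first_hour /prev_last_hour.
by have := hpd_gt0 S; lia.
Qed.

Let flush_inLv t : is_hour S t -> inLv P (info X 0 t) (flush t).
Proof.
move=> /is_hour_day[hd dt]; apply: (inLv_mono (info_bid_hour hd dt)); rewrite /flush.
case: eqP => _; last exact: inLv_cst.
apply: inLv_mulmx; apply: inLvB; last by have [] := level_inLv hw hd.
exact/level_after_inLv/last_hour_in_day.
Qed.

(** The only ingredients unknown at closing time are the allocation and activation of hour [t],
    which enter through the delivery and are revealed by hour [t]; the mixed decisions are therefore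
    nonanticipative. *)
Let measurable_weight t : is_hour S t -> measurable_wrt (info X 0 t) (weight t).
Proof.
move=> ht; have [hd dt] := is_hour_day ht; have sub := info_bid_hour hd dt.
have sub' : info X (first_hour S (day_of S t)) t `<=` info X 0 t by exact: info_mono.
have [[ms _] [mu _] [mv _]] := plan_bids (plan hd) dt.
have [ig ip _] := plan_flows (plan hd) dt.
have md n (c : 'cV[R]_n) (f : Omega -> 'cV[R]_n) : inLv P (info_bid X (day_of S t)) f ->
    measurable_wrt (info X 0 t) (fun om => dotv c (f om)).
  move=> fL; rewrite (_ : (fun _ => _) = fun om => \sum_i c i ord0 * f om i ord0).
    apply: measurable_sum => i; apply: measurable_funM; first exact: measurable_wrt_cst.
    by have [mf _] := fL i; exact: measurable_mono mf.
  by apply/funext => om; rewrite dotvE.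
apply: measurable_clamp01; apply: measurable_funM.
  apply: measurable_funD; last exact: measurable_wrt_cst.
  apply: measurable_delivery.
  - exact: subset_trans (kappa_info hd dt) sub'.
  - exact: subset_trans (rho_info hd dt) sub'.
  - exact: measurable_mono ms.
  - exact: measurable_mono mu.
  - exact: measurable_mono mv.
apply: measurable_fun_inv; apply: measurable_funD; last exact: measurable_wrt_cst.
by apply: measurable_funB; exact: md.
Qed.

Let weight_mul_inLv t (f : Omega -> flow S) : is_hour S t ->
  inLv P (info_bid X (day_of S t)) f -> inLv P (info X 0 t) (fun om => weight t om *: f om).
Proof.
move=> ht fL i; have [hd dt] := is_hour_day ht.
have [mf fi] := fL i; have mw := measurable_weight ht.
have mf' : measurable_wrt (info X 0 t) (fun om => f om i ord0).
  exact: measurable_mono (info_bid_hour hd dt) mf.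
apply: (@inL_dominated _ _ _ P _ _ (fun om => f om i ord0)) => //.
- exact: measurable_info.
- rewrite (_ : (fun _ => _) = fun om => weight t om * f om i ord0).
    exact: measurable_funM.
  by apply/funext => om; rewrite mxE.
- move=> om; rewrite mxE normrM -[leRHS]mul1r ler_wpM2r//.
  have /andP[l0 l1] := clamp01_ge0_le1
    (mix_weight t (delivery X t om (s t om) (u t om) (v t om)) (g t om) (p t om)).
  by rewrite ger0_norm.
Qed.

Let flows_inLv t : is_hour S t ->
  [/\ inLv P (info X 0 t) (cg t), inLv P (info X 0 t) (cp t) & inLv P (info X 0 t) (cz t)].
Proof.
move=> ht; have [hd dt] := is_hour_day ht; have sub := info_bid_hour hd dt.
have [ig ip iz] := plan_flows (plan hd) dt.
have ipm : inLv P (info_bid X (day_of S t)) (fun=> pmax S t) by exact: inLv_cst.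
split; first exact: weight_mul_inLv.
- apply: (@eq_inLv _ _ _ _ _ _ (fun om => pmax S t + weight t om *: (p t om - pmax S t))).
    by move=> om i; rewrite !mxE; ring.
  by apply: inLvD; [exact: inLv_cst|apply: weight_mul_inLv => //; exact: inLvB].
- apply: inLvD; last exact: flush_inLv.
  have igp : inLv P (info_bid X (day_of S t)) (fun om => g t om - p t om + pmax S t).
    by apply: inLvD => //; exact: inLvB.
  apply: (@eq_inLv _ _ _ _ _ _ (fun om => z t om + (g t om - p t om + pmax S t) -
      weight t om *: (g t om - p t om + pmax S t))).
    by move=> om i; rewrite !mxE; ring.
  apply: inLvB; last exact: weight_mul_inLv.
  by apply: (inLv_mono sub); exact: inLvD.
Qed.

Let cw_inLv t : (t <= nhours S)%N -> inLv P (info X 0 t) (cw t).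
Proof.
elim: t => [_|t IH tT].
  apply: (@eq_inLv _ _ _ _ _ _ (fun=> w0 S)); last exact: inLv_cst.
  by move=> om i; rewrite /= (CPr_init hw).
have ht : is_hour S t.+1 by [].
have [hd dt] := is_hour_day ht; have [ig ip iz] := flows_inLv ht.
apply: inLvD.
  by apply: (inLv_mono _ (IH (ltnW tT))); exact: info_mono.
apply: inLvD; first exact: (inLv_mono (info_bid_hour hd dt) (inflow_inLv hd dt)).
by apply: inLv_mulmx; apply: inLvD => //; exact: inLvB.
Qed.

(* Away from the sink the levels [cw] follow [target]; at the sink they may exceed it. *)
Let target t om : level S :=
  if t is 0%N then w 0%N om else
  if t == last_hour S (day_of S t) then w (day_of S t) om
  else level_after X (day_of S t) t (w (day_of S t).-1 om) g p z om.

(** The issue is the day boundary: if [t] closes the previous day, the sum in [level_after] is empty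
    and both sides are the planned level [w d.-1]; the initial hour [0] is the instance [d = 1]. *)
Let target_pred t om : is_hour S t.+1 -> let d := day_of S t.+1 in
  target t om = level_after X d t (w d.-1 om) g p z om.
Proof.
move=> ht /=; have [hd dt] := is_hour_day ht; set d := day_of S t.+1 in hd dt *.
have d0 : (0 < d)%N by case/andP: hd.
have dt' := dt; move: dt'; rewrite /in_day => /andP[t1 t2].
have [tE|tE] := eqVneq t (prev_last_hour S d).
  have -> : level_after X d t (w d.-1 om) g p z om = w d.-1 om.
    by rewrite /level_after tE /first_hour /prev_last_hour big_geq ?addr0.
  rewrite /target; case: t ht @d hd dt d0 t1 t2 tE => [|t] ht d hd dt d0 t1 t2 tE.
    case: (posnP d.-1) => [->//|dp].
    by move: tE; rewrite /prev_last_hour => /esym/eqP; rewrite muln_eq0 eqn0Ngt dp /=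
      eqn0Ngt hpd_gt0.
  have dp : (0 < d.-1)%N.
    by rewrite lt0n; apply/eqP => dz; move: tE; rewrite /prev_last_hour dz mul0n.
  have dE : day_of S t.+1 = d.-1.
    apply: day_of_in_day => //; rewrite tE /in_day /prev_last_hour /last_hour leqnn andbT.
    by rewrite -/(last_hour S d.-1) last_hourE// /first_hour /prev_last_hour;
      have := hpd_gt0 S; lia.
  by rewrite dE /last_hour -/(prev_last_hour S d) -tE eqxx.
have t0 : in_day S d t.
  rewrite /in_day (ltnW t2) andbT /first_hour ltn_neqAle eq_sym tE.
  by move: t1; rewrite /first_hour.
have dE := day_of_in_day d0 t0.
rewrite /target; case: t ht @d hd dt d0 t1 t2 tE t0 dE => [|t] ht d hd dt d0 t1 t2 tE t0 dE.
  by move: t0; rewrite /in_day.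
by rewrite dE ltn_eqF.
Qed.

Let cw_target t om : (t <= nhours S)%N ->
  (forall d, is_day S d -> lev (w d om) (level_after X d (last_hour S d) (w d.-1 om) g p z om)) ->
  (forall r, r != ord_max -> cw t om r ord0 = target t om r ord0) /\
  target t om ord_max ord0 <= cw t om ord_max ord0.
Proof.
move=> + tgt; elim: t => [//|t IH] tT.
have ht : is_hour S t.+1 by [].
have [hd dt] := is_hour_day ht.
have [IHr IHs] := IH (ltnW tT); move: IHr IHs; rewrite target_pred//.
set d := day_of S t.+1 in hd dt *; set L := level_after _ _ _ _ _ _ _ _ => IHr IHs.
have LE : level_after X d t.+1 (w d.-1 om) g p z om =
    L + (inflow X t.+1 om + incidence S *m (g t.+1 om - p t.+1 om + z t.+1 om)).
  rewrite /L /level_after big_nat_recr ?addrA//=; last by case/andP: dt.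
have cwE r : cw t.+1 om r ord0 = cw t om r ord0 - L r ord0 +
    level_after X d t.+1 (w d.-1 om) g p z om r ord0 + (incidence S *m flush t.+1 om) r ord0.
  have netE : cg t.+1 om - cp t.+1 om + cz t.+1 om =
      g t.+1 om - p t.+1 om + z t.+1 om + flush t.+1 om.
    by rewrite /cz addrA /cg /cp mix_net.
  have matD (a b : level S) : (a + b) r ord0 = a r ord0 + b r ord0 by rewrite mxE.
  by rewrite LE /= /net netE mulmxDr !matD; ring.
rewrite /target -/d; case: eqP => tl; last first.
  have f0 : flush t.+1 om = 0 by rewrite /flush -/d; case: eqP.
  have z0 r : (0 : level S) r ord0 = 0 by rewrite mxE.
  split => [r rs|]; rewrite cwE f0 mulmx0 z0 addr0.
    by rewrite IHr// subrr add0r.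
  by rewrite lerDr subr_ge0.
(* Each reservoir loses its own excess and the sink collects them all, which is a net gain by the
   nonnegative excess of the others. *)
have fE : incidence S *m flush t.+1 om =
    \col_r ((r == ord_max)%:R * (\sum_r' excess d om r' ord0) - excess d om r ord0).
  have -> : flush t.+1 om = Y *m excess d om by rewrite /flush -/d; case: eqP.
  rewrite mulmxA MY; apply/matrixP => r j; rewrite mxE [RHS]mxE ord1.
  under eq_bigr do rewrite mxE mulrBl.
  rewrite sumrB -mulr_sumr; congr (_ - _).
  rewrite (bigD1 r)//= eqxx mul1r big1 ?addr0// => r' /negbTE.
  by rewrite eq_sym => ->; rewrite mul0r.
have excE r : excess d om r ord0 =
    level_after X d t.+1 (w d.-1 om) g p z om r ord0 - w d om r ord0.
  by rewrite /excess -tl [LHS]mxE [X in _ + X]mxE.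
split => [r rs|]; rewrite cwE fE [(\col_ _ _) _ _]mxE.
  by rewrite (negbTE rs) mul0r IHr// excE; ring.
have tot : \sum_r excess d om r ord0 =
    excess d om ord_max ord0 + \sum_(r | r != ord_max) excess d om r ord0.
  by rewrite (bigD1 ord_max).
rewrite eqxx mul1r tot.
have : 0 <= \sum_(r | r != ord_max) excess d om r ord0.
  by apply: sumr_ge0 => r _; rewrite excE subr_ge0 tl; exact: tgt.
have sink0 : 0 <= excess d om ord_max ord0 by rewrite excE subr_ge0 tl; exact: tgt.
by have := excE ord_max; lra.
Qed.

Lemma plan_bidding : exists g' p' z' w', bidding_feasible X s u v g' p' z' w'.
Proof.
exists cg, cp, cz, cw; split.
- exact: (CPr_init hw).
- by move=> t /is_hour_day[hd dt]; exact: (plan_bids (plan hd)).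
- move=> t ht; have [ig ip iz] := flows_inLv ht; split => //.
  by apply: cw_inLv; case/andP: ht.
- move=> t ht; have [hd dt] := is_hour_day ht.
  have tgt : {ae P, forall om, forall d, is_day S d ->
      lp_feasible X d (w d.-1 om) (w d om) om
        (s ^~ om) (u ^~ om) (v ^~ om) (g ^~ om) (p ^~ om) (z ^~ om)}.
    by apply: ae_forall_imply => d /plan/plan_feasible.
  have rho := rho_bounds_ae hX ht; have wb := CPr_bounds hw hd.
  apply: filterS3 tgt rho wb => om lpf [ru rv] wb.
  have tgt d : is_day S d ->
      lev (w d om) (level_after X d (last_hour S d) (w d.-1 om) g p z om).
    by move=> /lpf[].
  have [bd su sv lb] := lp_hour (lpf _ hd) dt.
  have [[u0 v0 [g0 gm] [p0 pm] z0] de] := mix_rvP ht ru rv bd su sv.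
  have tT : (t <= nhours S)%N by case/andP: ht.
  have [cwr cws] := cw_target tT tgt.
  split => //.
  + split => // a; rewrite [leLHS]mxE [leRHS]mxE addr_ge0//.
      by have := z0 a; rewrite [leLHS]mxE.
    rewrite /flush; case: eqP => _; last by rewrite mxE.
    rewrite mxE; apply: sumr_ge0 => r _; apply: mulr_ge0; first exact: Y_ge0.
    by rewrite /excess [leRHS]mxE [X in _ + X]mxE subr_ge0; exact: tgt.
  + have cwS k : (0 < k)%N -> cw k om = cw k.-1 om + net k om by case: k.
    by rewrite cwS ?addrA//; case/andP: ht.
  + have tb : level_bounds t (target t om).
      have targetE k : (0 < k)%N -> target k om = if k == last_hour S (day_of S k)
        then w (day_of S k) om else level_after X (day_of S k) k (w (day_of S k).-1 om) g p z om.
        by case: k.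
      rewrite targetE; last by case/andP: ht.
      case: eqP => tl; last exact: lb.
      by rewrite {1}tl.
    (* The sink may lie above its target: its lower bound holds a fortiori and its upper bound is
       [+oo]. *)
    case: tb => [tlo thi]; split => r; have [->|rs] := eqVneq r ord_max.
    * exact: le_trans (tlo _) cws.
    * by rewrite cwr.
    * by rewrite whi_sink// leey.
    * by rewrite cwr.
Qed.

End bidding_from_plans.

(** * Comparison of the optimal values *)

Section optimal_values.
Context {R : realType} {S : hydro_system R} {disp : measure_display}
  {Omega : measurableType disp} {P : probability Omega R} (X : market S P).
Variables tpi_s tpi_u tpi_v : nat -> Omega -> R.
Hypothesis hX : market_assumptions X.
Hypothesis htpi : forall d t, is_day S d -> in_day S d t ->
    [/\ is_cond_exp P (info_bid X d) (pi_s X t) (tpi_s t),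
        is_cond_exp P (info_bid X d) (rev_u X t) (tpi_u t) &
        is_cond_exp P (info_bid X d) (rev_v X t) (tpi_v t)].

Let objective d s u v om :=
  lp_objective (S := S) tpi_s tpi_u tpi_v d om (s ^~ om) (u ^~ om) (v ^~ om).

(** Prices are merely integrable, so boundedness of the bids is what makes the products integrable
    and allows expectations to be split. *)
Definition bounded_bids (s u v : nat -> Omega -> R) := forall t, is_hour S t ->
  exists M, [/\ measurable_fun setT (s t), measurable_fun setT (u t), measurable_fun setT (v t) &
    {ae P, forall om, [/\ `|s t om| <= M, `|u t om| <= M & `|v t om| <= M]}].

Lemma integrable_products (a b c : Omega -> R) (s u v : nat -> Omega -> R) t :
  bounded_bids s u v -> is_hour S t ->
  P.-integrable setT (EFin \o a) -> P.-integrable setT (EFin \o b) ->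
  P.-integrable setT (EFin \o c) ->
  [/\ P.-integrable setT (EFin \o (fun om => a om * s t om)),
      P.-integrable setT (EFin \o (fun om => b om * u t om)) &
      P.-integrable setT (EFin \o (fun om => c om * v t om))].
Proof.
move=> bnd ht ia ib ic; have [M [ms mu mv H]] := bnd t ht.
split; [apply: (integrable_bounded_mul (M := M)) ia ms _
       |apply: (integrable_bounded_mul (M := M)) ib mu _
       |apply: (integrable_bounded_mul (M := M)) ic mv _];
  by apply: filterS H => om [].
Qed.

Lemma expectation_sum3 (a b c : Omega -> R) :
  P.-integrable setT (EFin \o a) -> P.-integrable setT (EFin \o b) ->
  P.-integrable setT (EFin \o c) ->
  P.-integrable setT (EFin \o (fun om => a om + b om + c om)) /\
  ('E_P[fun om => (a om + b om + c om)%R] =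
    \int[P]_om (a om)%:E + \int[P]_om (b om)%:E + \int[P]_om (c om)%:E)%E.
Proof.
move=> ia ib ic; have iab := integrableD measurableT ia ib.
split; first by have := integrableD measurableT iab ic; apply: eq_integrable.
rewrite expectation.unlock; under eq_integral do rewrite !EFinD.
by rewrite integralD// integralD.
Qed.

Let products s u v : bounded_bids s u v -> forall t, is_hour S t ->
  [/\ P.-integrable setT (EFin \o (fun om => tpi_s t om * s t om)),
      P.-integrable setT (EFin \o (fun om => tpi_u t om * u t om)) &
      P.-integrable setT (EFin \o (fun om => tpi_v t om * v t om))].
Proof.
move=> bnd t ht; have [hd dt] := is_hour_day ht.
have [[[_ i1] _] [[_ i2] _] [[_ i3] _]] := htpi hd dt.
exact: integrable_products.
Qed.

Lemma sum_expected_objective s u v : bounded_bids s u v ->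
  (\sum_(1 <= t < (nhours S).+1)
    'E_P[fun om => (tpi_s t om * s t om + tpi_u t om * u t om + tpi_v t om * v t om)%R] =
   \sum_(1 <= d < (ndays S).+1) \int[P]_om (objective d s u v om)%:E)%E.
Proof.
move=> bnd; rewrite sum_hours_days; apply: eq_big_nat => d hd.
pose f t om := if in_day S d t then
  (tpi_s t om * s t om + tpi_u t om * u t om + tpi_v t om * v t om)%:E else 0%E.
transitivity (\sum_(first_hour S d <= t < (last_hour S d).+1) \int[P]_om f t om)%E.
  by apply: eq_big_nat => t; rewrite ltnS => dt; rewrite expectation.unlock /f /in_day dt.
rewrite -integral_sum//; last first.
  move=> t; rewrite /f; case dt : (in_day S d t); last exact: integrable0.
  have [i1 i2 i3] := products bnd (in_day_hour hd dt).
  by have [] := expectation_sum3 i1 i2 i3.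
apply: eq_integral => om _; rewrite /objective /lp_objective -sumEFin.
by apply: eq_big_nat => t; rewrite ltnS => dt; rewrite /f /in_day dt.
Qed.

Lemma integrable_objective s u v d : bounded_bids s u v -> is_day S d ->
  P.-integrable setT (fun om => (objective d s u v om)%:E).
Proof.
move=> bnd hd; pose f t om := if in_day S d t then
  (tpi_s t om * s t om + tpi_u t om * u t om + tpi_v t om * v t om)%:E else 0%E.
rewrite (_ : (fun _ => _) = fun om =>
  (\sum_(t <- index_iota (first_hour S d) (last_hour S d).+1) f t om)%E); last first.
  apply/funext => om; rewrite /objective /lp_objective -sumEFin.
  by apply: eq_big_nat => t; rewrite ltnS => dt; rewrite /f /in_day dt.
apply: integrable_sum => // t _; rewrite /f; case dt : (in_day S d t); last exact: integrable0.
have [i1 i2 i3] := products bnd (in_day_hour hd dt).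
by have [] := expectation_sum3 i1 i2 i3.
Qed.

(** Bids known at closing time can be pulled out of the conditional expectations that define the
    reduced prices. *)
Lemma expected_revenue_reduced (K : nat -> Omega -> probability Omega R) s u v t :
  (forall d, is_day S d -> is_regular_cond_prob P (info_bid X d) (K d)) ->
  bounded_bids s u v -> is_hour S t ->
  measurable_wrt (info_bid X (day_of S t)) (s t) ->
  measurable_wrt (info_bid X (day_of S t)) (u t) ->
  measurable_wrt (info_bid X (day_of S t)) (v t) ->
  ('E_P[fun om => revenue X t om (s t om) (u t om) (v t om)] =
   'E_P[fun om => (tpi_s t om * s t om + tpi_u t om * u t om + tpi_v t om * v t om)%R])%E.
Proof.
move=> hK bnd ht ms mu mv; have [hd dt] := is_hour_day ht.
have is_ := integrable_pi_s hX ht; have iu := integrable_rev_u hX ht.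
have iv := integrable_rev_v hX ht.
have [i1 i2 i3] := integrable_products bnd ht is_ iu iv.
have [j1 j2 j3] := products bnd ht.
have [_ ->] := expectation_sum3 i1 i2 i3; have [_ ->] := expectation_sum3 j1 j2 j3.
have [c1 c2 c3] := htpi hd dt.
have mS := @measurable_info _ _ _ _ _ X 0 (prev_last_hour S (day_of S t)).
by rewrite (cond_exp_mul mS (hK _ hd) is_ c1 ms i1) (cond_exp_mul mS (hK _ hd) iu c2 mu i2)
  (cond_exp_mul mS (hK _ hd) iv c3 mv i3).
Qed.

Section fixed_levels.
Variable w : nat -> Omega -> level S.
Hypothesis hw : reduced_planner_feasible X w.
Let V := plan_value X tpi_s tpi_u tpi_v w.

Lemma day_plan_ext d s u v g p z s' u' v' g' p' z' :
  (forall t, in_day S d t -> [/\ s t = s' t, u t = u' t & v t = v' t] /\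
     [/\ g t = g' t, p t = p' t & z t = z' t]) ->
  is_day S d -> day_plan X w d s u v g p z -> day_plan X w d s' u' v' g' p' z'.
Proof.
move=> E hd [H1 H2 H3 H4]; split.
- by move=> t dt; have [[<- <- <-] _] := E t dt; exact: H1.
- by move=> t dt; have [_ [<- <- <-]] := E t dt; exact: H2.
- by move=> t om dt; have [[<- <- <-] [<- <- <-]] := E t dt; exact: H3.
- apply: filterS H4 => om; apply: lp_feasible_ext => t dt.
  by have [[-> -> ->] [-> -> ->]] := E t dt.
Qed.

Lemma plans_bounded s u v g p z :
  (forall d, is_day S d -> day_plan X w d s u v g p z) -> bounded_bids s u v.
Proof.
move=> plan t ht; have [hd dt] := is_hour_day ht.
have [is_ iu iv] := plan_bids (plan _ hd) dt.
have sub f : inL P (info_bid X (day_of S t)) f -> measurable_fun setT f.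
  by move=> [mf _]; apply: measurable_sub mf; exact: measurable_info.
exists (Num.max (energy_range (S := S) t) (Num.max
  (energy_range (S := S) t / rhobar_u X t) (energy_range (S := S) t / rhobar_v X t))).
split; [exact: sub|exact: sub|exact: sub|].
apply/aeW => om; have [_ sb ub vb] := plan_bounds (plan _ hd) om dt.
by rewrite !le_max sb ub vb !orbT.
Qed.

(** A day whose value integrates to [-oo] makes the whole sum [-oo]. Otherwise every day has a
    near-optimal plan, and the tolerance [e] is shared equally among the days. *)
Lemma plan_values_le (Y : \bar R) :
  (forall s u v g p z, (forall d, is_day S d -> day_plan X w d s u v g p z) ->
    (\sum_(1 <= d < (ndays S).+1) \int[P]_om (objective d s u v om)%:E <= Y)%E) ->
  (\sum_(1 <= d < (ndays S).+1) \int[P]_om V d om <= Y)%E.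
Proof.
move=> HY.
have [[d /andP[hd /eqP VN]]|/forallNP noN] :=
    pselect (exists d, is_day S d && (\int[P]_om V d om == -oo)%E).
  suff -> : (\sum_(1 <= d < (ndays S).+1) \int[P]_om V d om = -oo)%E by rewrite leNye.
  by apply/esum_eqNyP; exists d; split => //; rewrite mem_index_iota.
have VN d : is_day S d -> (\int[P]_om V d om != -oo)%E.
  by move=> hd; apply/negP => VN; apply: (noN d); rewrite hd.
have Vfin d : is_day S d -> (\int[P]_om V d om)%E \is a fin_num.
  move=> hd; apply: integrable_fin_num => //.
  exact: (integrable_plan_value hX htpi hw hd (VN d hd)).
apply/lee_addgt0Pr => e e0; pose e' := e / (ndays S)%:R.
have D0 : 0 < (ndays S)%:R :> R by rewrite ltr0n ndays_gt0.
have e'0 : 0 < e' by rewrite divr_gt0.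
pose tup := ((nat -> Omega -> R) * (nat -> Omega -> R) * (nat -> Omega -> R) *
  ((nat -> Omega -> flow S) * (nat -> Omega -> flow S) * (nat -> Omega -> flow S)))%type.
have /choice[c cP] d : exists c : tup, is_day S d ->
    day_plan X w d c.1.1.1 c.1.1.2 c.1.2 c.2.1.1 c.2.1.2 c.2.2 /\
    (\int[P]_om V d om - e'%:E <= \int[P]_om (objective d c.1.1.1 c.1.1.2 c.1.2 om)%:E)%E.
  have [hd|nd] := boolP (is_day S d); last first.
    by exists (fun _ _ => 0, fun _ _ => 0, fun _ _ => 0,
      (fun _ _ => 0, fun _ _ => 0, fun _ _ => 0)).
  have [s [u [v [g [p [z H]]]]]] := near_optimal_day hX htpi hw hd e'0 (VN d hd).
  by exists (s, u, v, (g, p, z)).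
(* For fixed levels [w] the days are decoupled, so the daily plans are glued by reading each hour
   from the plan of its own day. *)
pose cs t := (c (day_of S t)).1.1.1 t; pose cu t := (c (day_of S t)).1.1.2 t.
pose cv t := (c (day_of S t)).1.2 t; pose cg t := (c (day_of S t)).2.1.1 t.
pose cp t := (c (day_of S t)).2.1.2 t; pose cz t := (c (day_of S t)).2.2 t.
have cE d t : is_day S d -> in_day S d t -> day_of S t = d.
  by move=> /andP[d0 _]; exact: day_of_in_day.
have plan d : is_day S d -> day_plan X w d cs cu cv cg cp cz.
  move=> hd; have [H _] := cP d hd; apply: day_plan_ext H => // t dt.
  by rewrite /cs /cu /cv /cg /cp /cz (cE d t).
have obj d : is_day S d ->
    (\int[P]_om V d om - e'%:E <= \int[P]_om (objective d cs cu cv om)%:E)%E.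
  move=> hd; have [_ H] := cP d hd; apply: le_trans H _.
  rewrite le_eqVlt; apply/orP; left; apply/eqP; apply: eq_integral => om _.
  congr (_%:E); apply: eq_big_nat => t; rewrite ltnS => dt.
  by rewrite /cs /cu /cv (cE d t).
apply: (@le_trans _ _ (\sum_(1 <= d < (ndays S).+1)
  \int[P]_om (objective d cs cu cv om)%:E + e%:E)%E);
  last by rewrite leeD2r//; exact: HY plan.
rewrite -leeBlDr//.
have -> : (\sum_(1 <= d < (ndays S).+1) \int[P]_om V d om - e%:E =
    \sum_(1 <= d < (ndays S).+1) (\int[P]_om V d om - e'%:E))%E.
  have -> : e = \sum_(1 <= d < (ndays S).+1) e'.
    by rewrite sumr_const_nat subSS subn0 /e' -[RHS]mulr_natr divfK// gt_eqF.
  rewrite -sumEFin.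
  have -> : (\sum_(1 <= d < (ndays S).+1) \int[P]_om V d om =
      (\sum_(1 <= d < (ndays S).+1) fine (\int[P]_om V d om))%:E)%E.
    by rewrite -sumEFin; apply: eq_big_nat => d hd; rewrite fineK// Vfin.
  rewrite sumEFin -EFinB -sumrB -sumEFin; apply: eq_big_nat => d hd.
  by rewrite EFinB fineK// Vfin.
by rewrite big_nat [leRHS]big_nat; apply: lee_sum => d hd; exact: obj.
Qed.

(** The decisions here may anticipate later information; for almost every outcome they are still a
    feasible point of that outcome's program, so its value dominates them pointwise. *)
Lemma plan_value_ge s u v g p z d : is_day S d -> bounded_bids s u v ->
  {ae P, forall om, lp_feasible X d (w d.-1 om) (w d om) om
    (s ^~ om) (u ^~ om) (v ^~ om) (g ^~ om) (p ^~ om) (z ^~ om)} ->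
  (\int[P]_om (objective d s u v om)%:E <= \int[P]_om V d om)%E.
Proof.
move=> hd bnd feas; have mV : measurable_fun setT (V d).
  exact: (measurable_sub (@measurable_info _ _ _ _ _ X _ _) (measurable_plan_value htpi hw hd)).
have objV : {ae P, forall om, ((objective d s u v om)%:E <= V d om)%E}.
  apply: filterS feas => om lpf; apply: ereal_sup_ubound.
  by exists (s ^~ om), (u ^~ om), (v ^~ om), (g ^~ om), (p ^~ om), (z ^~ om).
apply: (ae_le_integral (integrable_objective bnd hd) _ objV).
apply: (integrable_of_ae_bounded mV (integrable_objective_bound htpi hd)).
apply: filterS2 feas objV => om lpf; have := objective_le_bound tpi_s tpi_u tpi_v hX hd lpf.
rewrite ler_norml => /andP[lo _].
have := plan_value_le_bound tpi_s tpi_u tpi_v hX w om hd; rewrite -/(V d om).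
case: (V d om) => [y| |]; rewrite ?leye_eq ?leeNy_eq// !lee_fin => hi le.
by rewrite ler_norml hi andbT; exact: le_trans lo le.
Qed.

End fixed_levels.

Section kernels.
Variable K : nat -> Omega -> probability Omega R.
Hypothesis hK : forall d, is_day S d -> is_regular_cond_prob P (info_bid X d) (K d).

Lemma integral_trader_value w d : is_day S d ->
  (\int[P]_om trader_value X (K d) d (w d.-1 om) (w d om) om =
   \int[P]_om plan_value X tpi_s tpi_u tpi_v w d om)%E.
Proof.
move=> hd; apply: integral_ae_ext.
have gen := generic_ae hX hd (hK hd) (fun t => htpi hd (t := t)).
apply: filterS gen => om gen; apply/eqP; rewrite eq_le; apply/andP; split.
- exact: trader_le_lp.
- exact: lp_le_trader.
Qed.

Lemma reduced_bidding_le_planner :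
  (reduced_bidding_value X tpi_s tpi_u tpi_v <= reduced_planner_value X K)%E.
Proof.
apply: ge_ereal_sup => _ [s [u [v [g [p [z [w [feas ->]]]]]]]].
have [ini bids flows lvl cons tgt bnd] := feas.
have hw : reduced_planner_feasible X w by [].
have mI f t t' : inL P (info X t t') f -> measurable_fun setT f.
  by move=> [mf _]; apply: measurable_sub mf; exact: measurable_info.
have bb : bounded_bids s u v.
  move=> t ht; have [hd dt] := is_hour_day ht; have [is_ iu iv] := bids t ht.
  exists (Num.max (energy_range (S := S) t) (Num.max
    (energy_range (S := S) t / rhobar_u X t) (energy_range (S := S) t / rhobar_v X t))).
  split; [exact: mI is_|exact: mI iu|exact: mI iv|].
  apply: filterS (cons _ _ hd dt) => om [bd su sv _].
  have [sb ub vb] := bids_bounds hX ht bd su sv.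
  by rewrite !le_max sb ub vb !orbT.
rewrite sum_expected_objective//.
apply: (@le_trans _ _ (\sum_(1 <= d < (ndays S).+1)
    \int[P]_om plan_value X tpi_s tpi_u tpi_v w d om)%E).
  rewrite big_nat [leRHS]big_nat; apply: lee_sum => d hd.
  have hdays : {ae P, forall om, forall t, in_day S d t ->
      [/\ bounds t (u t om) (v t om) (g t om) (p t om) (z t om),
          s t om + rhobar_u X t * u t om = energy t (g t om) (p t om),
          s t om - rhobar_v X t * v t om >= - dotv (zeta S t) (pmax S t)
        & level_bounds t (level_after X d t (w d.-1 om) g p z om)]}.
    by apply: ae_forall_imply => t; exact: cons.
  apply: (plan_value_ge hw hd bb (g := g) (p := p) (z := z)).
  by apply: filterS2 hdays (tgt d hd) => om h1 h2; split.
apply: ereal_sup_ubound; exists w => //.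
by apply: eq_big_nat => d hd; rewrite integral_trader_value.
Qed.

(** Shared by the comparisons with both bidding models: it suffices to bound the objectives of day
    plans. *)
Lemma planner_le (Y : \bar R) :
  (forall w s u v g p z, reduced_planner_feasible X w ->
    (forall d, is_day S d -> day_plan X w d s u v g p z) ->
    (\sum_(1 <= d < (ndays S).+1) \int[P]_om (objective d s u v om)%:E <= Y)%E) ->
  (reduced_planner_value X K <= Y)%E.
Proof.
move=> HY; apply: ge_ereal_sup => _ [w hw ->].
rewrite (_ : (\sum_(1 <= d < (ndays S).+1) _)%E = (\sum_(1 <= d < (ndays S).+1)
    \int[P]_om plan_value X tpi_s tpi_u tpi_v w d om)%E).
  by apply: plan_values_le => // s u v g p z; exact: HY.
by apply: eq_big_nat => d hd; rewrite integral_trader_value.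
Qed.

Lemma planner_le_reduced_bidding :
  (reduced_planner_value X K <= reduced_bidding_value X tpi_s tpi_u tpi_v)%E.
Proof.
apply: planner_le => w s u v g p z hw plan.
rewrite -sum_expected_objective; last exact: plans_bounded plan.
apply: ereal_sup_ubound; exists s, u, v, g, p, z, w; split => //.
exact: plan_reduced_bidding.
Qed.

Lemma planner_le_bidding : (reduced_planner_value X K <= bidding_value X)%E.
Proof.
apply: planner_le => w s u v g p z hw plan.
have bb := plans_bounded plan; rewrite -sum_expected_objective//.
have [Y [Y0 MY]] := flush_matrix S.
have [g' [p' [z' [w' feas]]]] := plan_bidding hX hw plan Y0 MY.
apply: ereal_sup_ubound; exists s, u, v, g', p', z', w'; split => //.
apply: eq_big_nat => t ht; have [hd dt] := is_hour_day ht.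
have [[ms _] [mu _] [mv _]] := plan_bids (plan _ hd) dt.
by rewrite (expected_revenue_reduced hK bb ht).
Qed.

End kernels.

End optimal_values.

Theorem theorem2 (R : realType) (S : hydro_system R) (disp : measure_display)
  (Omega : measurableType disp) (P : probability Omega R) (X : market S P)
  (hX : market_assumptions X)
  (K : nat -> Omega -> probability Omega R)
  (hK : forall d, is_day S d -> is_regular_cond_prob P (info_bid X d) (K d))
  (tpi_s tpi_u tpi_v : nat -> Omega -> R)
  (htpi : forall d t, is_day S d -> in_day S d t ->
    [/\ is_cond_exp P (info_bid X d) (pi_s X t) (tpi_s t),
        is_cond_exp P (info_bid X d) (rev_u X t) (tpi_u t) &
        is_cond_exp P (info_bid X d) (rev_v X t) (tpi_v t)]) :
  reduced_planner_value X K = reduced_bidding_value X tpi_s tpi_u tpi_v /\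
  (reduced_bidding_value X tpi_s tpi_u tpi_v <= bidding_value X)%E.
Proof.
have le1 := reduced_bidding_le_planner hX htpi hK.
have le2 := planner_le_reduced_bidding hX htpi hK.
have le3 := planner_le_bidding hX htpi hK.
split; first by apply/eqP; rewrite eq_le le2.
exact: le_trans le1 le3.
Qed.
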